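(* Let $k$ be an algebraically closed field, let $f\in k[x,y,z]$ be a non-singular homogeneous polynomial of degree $3$, and let $R=k[x,y,z]/(f)$. If the (graded, syzygy) symmetric signature $s_\sigma(R)$ exists, then $s_{\sigma}(R)\leq\frac{1}{2}$.
   Context: $f$ non-singular means that $\mathrm{Proj}\,k[x,y,z]/(f)$ is a smooth curve (a plane elliptic curve). $R$ is standard graded of dimension $2$. For a finitely generated graded $R$-module $M$, the graded free rank $\mathrm{frk}_R^{\mathrm{gr}}(M)$ is the maximal $n$ such that there is a homogeneous degree-$0$ split surjection $M\twoheadrightarrow F$ with $F$ a free graded $R$-module of rank $n$ (so summands $R(a)$ with any shift $a\in\mathbb Z$ are counted). $(-)^*=\mathrm{Hom}_R(-,R)$ and $(-)^{**}$ is the double dual. $\mathrm{Syz}_R^2(k)$ is the second syzygy module in the minimal graded free resolution of $k=R/R_+$, and $\mathcal S^q=\left(\mathrm{Sym}^q_R(\mathrm{Syz}_R^2(k))\right)^{**}$ for $q\ge0$. The graded symmetric signature is $$s_{\sigma}(R)=\lim_{N\to+\infty}\frac{\sum_{q=0}^N\mathrm{frk}_R^{\mathrm{gr}}\,\mathcal S^q}{\sum_{q=0}^N\mathrm{rank}_R\,\mathcal S^q},$$ provided the limit exists. *)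

(* Defs.v *)
(* mpoly has to be imported before topology: in the other order the levels of
   their notations clash. *)
From HB Require Import structures.
From mathcomp Require Import all_boot all_order all_algebra.
From mathcomp Require Import ring_quotient perm.
From mathcomp Require Import mpoly freeg.
From mathcomp Require Import boolp classical_sets functions reals.
From mathcomp Require Import topology normedtype sequences.

Set Implicit Arguments.
Unset Strict Implicit.
Unset Printing Implicit Defensive.

Import GRing.Theory.
Import numFieldNormedType.Exports.

Local Open Scope ring_scope.
Local Open Scope quotient_scope.
Local Open Scope classical_set_scope.

Section Span.
Variables (R : comNzRingType) (M : lmodType R) (G : set M).

Definition lin_span : pred M := fun x =>
  `[< exists n (c : 'I_n -> R) (g : 'I_n -> M),
        (forall i, G (g i)) /\ x = \sum_(i < n) c i *: g i >].

Lemma span_submod_closed : submod_closed lin_span.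
Proof.
split.
  by apply/asboolP; exists 0%N, (fun=> 0), (fun=> 0); split=> [[]|] //;
     rewrite big_ord0.
move=> a x y /asboolP[m [c [g [Gg ->]]]] /asboolP[n [d [h [Gh ->]]]].
apply/asboolP; exists (m + n)%N.
exists (fun i => match fintype.split i with inl j => a * c j | inr j => d j end).
exists (fun i => match fintype.split i with inl j => g j | inr j => h j end).
split=> [i|]; first by case: (fintype.split i).
rewrite big_split_ord /= scaler_sumr; congr (_ + _); apply: eq_bigr => i _.
  by rewrite (unsplitK (inl i)) scalerA.
by rewrite (unsplitK (inr i)).
Qed.

HB.instance Definition _ := GRing.isSubmodClosed.Build R M lin_span
  span_submod_closed.

End Span.

(* The quotient of M by the submodule generated by G. *)
Section QuotientModule.
Variables (R : comNzRingType) (M : lmodType R) (G : set M).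

Local Notation span_zmod := (GRing.ZmodClosed.clone M (lin_span G) _).

Definition quot_mod : Type := (Quotient.quot span_zmod).

HB.instance Definition _ := GRing.Zmodule.on quot_mod.

Definition quot_proj (x : M) : quot_mod := \pi_((Quotient.quot span_zmod)) x.

Definition quot_scale (a : R) (x : quot_mod) : quot_mod :=
  quot_proj (a *: repr (x : (Quotient.quot span_zmod))).

Lemma quot_projK (x : quot_mod) : quot_proj (repr (x : (Quotient.quot span_zmod))) = x.
Proof. exact: reprK. Qed.

Lemma quot_projD x y : quot_proj (x + y) = quot_proj x + quot_proj y.
Proof. by rewrite /quot_proj; exact: (raddfD (\pi_((Quotient.quot span_zmod)))). Qed.

Lemma quot_projP x y : quot_proj x = quot_proj y <-> x - y \in lin_span G.
Proof.
rewrite /quot_proj (Quotient.idealrBE span_zmod).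
by split=> [H|/eqP //]; apply/eqP.
Qed.

Lemma quot_projZ a x : quot_proj (a *: x) = quot_scale a (quot_proj x).
Proof.
apply/quot_projP; rewrite -scalerBr; apply: rpredZ.
by apply/quot_projP; rewrite quot_projK.
Qed.

Lemma quot_scaleA a b x :
  quot_scale a (quot_scale b x) = quot_scale (a * b) x.
Proof. by rewrite -[x]quot_projK -!quot_projZ scalerA. Qed.

Lemma quot_scale1 : left_id 1 quot_scale.
Proof. by move=> x; rewrite -[x]quot_projK -!quot_projZ scale1r. Qed.

Lemma quot_scaleDr : right_distributive quot_scale +%R.
Proof.
move=> a x y; rewrite -[x]quot_projK -[y]quot_projK -quot_projD -!quot_projZ.
by rewrite scalerDr quot_projD.
Qed.

Lemma quot_scaleDl x : {morph quot_scale^~ x : a b / a + b}.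
Proof.
move=> a b /=; rewrite -[x]quot_projK -!quot_projZ.
by rewrite scalerDl quot_projD.
Qed.

HB.instance Definition _ := GRing.Zmodule_isLmodule.Build R quot_mod
  quot_scaleA quot_scale1 quot_scaleDr quot_scaleDl.

End QuotientModule.

Section Kernel.
Variables (R : comNzRingType) (U V : lmodType R) (g : {linear U -> V}).

Definition ker_pred : pred U := fun u => g u == 0.

Lemma ker_submod_closed : submod_closed ker_pred.
Proof.
split=> [|a u v]; rewrite !unfold_in /= ?linear0 // => /eqP gu /eqP gv.
by rewrite linearP gu gv scaler0 addr0.
Qed.

HB.instance Definition _ := GRing.isSubmodClosed.Build R U ker_pred
  ker_submod_closed.

Definition ker_mod : Type := {u : U | u \in ker_pred}.

HB.instance Definition _ := SubChoice.on ker_mod.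
HB.instance Definition _ := [SubChoice_isSubLmodule of ker_mod by <:].

End Kernel.

Section Dual.
Variables (R : comNzRingType) (M : lmodType R).

Definition dual_pred : pred (M -> R^o) := fun phi => `[< linear phi >].

Lemma dual_submod_closed : submod_closed dual_pred.
Proof.
split=> [|a phi psi].
  by apply/asboolP => b x y; rewrite scaler0 addr0.
move=> /asboolP lphi /asboolP lpsi; apply/asboolP => b x y.
rewrite !fctE /= lphi lpsi !scalerDr !scalerA (mulrC a b) -!addrA.
by congr (_ + _); rewrite addrCA.
Qed.

HB.instance Definition _ := GRing.isSubmodClosed.Build R (M -> R^o) dual_pred
  dual_submod_closed.

Definition dual_mod : Type := {phi : M -> R^o | phi \in dual_pred}.

HB.instance Definition _ := SubChoice.on dual_mod.
HB.instance Definition _ := [SubChoice_isSubLmodule of dual_mod by <:].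

End Dual.

(* Sym^q(M) is the free module on M^q modulo multilinearity and symmetry. *)
Section SymmetricPower.
Variables (R : comNzRingType) (M : lmodType R) (q : nat).

Definition upd (m : {ffun 'I_q -> M}) (i : 'I_q) (x : M) : {ffun 'I_q -> M} :=
  [ffun j => if j == i then x else m j].

Definition sym_rel : set {freeg {ffun 'I_q -> M} / R} := [set z |
  (exists m i a x y,
     z = << upd m i (a *: x + y) >> - a *: << upd m i x >> - << upd m i y >>)
  \/ (exists (m : {ffun 'I_q -> M}) (s : 'S_q), z = << [ffun j => m (s j)] >> - << m >>)].

Definition sym_mod : Type := quot_mod sym_rel.

HB.instance Definition _ := GRing.Lmodule.on sym_mod.

Definition sym_prod (m : {ffun 'I_q -> M}) : sym_mod :=
  quot_proj sym_rel << m >>.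

End SymmetricPower.

(* A ring (module) with its homogeneous pieces.  The records carry only the
   data: the axioms of a grading are not fields, but hold for each of the
   gradings built below from a finitely generated module. *)
Record gradedRing := GradedRing {
  gring_sort :> comNzRingType;
  rdeg : int -> set gring_sort
}.

Record gradedModule (A : gradedRing) := GradedModule {
  gmod_sort :> lmodType A;
  gdeg : int -> set gmod_sort
}.

Definition homog_map (A : gradedRing) (M N : gradedModule A) (g : M -> N) :=
  forall d x, gdeg d x -> gdeg d (g x).

Section GradedConstructions.
Variable A : gradedRing.

Definition gregular : gradedModule A := @GradedModule A A^o (@rdeg A).

(* The direct sum of the A(a i), where A(a)_d = A_(a + d). *)
Definition gfree (n : nat) (a : 'I_n -> int) : gradedModule A :=
  @GradedModule A 'rV[A]_n
    (fun d => [set v | forall i, rdeg (a i + d) (v ord0 i)]).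

Definition gquot (M : gradedModule A) (G : set M) : gradedModule A :=
  @GradedModule A (quot_mod G) (fun d => quot_proj G @` gdeg d).

Definition gker (M N : gradedModule A) (g : {linear M -> N}) :
    gradedModule A :=
  @GradedModule A (ker_mod g) (fun d => [set u | gdeg d (val u)]).

Definition gdual (M : gradedModule A) : gradedModule A :=
  @GradedModule A (dual_mod M) (fun d => [set phi |
    forall e (x : M), gdeg e x -> rdeg (d + e) (val phi x)]).

(* The scalars r i matter only for q = 0, where Sym^0(M) is A itself. *)
Definition gsym (q : nat) (M : gradedModule A) : gradedModule A :=
  @GradedModule A (sym_mod M q) (fun d => [set z |
    exists n (r : 'I_n -> A) (m : 'I_n -> {ffun 'I_q -> M}),
      z = \sum_(i < n) r i *: sym_prod (m i) /\
      forall i, exists e (b : 'I_q -> int),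
        [/\ rdeg e (r i), forall j, gdeg (b j) (m i j)
          & d = e + \sum_(j < q) b j]]).

Definition positive_part : set A^o :=
  [set r | exists2 d : int, 0 < d & rdeg d (r : A)].

Definition gresidue : gradedModule A :=
  @gquot gregular positive_part.

(* ... -> F_2 -> F_1 -> F_0 -> M -> 0 with F_i the direct sum of the
   A(shift i j), j < betti i. *)
Record minResolution (M : gradedModule A) := MinResolution {
  betti : nat -> nat;
  shift : forall i, 'I_(betti i) -> int;
  augm : {linear gfree (@shift 0%N) -> M};
  bdry : forall i, {linear gfree (@shift i.+1) -> gfree (@shift i)};
  augm_homog : homog_map augm;
  bdry_homog : forall i, homog_map (bdry i);
  augm_surj : forall x, exists v, augm v = x;
  augm_exact : forall v, augm v = 0 <-> exists w, bdry 0%N w = v;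
  bdry_exact : forall i v, bdry i v = 0 <-> exists w, bdry i.+1 w = v;
  bdry_minimal : forall i w j,
    (bdry i w : 'rV[A]_(betti i)) ord0 j \in lin_span positive_part
}.

Definition gsyz2 (M : gradedModule A) (F : minResolution M) :
  gradedModule A := gker (bdry F 0%N).

(* The maximum of P if P is nonempty and bounded, 0 otherwise. *)
Definition max_nat (P : set nat) : nat :=
  xget 0%N [set n | P n /\ forall m, P m -> (m <= n)%N].

Definition has_gfree_quotient (M : gradedModule A) (n : nat) : Prop :=
  exists (a : 'I_n -> int) (p : {linear M -> gfree a})
    (s : {linear gfree a -> M}),
    [/\ homog_map p, homog_map s & cancel s p].

Definition gfrk (M : gradedModule A) : nat := max_nat (has_gfree_quotient M).

(* Over a domain A, this is the dimension of M (x) Frac A. *)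
Definition rank_mod (M : lmodType A) : nat :=
  max_nat [set n | exists v : 'I_n -> M, forall c : 'I_n -> A,
    \sum_(i < n) c i *: v i = 0 -> forall i, c i = 0].

Definition reflexive_sym (M : gradedModule A) (q : nat) : gradedModule A :=
  gdual (gdual (gsym q M)).

Definition symsig_ratio (RR : realType) (M : gradedModule A) (N : nat) : RR :=
  (\sum_(0 <= q < N.+1) gfrk (reflexive_sym M q))%:R /
  (\sum_(0 <= q < N.+1) rank_mod (reflexive_sym M q))%:R.

Definition symsig_exists (RR : realType) (M : gradedModule A) : Prop :=
  cvgn (symsig_ratio RR M).

Definition symsig (RR : realType) (M : gradedModule A) : RR :=
  limn (symsig_ratio RR M).

End GradedConstructions.

Section PlaneCubic.
Variable k : closedFieldType.

(* Jacobian criterion for smoothness of Proj k[x,y,z]/(f); every point of the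
   projective plane over k is given by a nonzero v.  It fails for f = 0. *)
Definition nonsingular (f : {mpoly k[3]}) : Prop :=
  forall v : 'I_3 -> k, (exists i, v i != 0) -> f.@[v] = 0 ->
    exists i, (f^`M(i)).@[v] != 0.

Variable f : dhomog 3 k 3.

Definition cubic_ideal : pred {mpoly k[3]} := fun p =>
  `[< exists g, p = g * (f : {mpoly k[3]}) >].

Lemma cubic_idealr_closed : idealr_closed cubic_ideal.
Proof.
split.
- by apply/asboolP; exists 0; rewrite mul0r.
- apply/asboolP => -[g] /(congr1 (mcoeff 0%MM)).
  have f0 : (f : {mpoly k[3]})@_0%MM = 0.
    case: (f) => p hp /=; apply: (dhomog_nemf_coeff hp).
    by rewrite mf0.
  by rewrite mcoeff1 eqxx rmorphM /= f0 mulr0 => /eqP; rewrite oner_eq0.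
- move=> a u v /asboolP[g ->] /asboolP[h ->]; apply/asboolP.
  by exists (a * g + h); rewrite mulrDl mulrA.
Qed.

HB.instance Definition _ := isIdealr.Build {mpoly k[3]} cubic_ideal
  cubic_idealr_closed.

Definition cubic_idealr : idealr {mpoly k[3]} := Idealr.clone _ cubic_ideal _.

Definition coord_ring : gradedRing :=
  @GradedRing {ideal_quot cubic_idealr} (fun e => [set r |
    match e with
    | Posz n => exists2 p : {mpoly k[3]}, p \is n.-homog
                  & r = \pi_({ideal_quot cubic_idealr}) p
    | Negz _ => r = 0
    end]).

End PlaneCubic.

(* Main.v *)
(* Up to a shift, Syz^2(k) is {w in R^3 | x w_0 + y w_1 + z w_2 = 0}, a bundle of
   rank 2 on the elliptic curve.  A graded free summand of S^q gives a form Phi on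
   Sym^q and a section P of S^q that pair to 1 and have degrees of sum q.  Pull
   both back along the tangential map G (t to -2t), which is given by forms of
   degree 4.  The tangent line at t passes through G(t), so n = grad f(t), of
   degree 2, lies in the pulled-back bundle G^perp; it spans a subbundle of the
   same slope as G^perp.  Hence Phi vanishes if 4 deg Phi < 2q and P vanishes if
   4 deg P < 2q, so that deg Phi = deg P = q/2 and q is even.  For odd q the free
   rank is thus 0, for even q it is at most the rank q+1, and the sums over
   q < 2m give a ratio at most 1/2.  This is valid in every characteristic. *)

Require Import Defs.
From HB Require Import structures.
From mathcomp Require Import all_boot all_order all_algebra.
From mathcomp Require Import ring_quotient perm.
From mathcomp Require Import mpoly freeg.
From mathcomp Require Import boolp classical_sets functions reals.
From mathcomp Require Import topology normedtype sequences.
From mathcomp Require Import fieldext generic_quotient.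
From mathcomp Require Import ring zify.

Set Implicit Arguments.
Unset Strict Implicit.
Unset Printing Implicit Defensive.

Import Order.TTheory GRing.Theory Num.Theory.
Import numFieldNormedType.Exports.
Local Open Scope ring_scope.

(** In units of O(1) the bundle has slope -1/2, which is what separates odd from even q; for the
    same reason no line bundle O(a) has the slope of the bundle, and one would have to appeal to
    semistability of symmetric powers. The pullback removes this obstacle: G^perp is the kernel of
    O^3 -> O(4), n embeds O(-2) into it and the quotient is again O(-2). Every vanishing statement
    then reduces to the absence of sections of negative degree. Phi and P need separate arguments
    because symmetric tensors and symmetric powers differ in small characteristic. Phi is a
    symmetric multilinear form and is contracted slot by slot; P has no such polarization and is
    expanded as a binary form. Both arguments divide by coordinates of n and G, and the quotients
    must again be sections. Sections are therefore elements of the function field with a degree, and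
    a quotient is recognized as regular by multiplying it with a family without common zeros. This
    rests on the normality of R, which is derived from a Nullstellensatz on two affine charts. *)

(** * A Nullstellensatz in two variables *)

Section Nullstellensatz.

Variable F : closedFieldType.

(** Euclidean descent: some member q of the ideal does not vanish at a root of p, so q mod p is a
    nonzero member of smaller size. The descent ends at a nonzero constant. *)
Lemma one_in_ideal_poly (J : {poly F} -> Prop) :
  (forall p q, J p -> J q -> J (p + q)) ->
  (forall a p, J p -> J (a * p)) ->
  (forall x, exists2 p, J p & p.[x] != 0) -> J 1.
Proof.
move=> JD JM J0.
have [p0 Jp0 p00] := J0 0.
have {p00} : p0 != 0 by apply: contraNneq p00 => ->; rewrite horner0.
have [n] := ubnP (size p0); elim: n p0 Jp0 => // n IH p Jp lepn p_neq0.
have [/eqP/size_poly1P[c c0 pc]|p_nc] := eqVneq (size p) 1%N.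
  by have := JM c^-1%:P _ Jp; rewrite pc -polyCM mulVf.
have [x /rootP px] := closed_rootP p p_nc.
have [q Jq qx] := J0 x.
apply: (IH (q %% p)).
- suff -> : q %% p = q + - (q %/ p) * p by apply: JD => //; apply: JM.
  by rewrite {2}(divp_eq q p) mulNr addrAC subrr add0r.
- by apply: leq_trans (ltn_modpN0 q p_neq0) _.
- apply: contraNneq qx => qp; rewrite (divp_eq q p) qp addr0 hornerM px.
  by rewrite mulr0.
Qed.

(** Elimination of the outer variable: the monic [m] makes the quotient finite over [{poly F}], so a
    Nakayama argument yields members of [J] free of that variable, to which the case of one variable
    applies. *)
Lemma one_in_ideal_poly2 (J : {poly {poly F}} -> Prop) (m : {poly {poly F}}) :
  (forall p q, J p -> J q -> J (p + q)) ->
  (forall a p, J p -> J (a * p)) ->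
  m \is monic -> J m ->
  (forall x y, exists2 p, J p & p.[y%:P].[x] != 0) -> J 1.
Proof.
move=> JD JM m_mon Jm J0.
have Jz : J 0 by rewrite -(mul0r m); apply: JM.
have Jsum (I : finType) (g : I -> {poly {poly F}}) :
  (forall i, J (g i)) -> J (\sum_i g i) by move=> Jg; apply: big_ind.
suff Jx x0 : exists2 d : {poly F}, J d%:P & d.[x0] != 0.
  pose J' d := J d%:P.
  suff : J' 1 by [].
  apply: (@one_in_ideal_poly J') => [p q|a p|//].
    by rewrite /J' polyCD; apply: JD.
  by rewrite /J' polyCM; apply: JM.
(* On the fibre over [x0] there is no common zero, so the case of one variable gives a member
   congruent to 1 modulo X - x0. *)
have [a Ja a1] : exists2 a, J a & map_poly (horner_eval x0) a = 1.
  pose J' g := exists2 a, J a & map_poly (horner_eval x0) a = g.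
  apply: (@one_in_ideal_poly J').
  - move=> _ _ [p Jp <-] [q Jq <-]; exists (p + q); first exact: JD.
    by rewrite rmorphD.
  - move=> g _ [p Jp <-]; exists (map_poly polyC g * p); first exact: JM.
    rewrite rmorphM /=; congr (_ * _); apply/polyP => i.
    by rewrite !coef_map /= /horner_eval hornerC.
  - move=> y; have [p Jp pxy] := J0 x0 y.
    exists (map_poly (horner_eval x0) p); first by exists p.
    have <- : p.[y%:P].[x0] = (map_poly (horner_eval x0) p).[y] => //.
    by rewrite -[in RHS](hornerC y x0) -[y%:P.[x0]]/(horner_eval x0 y%:P) horner_map.
pose u : {poly F} := 'X - x0%:P.
have [b ab] : exists b, 1 - a = u%:P * b.
  exists (map_poly (fun c : {poly F} => c %/ u) (1 - a)).
  apply/polyP => i; rewrite coefCM coef_map_id0 ?div0p //.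
  rewrite mulrC divpK // dvdp_XsubCl; apply/rootP.
  have := congr1 (fun p : {poly F} => p`_i) a1.
  rewrite coef_map /= /horner_eval coefB hornerD hornerN => ->.
  by rewrite !coef1; case: (i == 0)%N; rewrite ?hornerC ?horner0 subrr.
pose n := (size m).-1.
have [n0|n_gt0] := posnP n.
  have sm : size m = 1%N.
    by rewrite -[LHS]prednK ?size_poly_gt0 ?monic_neq0 // -/n n0.
  have ms := size1_polyC (eq_leq sm).
  exists 1; last by rewrite hornerC oner_eq0.
  suff -> : 1%:P = m by [].
  by move: m_mon; rewrite ms monicE lead_coefC => /eqP ->.
(* [beta] is multiplication by [b] modulo [m] in the basis of powers, so [N] is multiplication by 1
   - u b = a, and each of its rows represents a member of [J]. *)
pose beta : 'M[{poly F}]_n :=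
  \matrix_(i, j) (Pdiv.Ring.rmodp (b * 'X^i) m)`_j.
pose N : 'M[{poly F}]_n := 1%:M - u *: beta.
have m0 := monic_neq0 m_mon.
have betaE (i : 'I_n) :
    \sum_(j < n) (beta i j)%:P * 'X^j = Pdiv.Ring.rmodp (b * 'X^i) m.
  set r := Pdiv.Ring.rmodp _ _.
  have sr : (size r <= n)%N.
    have : (size r < size m)%N by rewrite Pdiv.Ring.ltn_rmodp.
    by rewrite -[size m]prednK ?size_poly_gt0.
  apply/polyP => l; rewrite coef_sum.
  have [ln|nl] := ltnP l n.
    rewrite (bigD1 (Ordinal ln)) //= coefCM coefXn eqxx mulr1 mxE big1 ?addr0 //.
    move=> j /negPf jl; rewrite coefCM coefXn.
    by rewrite -val_eqE /= in jl; rewrite eq_sym jl mulr0.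
  rewrite big1 ?(nth_default _ (leq_trans sr nl)) // => j _.
  by rewrite coefCM coefXn gtn_eqF ?mulr0 // (leq_trans (ltn_ord j)).
have JN (i : 'I_n) : J (\sum_(j < n) (N i j)%:P * 'X^j).
  have -> : \sum_(j < n) (N i j)%:P * 'X^j =
      'X^i * a + u%:P * Pdiv.Ring.rdivp (b * 'X^i) m * m.
    transitivity ('X^i - u%:P * Pdiv.Ring.rmodp (b * 'X^i) m).
      rewrite -betaE mulr_sumr -[X in X - _](mulr1 'X^i).
      rewrite -[in X in X - _](_ : \sum_(j < n) ((i == j)%:R)%:P * 'X^j = 'X^i).
        rewrite mulr1 -sumrB; apply: eq_bigr => j _.
        by rewrite !mxE polyCB mulrBl polyCM mulrA.
      rewrite (bigD1 i) //= eqxx mul1r big1 ?addr0 // => j /negPf ji.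
      by rewrite eq_sym ji mul0r.
    have := Pdiv.RingMonic.rdivp_eq m_mon (b * 'X^i).
    set q := Pdiv.Ring.rdivp _ _; set r := Pdiv.Ring.rmodp _ _ => e.
    have -> : r = b * 'X^i - q * m by rewrite e addrAC subrr add0r.
    rewrite mulrBr mulrA -ab; ring.
  by apply: JD; apply: JM.
(* The adjugate combines the rows of [N] into its determinant, which takes the value 1 at [x0]
   because [u] vanishes there. *)
exists (\det N).
  have := Jsum _ (fun k : 'I_n => (\adj N (Ordinal n_gt0) k)%:P *
    \sum_(j < n) (N k j)%:P * 'X^j) (fun k => JM _ _ (JN k)).
  under eq_bigr => k _ do rewrite mulr_sumr.
  rewrite exchange_big /= => H.
  suff <- : \sum_(j < n) (\adj N *m N) (Ordinal n_gt0) j *: 'X^j = (\det N)%:P.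
    move: H; congr (J _); apply: eq_bigr => j _.
    rewrite mxE scaler_suml; apply: eq_bigr => k _.
    by rewrite mulrA -polyCM mul_polyC.
  rewrite mul_adj_mx (bigD1 (Ordinal n_gt0)) //= mxE eqxx expr0 alg_polyC.
  rewrite big1 ?addr0 // => j /negPf j0.
  by rewrite mxE eq_sym j0 scale0r.
rewrite -[_.[_]]/(horner_eval x0 _) -det_map_mx.
have -> : map_mx (horner_eval x0) N = 1%:M.
  apply/matrixP => i j; rewrite !mxE /= /horner_eval hornerD hornerN hornerM.
  rewrite hornerXsubC subrr mul0r subr0.
  by case: (i == j); rewrite ?hornerC ?horner0.
by rewrite det1 oner_eq0.
Qed.

End Nullstellensatz.

(** * Cubic forms *)

Section Homogeneous.

Variables (n : nat) (k : comNzRingType).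
Implicit Types (p q : {mpoly k[n]}) (m : 'X_{1..n}).

Lemma mdegS_U m d : mdeg m = d.+1 ->
  exists i m', m = (U_(i) + m')%MM /\ mdeg m' = d.
Proof.
move=> md; have [i mi] : exists i, (m i != 0)%N.
  apply/existsP; apply: contra_eqT md; rewrite negb_exists => /forallP m0.
  rewrite mdegE big1 // => i _.
  by move: (m0 i); rewrite negbK => /eqP.
have le : (U_(i) <= m)%MM.
  by apply/mnm_lepP => j; rewrite mnm1E; case: eqP => // <-; rewrite lt0n.
exists i, (m - U_(i))%MM; split; first by rewrite addmC submK.
by apply/eqP; rewrite -eqSS -md -{2}(submK le) mdegD mdeg1 addn1.
Qed.

Lemma dhomog_ind_monomial d (P : {mpoly k[n]} -> Prop) :
  P 0 -> (forall p q, P p -> P q -> P (p + q)) ->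
  (forall c p, P p -> P (c *: p)) ->
  (forall m, mdeg m = d -> P 'X_[m]) ->
  forall p, p \is d.-homog -> P p.
Proof.
move=> P0 PD PZ PX p /dhomogP hp; rewrite (mpolyE p) big_seq.
by apply: big_ind => // m /hp md; apply/PZ/PX.
Qed.

Lemma dhomog_ind (P : nat -> {mpoly k[n]} -> Prop) :
  (forall d, P d 0) -> (forall d p q, P d p -> P d q -> P d (p + q)) ->
  (forall d c p, P d p -> P d (c *: p)) ->
  P 0%N 1 -> (forall d i p, P d p -> P d.+1 ('X_i * p)) ->
  forall d p, p \is d.-homog -> P d p.
Proof.
move=> P0 PD PZ P1 PX d; apply: dhomog_ind_monomial => //.
- exact: PD.
- exact: PZ.
elim: d => [|d IH] m.
  by move/eqP; rewrite mdeg_eq0 => /eqP->; rewrite mpolyX0.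
by case/mdegS_U => i [m' [-> /IH Pm']]; rewrite mpolyXD; apply: PX.
Qed.

Lemma dhomog_mderiv d i p : p \is d.+1.-homog -> p^`M(i) \is d.-homog.
Proof.
move: p; apply: (@dhomog_ind_monomial d.+1 (fun p => p^`M(i) \is d.-homog))
  => [|q r hq hr|c q hq|m md].
- by rewrite raddf0 rpred0.
- by rewrite raddfD rpredD.
- by rewrite mderivZ rpredZ.
rewrite mderivX; have [mi|mi] := eqVneq (m i) 0%N.
  by rewrite mi scale0r rpred0.
apply: rpredZ; rewrite dhomogX; apply/eqP.
have le : (U_(i) <= m)%MM.
  by apply/mnm_lepP => j; rewrite mnm1E; case: eqP => // <-; rewrite lt0n.
by apply/eqP; rewrite -eqSS -md -{2}(submK le) mdegD mdeg1 addn1.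
Qed.

Lemma eq_mmap (L : nzRingType) (phi : {additive k -> L}) (u v : 'I_n -> L) p :
  u =1 v -> mmap phi u p = mmap phi v p.
Proof.
move=> uv; apply: eq_bigr => m _; congr (_ * _).
by apply: eq_bigr => i _; rewrite uv.
Qed.

Lemma mmap_scale_homog (L : comNzRingType) (phi : {rmorphism k -> L}) v c d p :
  p \is d.-homog -> mmap phi (fun i => c * v i) p = c ^+ d * mmap phi v p.
Proof.
move: d p; apply: (@dhomog_ind (fun d p =>
  mmap phi (fun i => c * v i) p = c ^+ d * mmap phi v p))
  => [d|d p q hp hq|d a p hp||d i p hp].
- by rewrite !raddf0 mulr0.
- by rewrite !mmapD hp hq mulrDr.
- by rewrite !mmapZ hp mulrCA.
- by rewrite !rmorph1 mulr1.
by rewrite !rmorphM /= !mmapX !mmap1U hp exprS; ring.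
Qed.

End Homogeneous.

Notation o0 := (@Ordinal 3 0 isT).
Notation o1 := (@Ordinal 3 1 isT).
Notation o2 := (@Ordinal 3 2 isT).

Lemma ord3P (P : 'I_3 -> Prop) : P o0 -> P o1 -> P o2 -> forall i, P i.
Proof.
by move=> P0 P1 P2 [[|[|[|//]]] lt]; [move: P0|move: P1|move: P2];
  congr P; apply: val_inj.
Qed.

Lemma sum3 (V : nmodType) (F : 'I_3 -> V) :
  \sum_i F i = F o0 + F o1 + F o2.
Proof.
rewrite !big_ord_recl big_ord0 addr0 addrA.
by congr (F _ + F _ + F _); apply: val_inj.
Qed.

(** Cyclic successor: j, nx j and nx (nx j) are the three indices in positive order, so one formula
    serves all components of [cross] and all three charts. *)
Definition nx (i : 'I_3) : 'I_3 :=
  match val i with 0%N => o1 | 1%N => o2 | _ => o0 end.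

Section Vectors.

Variable A : comNzRingType.
Implicit Types u v w : 'I_3 -> A.

Definition dot u v := \sum_i u i * v i.
Definition cross u v : 'I_3 -> A :=
  fun i => u (nx i) * v (nx (nx i)) - u (nx (nx i)) * v (nx i).
Definition unitv (j : 'I_3) : 'I_3 -> A := fun i => (i == j)%:R.

End Vectors.

Ltac vec3 := rewrite /cross /dot /unitv ?sum3 /nx /=.

Section CubicForm.

Variables (k L : comNzRingType) (phi : {rmorphism k -> L}).
Implicit Types (f : {mpoly k[3]}) (u v w t e : 'I_3 -> L).

Local Notation "f ^@ u" := (mmap phi u f) (at level 10).

Definition grad f u : 'I_3 -> L := fun a => f^`M(a) ^@ u.

Lemma cubic_ind (P : {mpoly k[3]} -> Prop) :
  P 0 -> (forall p q, P p -> P q -> P (p + q)) ->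
  (forall c p, P p -> P (c *: p)) ->
  (forall a b c, P ('X_a * 'X_b * 'X_c)) ->
  forall p, p \is 3.-homog -> P p.
Proof.
move=> P0 PD PZ PX; apply: dhomog_ind_monomial => // m.
case/mdegS_U => a [m1 [-> /mdegS_U[b [m2 [-> /mdegS_U[c [m3 [-> /eqP]]]]]]]].
rewrite mdeg_eq0 => /eqP->; rewrite addm0 !mpolyXD mulrA; exact: PX.
Qed.

Lemma mevalX3 a b c u : ('X_a * 'X_b * 'X_c) ^@ u = u a * u b * u c.
Proof. by rewrite !rmorphM /= !mmapX !mmap1U. Qed.

Lemma mmapXU u i : 'X_i ^@ u = u i.
Proof. by rewrite mmapX mmap1U. Qed.

Lemma mmap_delta u (i j : 'I_3) : ('X_i)^`M(j) ^@ u = (i == j)%:R.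
Proof.
rewrite mderivX mmapZ mnm1E; case: eqP => [->|_] /=.
  have -> : (U_(j) - U_(j) = 0)%MM by apply/mnmP => l; rewrite mnmBE subnn mnm0E.
  by rewrite rmorph1 mul1r mmapX mmap11.
by rewrite rmorph0 mul0r.
Qed.

Lemma dot_deltal (F : 'I_3 -> L) i : \sum_a (i == a)%:R * F a = F i.
Proof.
rewrite (bigD1 i) //= eqxx mul1r big1 ?addr0 // => j /negPf ji.
by rewrite eq_sym ji mul0r.
Qed.

Lemma dot_gradX3 a b c u v : dot (grad ('X_a * 'X_b * 'X_c) u) v =
  v a * u b * u c + u a * v b * u c + u a * u b * v c.
Proof.
rewrite /dot /grad; under eq_bigr => i _.
  rewrite !mderivM !rmorphD /= !rmorphM /= !rmorphD /= !rmorphM /=.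
  rewrite !mmap_delta !mmapXU.
  have -> : forall x y z : L, ((x * u b + u a * y) * u c + u a * u b * z) * v i =
    x * (v i * (u b * u c)) + y * (v i * (u a * u c)) + z * (v i * (u a * u b)).
    by move=> *; ring.
  over.
by rewrite !big_split /= !dot_deltal; ring.
Qed.

Lemma dot_gradD f g u v : dot (grad (f + g) u) v = dot (grad f u) v + dot (grad g u) v.
Proof.
rewrite /dot -big_split; apply: eq_bigr => i _.
by rewrite /grad !raddfD /= mulrDl.
Qed.

Lemma dot_gradZ c f u v : dot (grad (c *: f) u) v = phi c * dot (grad f u) v.
Proof.
rewrite /dot mulr_sumr; apply: eq_bigr => i _.
by rewrite /grad mderivZ mmapZ mulrA.
Qed.

Lemma dot_grad0 u v : dot (grad 0 u) v = 0.
Proof. by rewrite /dot big1 // => i _; rewrite /grad !raddf0 mul0r. Qed.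

(** Both sides are linear in f and agree on products of three coordinates. The mixed coefficients
    are gradients at u and at v, so no division by 2 occurs. *)
Lemma cubic_taylor f (hf : f \is 3.-homog) u v a b :
  f ^@ (fun i => a * u i + b * v i) =
  a ^+ 3 * f ^@ u + a ^+ 2 * b * dot (grad f u) v
  + a * b ^+ 2 * dot (grad f v) u + b ^+ 3 * f ^@ v.
Proof.
move: f hf; apply: cubic_ind => [|p q hp hq|c p hp|x y z].
- by rewrite !raddf0 !dot_grad0 !mulr0 !addr0.
- by rewrite !mmapD !dot_gradD hp hq; ring.
- by rewrite !mmapZ !dot_gradZ hp; ring.
by rewrite !mevalX3 !dot_gradX3; ring.
Qed.

Lemma cubic_grad_line f (hf : f \is 3.-homog) u v a b :
  dot (grad f (fun i => a * u i + b * v i)) v =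
  a ^+ 2 * dot (grad f u) v + 2%:R * a * b * dot (grad f v) u
  + 3%:R * b ^+ 2 * f ^@ v.
Proof.
move: f hf; apply: cubic_ind => [|p q hp hq|c p hp|x y z].
- by rewrite !raddf0 !dot_grad0 !mulr0 !addr0.
- by rewrite !mmapD !dot_gradD hp hq; ring.
- by rewrite !mmapZ !dot_gradZ hp; ring.
by rewrite !mevalX3 !dot_gradX3; ring.
Qed.

Lemma cubic_euler f (hf : f \is 3.-homog) u :
  dot (grad f u) u = 3%:R * f ^@ u.
Proof.
move: f hf; apply: cubic_ind => [|p q hp hq|c p hp|x y z].
- by rewrite !raddf0 !dot_grad0 !mulr0.
- by rewrite !mmapD !dot_gradD hp hq; ring.
- by rewrite !mmapZ !dot_gradZ hp; ring.
by rewrite !mevalX3 !dot_gradX3; ring.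
Qed.

(* The second intersection of the tangent line at t with the cubic.  The line
   meets {x | dot e x = 0} in w = e x grad f t, and f (a t + b w) =
   b^2 (a dot (grad f w) t + b f w); tang carries the factor (dot e t)^3. *)
Definition tangw f e t := cross e (grad f t).
Definition tang f e t : 'I_3 -> L := fun i =>
  f ^@ (tangw f e t) * t i
  - dot (grad f (tangw f e t)) t * tangw f e t i.

Section Tangent.

Variables (f : {mpoly k[3]}) (hf : f \is 3.-homog) (t : 'I_3 -> L).
Hypothesis ft : f ^@ t = 0.

Lemma tang_gradt : dot (grad f t) t = 0.
Proof. by rewrite cubic_euler // ft mulr0. Qed.

Lemma tang_gradw e : dot (grad f t) (tangw f e t) = 0.
Proof. rewrite /tangw; vec3; ring. Qed.

Lemma tang_grad e : dot (grad f t) (tang f e t) = 0.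
Proof.
have -> : dot (grad f t) (tang f e t) =
    f ^@ (tangw f e t) * dot (grad f t) t
    - dot (grad f (tangw f e t)) t * dot (grad f t) (tangw f e t).
  rewrite /tang; move: (tangw f e t) (grad f t) => w n.
  by move: (f ^@ w) (dot (grad f w) t) => a b; vec3; ring.
by rewrite tang_gradt tang_gradw; ring.
Qed.

Lemma tang_on_cubic e : f ^@ (tang f e t) = 0.
Proof.
set w := tangw f e t.
have -> : f ^@ (tang f e t) =
    f ^@ (fun i => f ^@ w * t i + (- dot (grad f w) t) * w i).
  by apply: eq_mmap => //; move=> i; rewrite /tang -/w; ring.
by rewrite cubic_taylor // ft tang_gradw -/w; ring.
Qed.

(** The residual point depends only on the tangent line: up to the factors dot e t and dot e' t, the
    two vectors [tangw] differ by a multiple of t. The cubes are later divided out to get a point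
    independent of e. *)
Lemma tang_change e e' i :
  dot e' t ^+ 3 * tang f e t i = dot e t ^+ 3 * tang f e' t i.
Proof.
set w := tangw f e t; set w' := tangw f e' t.
set mu := dot e (cross e' (grad f t)).
(* The defect of this relation is a multiple of dot (grad f t) t, which is 0 by Euler's formula. *)
have ww' j : dot e' t * w j = dot e t * w' j + (- mu) * t j.
  have gt := tang_gradt; rewrite /w /w' /tangw /mu.
  move: gt; move: (grad f t) => n gt.
  have : dot e' t * cross e n j - (dot e t * cross e' n j + - dot e (cross e' n) * t j) =
    dot n t * (cross e e' j); last by rewrite gt mul0r => /eqP; rewrite subr_eq0 => /eqP.
  by move: j; apply: ord3P; vec3; ring.
have fw : dot e' t ^+ 3 * f ^@ w = dot e t ^+ 3 * f ^@ w' +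
    dot e t ^+ 2 * (- mu) * dot (grad f w') t.
  rewrite -mmap_scale_homog //.
  have -> : f ^@ (fun i => dot e' t * w i) =
     f ^@ (fun i => dot e t * w' i + (- mu) * t i) by apply: eq_mmap.
  by rewrite cubic_taylor // ft tang_gradw; ring.
have gw : dot e' t ^+ 2 * dot (grad f w) t = dot e t ^+ 2 * dot (grad f w') t.
  have -> : dot e' t ^+ 2 * dot (grad f w) t =
      dot (grad f (fun i => dot e' t * w i)) t.
    rewrite /dot mulr_sumr; apply: eq_bigr => j _.
    rewrite /grad mulrA; congr (_ * _); apply/esym.
    by apply: mmap_scale_homog; apply: dhomog_mderiv.
  have -> : dot (grad f (fun i => dot e' t * w i)) t =
      dot (grad f (fun i => dot e t * w' i + (- mu) * t i)) t.
    by apply: eq_bigr => j _; congr (_ * _); apply: eq_mmap.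
  by rewrite cubic_grad_line // ft tang_gradw; ring.
rewrite /tang -/w -/w'.
transitivity ((dot e' t ^+ 3 * f ^@ w) * t i -
  (dot e' t ^+ 2 * dot (grad f w) t) * (dot e' t * w i)); first by ring.
by rewrite fw gw ww'; ring.
Qed.

(** Ensures that t and [tangw] span the tangent line when dot e t and the gradient are nonzero. *)
Lemma cross_tangw e i : cross t (tangw f e t) i = - (dot e t * grad f t i).
Proof.
have : cross t (tangw f e t) i =
    e i * dot (grad f t) t - dot e t * grad f t i.
  by rewrite /tangw; move: (grad f t) => n; move: i; apply: ord3P; vec3; ring.
by rewrite tang_gradt mulr0 sub0r.
Qed.

End Tangent.

End CubicForm.

Section LinePolynomial.

Variables (n : nat) (k B : comNzRingType) (phi : {rmorphism k -> B}).
Variables u v : 'I_n -> B.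

Definition line_poly (p : {mpoly k[n]}) : {poly B} :=
  mmap (polyC \o phi) (fun i => (u i)%:P + (v i)%:P * 'X) p.

(** The coefficient in degree d sees the point v, which the affine parametrization u + X v
    misses. *)
Lemma line_poly_homog d p : p \is d.-homog ->
  (size (line_poly p) <= d.+1)%N /\ (line_poly p)`_d = mmap phi v p.
Proof.
move: d p; apply: (@dhomog_ind _ _ (fun d p =>
  (size (line_poly p) <= d.+1)%N /\ (line_poly p)`_d = mmap phi v p)).
- by move=> d; rewrite /line_poly !raddf0 size_poly0 coef0.
- move=> d p q [sp hp] [sq hq]; rewrite /line_poly !mmapD coefD; split.
    by apply: leq_trans (size_polyD _ _) _; rewrite geq_max sp.
  by rewrite hp hq.
- move=> d c p [sp hp]; rewrite /line_poly !mmapZ /= coefCM; split.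
    by rewrite mul_polyC (leq_trans (size_scale_leq _ _)).
  by rewrite hp.
- by rewrite /line_poly !rmorph1 size_poly1 coef1.
move=> d i p [sp hp]; rewrite /line_poly !rmorphM /= !mmapX !mmap1U; split.
  apply: leq_trans (size_polyMleq _ _) _.
  have : (size ((u i)%:P + (v i)%:P * 'X)%R <= 2)%N.
    by rewrite addrC size_MXaddC; case: ifP => // _; rewrite ltnS size_polyC leq_b1.
  by move=> s2; rewrite -subn1 leq_subLR; exact: (leq_add s2 sp).
rewrite mulrDl coefD coefCM (nth_default 0 sp) mulr0 add0r -mulrA coefCM.
by rewrite coefXM /= hp.
Qed.

Lemma line_poly_horner p b :
  (line_poly p).[b] = mmap phi (fun i => u i + b * v i) p.
Proof.
rewrite /line_poly /mmap horner_sum; apply: eq_bigr => m _.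
rewrite hornerM hornerC; congr (_ * _).
rewrite horner_prod; apply: eq_bigr => i _.
by rewrite horner_exp hornerD hornerM !hornerC hornerX mulrC.
Qed.

End LinePolynomial.

Lemma cross_parallel (A : comNzRingType) (u v : 'I_3 -> A) :
  (forall j, cross u v j = 0) -> forall a b, u a * v b = u b * v a.
Proof.
move=> c0; move: (c0 o0) (c0 o1) (c0 o2); rewrite /cross /nx /=.
move=> /subr0_eq e0 /subr0_eq e1 /subr0_eq e2.
by apply: ord3P; apply: ord3P.
Qed.

Lemma cross_cross (A : comNzRingType) (u v w : 'I_3 -> A) l :
  cross u (cross v w) l = v l * dot u w - w l * dot u v.
Proof. by move: l; apply: ord3P; vec3; ring. Qed.

(** * Smooth cubics contain no line *)

Section NoLine.

Variable k : closedFieldType.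
Implicit Types (f : {mpoly k[3]}) (u v : 'I_3 -> k).

Definition no_line f := forall u v,
  (forall a b, (forall i, a * u i + b * v i = 0) -> a = 0 /\ b = 0) ->
  exists a b, mmap idfun (fun i => a * u i + b * v i) f != 0.

(** If p were not constant, p - 1 would have the same size and a root, at which p is 1. *)
Lemma poly_vanish (p : {poly k}) : (forall x, p.[x] = 0) -> p = 0.
Proof.
move=> p0; have [sp|sp] := leqP (size p) 1.
  by rewrite (size1_polyC sp); have := p0 0; rewrite horner_coef0 => ->.
have : size (p - 1) != 1%N.
  by rewrite size_polyDl ?gtn_eqF // size_polyN size_poly1.
case/closed_rootP => x /rootP; rewrite hornerD hornerN hornerC p0 sub0r.
by move/eqP; rewrite oppr_eq0 oner_eq0.
Qed.

Lemma cubic_vanish_line f (hf : f \is 3.-homog) u v :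
  (forall a b, mmap idfun (fun i => a * u i + b * v i) f = 0) ->
  [/\ mmap idfun u f = 0, dot (grad idfun f u) v = 0,
      dot (grad idfun f v) u = 0 & mmap idfun v f = 0].
Proof.
move=> H.
pose p : {poly k} := (mmap idfun u f)%:P + dot (grad idfun f u) v *: 'X +
  dot (grad idfun f v) u *: 'X^2 + mmap idfun v f *: 'X^3.
have p0 : p = 0.
  apply: poly_vanish => x; rewrite -[RHS](H 1 x) cubic_taylor // /p.
  by rewrite !hornerD !hornerZ hornerC !hornerXn hornerX; ring.
have c i : p`_i = 0 by rewrite p0 coef0.
move: (c 0%N) (c 1%N) (c 2%N) (c 3%N).
by rewrite /p !coefD !coefZ !coefC !coefX !coefXn /= !(mulr0, mulr1, addr0, add0r).
Qed.

Lemma cross_indep u v :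
  (forall a b, (forall i, a * u i + b * v i = 0) -> a = 0 /\ b = 0) ->
  exists j, cross u v j != 0.
Proof.
move=> ind; apply/existsP; apply: contraT; rewrite negb_exists => /forallP h0.
have c0 j : cross u v j = 0 by apply/eqP; move: (h0 j); rewrite negbK.
have [[i ui]|u0] := altP (@existsP _ (fun i => u i != 0)); last first.
  have [] := ind 1 0; last by move/eqP; rewrite oner_eq0.
  move=> i; rewrite mul1r mul0r addr0; apply/eqP; apply: contraNT u0 => ui.
  by apply/existsP; exists i.
have [] := ind (v i) (- u i); last by move=> _ /eqP; rewrite oppr_eq0 (negPf ui).
move=> j; rewrite mulNr -(cross_parallel c0); ring.
Qed.

(** If f vanishes on the line through u and v, its gradients there are orthogonal to u and v, hence
    multiples of cross u v. The multiple is a quadratic form on the line and has a zero over k,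
    which is a singular point. *)
Lemma nonsingular_no_line f (hf : f \is 3.-homog) :
  (forall v, (exists i, v i != 0) -> mmap idfun v f = 0 ->
     exists i, mmap idfun v (f^`M(i)) != 0) -> no_line f.
Proof.
move=> ns u v ind; apply: contrapT => H.
have {}H a b : mmap idfun (fun i => a * u i + b * v i) f = 0.
  by apply/eqP; apply: contrapT => /negP h; apply: H; exists a, b.
have [fu guv gvu fv] := cubic_vanish_line hf H.
have [j lj] := cross_indep ind.
have sing a b : mmap idfun (fun i => a * u i + b * v i) (f^`M(j)) = 0 ->
    a = 0 /\ b = 0.
  move=> gj; apply: ind => i; apply/eqP; apply: contraT => pi.
  set p := fun i => a * u i + b * v i.
  have [|l] := ns p _ (H a b); first by exists i.
  have gv : dot (grad idfun f p) v = 0.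
    by rewrite cubic_grad_line // guv gvu fv; ring.
  have gu : dot (grad idfun f p) u = 0.
    have -> : dot (grad idfun f p) u =
        dot (grad idfun f (fun i => b * v i + a * u i)) u.
      by apply: eq_bigr => z _; congr (_ * _); apply: eq_mmap => y; rewrite addrC.
    by rewrite cubic_grad_line // guv gvu fu; ring.
  case/negP; apply/eqP.
  have cr : grad idfun f p l * cross u v j = grad idfun f p j * cross u v l.
    by apply: cross_parallel => z; rewrite cross_cross gu gv; ring.
  by apply/(mulIf lj); rewrite [LHS]cr [grad _ _ _ _]gj !mul0r.
(* Either the partial derivative vanishes at v, or its restriction to u + X v has degree 2 and a
   root. *)
pose q := line_poly idfun u v (f^`M(j)).
have [sq q2] := line_poly_homog idfun u v (dhomog_mderiv j hf).
have [v0|vn0] := eqVneq (mmap idfun v (f^`M(j))) 0.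
  have [] := sing 0 1; last by move=> _ /eqP; rewrite oner_eq0.
  by rewrite -[RHS]v0; apply: eq_mmap => i; ring.
have : size q != 1%N.
  apply: contraNneq vn0 => q1; rewrite -q2 nth_default // -/q q1 //.
case/closed_rootP => b /rootP; rewrite line_poly_horner => qb.
have [] := sing 1 b; last by move/eqP; rewrite oner_eq0.
by rewrite -[RHS]qb; apply: eq_mmap => i; ring.
Qed.

Lemma no_line_nonzero f (hf : f \is 3.-homog) : no_line f ->
  exists v, mmap idfun v f != 0.
Proof.
move=> /(_ (unitv k o0) (unitv k o1)) [|a [b h]].
  move=> a b h; move: (h o0) (h o1).
  by rewrite /unitv /= !(mulr1, mulr0, addr0, add0r).
by exists (fun i => a * unitv k o0 i + b * unitv k o1 i).
Qed.

(** If the residual point vanished, independence of t and w would kill both of its coefficients, and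
    the Taylor expansion would make f zero on the whole tangent line. *)
Lemma tang_nonzero f (hf : f \is 3.-homog) (t : 'I_3 -> k) i : no_line f ->
  mmap idfun t f = 0 -> t i != 0 -> (exists j, grad idfun f t j != 0) ->
  exists j, tang idfun f (unitv k i) t j != 0.
Proof.
move=> nl ft ti [j gj]; apply/existsP; apply: contraT.
rewrite negb_exists => /forallP h0.
have {}h0 l : tang idfun f (unitv k i) t l = 0.
  by apply/eqP; move: (h0 l); rewrite negbK.
set w := tangw idfun f (unitv k i) t.
have et : dot (unitv k i) t = t i.
  by rewrite /dot /unitv (bigD1 i) //= eqxx mul1r big1 ?addr0 // => z /negPf ->;
    rewrite mul0r.
have ind a b : (forall l, a * t l + b * w l = 0) -> a = 0 /\ b = 0.
  move=> ab.
  have cr := cross_tangw hf ft (unitv k i) j; rewrite et -/w in cr.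
  have cn0 : cross t w j != 0 by rewrite cr oppr_eq0 mulf_neq0.
  have bz : b = 0.
    apply: (mulIf cn0); rewrite mul0r.
    transitivity (cross t (fun l => a * t l + b * w l) j).
      by rewrite /cross; ring.
    by rewrite /cross !ab; ring.
  split=> //; apply: (mulIf ti); rewrite mul0r -(ab i) bz; ring.
have [l|fw /eqP] := ind (mmap idfun w f) (- dot (grad idfun f w) t).
  by rewrite -[RHS](h0 l) /tang -/w; ring.
rewrite oppr_eq0 => /eqP gw.
have [a [b /eqP[]]] := nl _ _ ind.
rewrite cubic_taylor // ft gw fw tang_gradw; ring.
Qed.

End NoLine.

(** * Existence of a generic point *)

Lemma rmorph_mmap (n : nat) (k A B : comNzRingType) (phi : {rmorphism k -> A})
    (g : {rmorphism A -> B}) (h : 'I_n -> A) p :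
  g (mmap phi h p) = mmap (g \o phi) (g \o h) p.
Proof.
rewrite /mmap rmorph_sum; apply: eq_bigr => m _; rewrite rmorphM; congr (_ * _).
by rewrite /mmap1 rmorph_prod; apply: eq_bigr => i _; rewrite rmorphXn.
Qed.

Section Homogenization.

Variable k : comNzRingType.
Implicit Types (g h : {poly k}) (p : {mpoly k[3]}).

(** The form x_0^d g(x_1/x_0). Coefficients of g beyond degree d are dropped, hence the size bounds
    below. *)
Definition homz (d : nat) g : {mpoly k[3]} :=
  \sum_(j < d.+1) g`_j *: ('X_o0 ^+ (d - j) * 'X_o1 ^+ j).

Lemma homzD d g h : homz d (g + h) = homz d g + homz d h.
Proof. by rewrite -big_split; apply: eq_bigr => j _; rewrite coefD scalerDl. Qed.

Lemma homzZ d c g : homz d (c *: g) = c *: homz d g.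
Proof. by rewrite scaler_sumr; apply: eq_bigr => j _; rewrite coefZ scalerA. Qed.

Lemma homz0 d : homz d 0 = 0.
Proof. by rewrite /homz big1 // => j _; rewrite coef0 scale0r. Qed.

Lemma homz_homog d g : homz d g \is d.-homog.
Proof.
apply: rpred_sum => j _; apply: rpredZ.
have dU i : ('X_i : {mpoly k[3]}) \is 1.-homog by rewrite dhomogX; apply/eqP; exact: mdeg1.
have := dhomogM (dhomogMn (d - j) (dU o0)) (dhomogMn j (dU o1)).
by rewrite !mul1n subnK // -ltnS.
Qed.

Lemma homzX0 d g : (size g <= d.+1)%N -> homz d.+1 g = 'X_o0 * homz d g.
Proof.
move=> sg; rewrite /homz big_ord_recr /= nth_default // scale0r addr0.
rewrite mulr_sumr; apply: eq_bigr => j _; rewrite -scalerAr mulrA -exprS.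
by rewrite subSn // -ltnS.
Qed.

Lemma homzX1 d g : homz d.+1 (g * 'X) = 'X_o1 * homz d g.
Proof.
rewrite /homz big_ord_recl /= coefMX eqxx scale0r add0r.
rewrite mulr_sumr; apply: eq_bigr => j _; rewrite coefMX /= subSS.
by rewrite -scalerAr mulrCA -exprS.
Qed.

Lemma homzC d c : homz d c%:P = c *: 'X_o0 ^+ d.
Proof.
rewrite /homz big_ord_recl /= coefC eqxx subn0 expr0 mulr1 big1 ?addr0 // => j _.
by rewrite coefC scale0r.
Qed.

Lemma homzX0n d e g : (size g <= d.+1)%N -> homz (e + d) g = 'X_o0 ^+ e * homz d g.
Proof.
move=> sg; elim: e => [|e IH]; first by rewrite expr0 mul1r.
by rewrite addSn homzX0 ?IH ?exprS ?mulrA // (leq_trans sg) // ltnS leq_addl.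
Qed.

Lemma homzM d e g h : (size g <= d.+1)%N -> (size h <= e.+1)%N ->
  homz (d + e) (g * h) = homz d g * homz e h.
Proof.
elim: d g => [|d IH] g sg sh.
  by rewrite (size1_polyC sg) mul_polyC homzZ homzC expr0 -scalerAl mul1r.
move: sg; elim/poly_ind: g => [|g c _] sg; first by rewrite mul0r !homz0 mul0r.
have sg' : (size g <= d.+1)%N.
  move: sg; rewrite size_MXaddC; case: ifP => [/andP[/eqP-> _]|_ //].
  by rewrite size_poly0.
rewrite mulrDl homzD [in RHS]homzD homzX1 homzC mulrAC addSn homzX1 IH //.
rewrite mul_polyC homzZ -addSn homzX0n // mulrDl -scalerAl; congr (_ + _).
by rewrite mulrA.
Qed.

End Homogenization.

(** * Division with remainder by a cubic monic in x_2 *)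

Section Reduction.

Variable k : comNzRingType.
Implicit Types (g h : {poly k}) (p : {mpoly k[3]}).

(** A form of degree d as a polynomial in x_2, whose coefficients, binary forms in x_0 and x_1, are
    stored dehomogenized. *)
Definition zsum (m d : nat) (c : nat -> {poly k}) : {mpoly k[3]} :=
  \sum_(i < m) homz (d - i) (c i) * 'X_o2 ^+ i.

(** The truncated subtraction also forces c i = 0 for i > d, where the exponent d - i of [zsum]
    would be wrong. *)
Definition zbound (d : nat) (c : nat -> {poly k}) :=
  forall i, (size (c i) <= d.+1 - i)%N.

Lemma zsumD m d c c' : zsum m d (fun i => c i + c' i) = zsum m d c + zsum m d c'.
Proof. by rewrite -big_split; apply: eq_bigr => i _; rewrite homzD mulrDl. Qed.

Lemma zsumZ m d a c : zsum m d (fun i => a *: c i) = a *: zsum m d c.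
Proof. by rewrite scaler_sumr; apply: eq_bigr => i _; rewrite homzZ scalerAl. Qed.

Lemma zboundD d c c' : zbound d c -> zbound d c' -> zbound d (fun i => c i + c' i).
Proof.
by move=> bc bc' i; apply: leq_trans (size_polyD _ _) _; rewrite geq_max bc bc'.
Qed.

Lemma zboundZ d a c : zbound d c -> zbound d (fun i => a *: c i).
Proof. by move=> bc i; apply: leq_trans (size_scale_leq _ _) _. Qed.

Lemma zbound0 d : zbound d (fun=> 0).
Proof. by move=> i; rewrite size_poly0. Qed.

Lemma zsum0 m d : zsum m d (fun=> 0) = 0.
Proof. by rewrite /zsum big1 // => i _; rewrite homz0 mul0r. Qed.

Lemma zboundS d c : zbound d c -> zbound d.+1 c.
Proof. by move=> bc i; apply: leq_trans (bc i) _; apply: leq_sub2r. Qed.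

Lemma zboundX d c : zbound d c -> zbound d.+1 (fun i => c i * 'X).
Proof.
move=> bc i; have [->|nz] := eqVneq (c i) 0; first by rewrite mul0r size_poly0.
rewrite size_mulX //; have := bc i; rewrite -size_poly_gt0 in nz; lia.
Qed.

Lemma zbound_gt d c i : zbound d c -> (d < i)%N -> c i = 0.
Proof.
move=> bc di; apply/eqP; rewrite -size_poly_leq0; apply: leq_trans (bc i) _.
by rewrite leqn0 subn_eq0.
Qed.

Lemma zsumX0 m d c : zbound d c -> 'X_o0 * zsum m d c = zsum m d.+1 c.
Proof.
move=> bc; rewrite mulr_sumr; apply: eq_bigr => i _; rewrite mulrA.
have [di|id] := ltnP d i.
  by rewrite (zbound_gt bc) // !homz0 mulr0.
by rewrite subSn // homzX0 //; have := bc i; rewrite subSn.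
Qed.

Lemma zsumX1 m d c : zbound d c ->
  'X_o1 * zsum m d c = zsum m d.+1 (fun i => c i * 'X).
Proof.
move=> bc; rewrite mulr_sumr; apply: eq_bigr => i _; rewrite mulrA.
have [di|id] := ltnP d i.
  by rewrite (zbound_gt bc) // mul0r !homz0 mulr0.
by rewrite subSn // homzX1.
Qed.

Lemma homog_zsum d p : p \is d.-homog ->
  exists2 c, zbound d c & p = zsum d.+1 d c.
Proof.
move: d p; apply: (@dhomog_ind _ _ (fun d p =>
  exists2 c, zbound d c & p = zsum d.+1 d c)).
- by move=> d; exists (fun=> 0); [apply: zbound0|rewrite zsum0].
- move=> d _ _ [c bc ->] [c' bc' ->]; exists (fun i => c i + c' i).
    exact: zboundD.
  by rewrite zsumD.
- move=> d a _ [c bc ->]; exists (fun i => a *: c i); first exact: zboundZ.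
  by rewrite zsumZ.
- exists (fun i => if i == 0%N then 1 else 0).
    by case=> [|i]; rewrite ?size_poly1 ?size_poly0.
  by rewrite /zsum big_ord1 /= expr0 mulr1 -polyC1 homzC scale1r expr0.
have zlast d c : zbound d c -> zsum d.+2 d.+1 c = zsum d.+1 d.+1 c.
  by move=> bc; rewrite /zsum big_ord_recr /= (zbound_gt bc) // homz0 mul0r addr0.
move=> d i _ [c bc ->]; move: i; apply: ord3P.
- exists c; first exact: zboundS.
  by rewrite zsumX0 // zlast.
- exists (fun i => c i * 'X); first exact: zboundX.
  rewrite zsumX1 // /zsum [RHS]big_ord_recr /= (zbound_gt bc) // mul0r homz0.
  by rewrite mul0r addr0.
exists (fun i => if i is j.+1 then c j else 0).
  by case=> [|i]; [rewrite size_poly0|rewrite subSS].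
rewrite /zsum [RHS]big_ord_recl /= homz0 mul0r add0r mulr_sumr.
by apply: eq_bigr => i _; rewrite mulrCA -exprS /= /bump /= add1n subSS.
Qed.

Variables (f : {mpoly k[3]}) (fc : nat -> {poly k}).
Hypothesis fcb : zbound 3 fc.
Hypothesis fE : f = 'X_o2 ^+ 3 + zsum 3 3 fc.

(** Only multiplication of the remainder by x_2 can create x_2^3, which is then replaced modulo f by
    - [zsum 3 3 fc]. *)
Lemma homog_reduce d p : p \is d.-homog ->
  exists c q, zbound d c /\ p = q * f + zsum 3 d c.
Proof.
move: d p; apply: (@dhomog_ind _ _ (fun d p =>
  exists c q, zbound d c /\ p = q * f + zsum 3 d c)).
- move=> d; exists (fun=> 0), 0; split; first exact: zbound0.
  by rewrite zsum0 mul0r addr0.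
- move=> d _ _ [c [q [bc ->]]] [c' [q' [bc' ->]]].
  exists (fun i => c i + c' i), (q + q'); split; first exact: zboundD.
  by rewrite zsumD mulrDl addrACA.
- move=> d a _ [c [q [bc ->]]]; exists (fun i => a *: c i), (a *: q).
  by split; [exact: zboundZ|rewrite zsumZ scalerDr scalerAl].
- exists (fun i => if i == 0%N then 1 else 0), 0; split.
    by case=> [|i]; rewrite ?size_poly1 ?size_poly0.
  rewrite /zsum !big_ord_recl big_ord0 /= !homz0 !mul0r !addr0 add0r expr0 mulr1.
  by rewrite -polyC1 homzC scale1r expr0.
move=> d i _ [c [q [bc ->]]]; move: i; apply: ord3P.
- exists c, ('X_o0 * q); split; first exact: zboundS.
  by rewrite mulrDr zsumX0 // mulrA.
- exists (fun i => c i * 'X), ('X_o1 * q); split; first exact: zboundX.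
  by rewrite mulrDr zsumX1 // mulrA.
pose cs i := if i is j.+1 then c j else 0.
have bcs : zbound d.+1 cs.
  by case=> [|i]; [rewrite size_poly0|rewrite /= subSS].
have bt : zbound d.+1 (fun i => - (c 2%N * fc i)).
  move=> i; rewrite size_polyN; have [->|c20] := eqVneq (c 2%N) 0.
    by rewrite mul0r size_poly0.
  have [->|fi0] := eqVneq (fc i) 0; first by rewrite mulr0 size_poly0.
  rewrite -!size_poly_gt0 in c20 fi0.
  apply: leq_trans (size_polyMleq _ _) _.
  rewrite -subn1; apply: leq_trans (leq_sub2r 1 (leq_add (bc 2%N) (fcb i))) _.
  by have := leq_trans c20 (bc 2%N); have := leq_trans fi0 (fcb i); lia.
exists (fun i => cs i + - (c 2%N * fc i)), ('X_o2 * q + homz (d - 2) (c 2%N)).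
split; first exact: zboundD.
rewrite mulrDr mulrA mulrDl -addrA; congr (_ + _); rewrite zsumD.
have -> : zsum 3 d.+1 (fun i => - (c 2%N * fc i)) = - (homz (d - 2) (c 2%N) * zsum 3 3 fc).
  rewrite mulr_sumr -sumrN; apply: eq_bigr => i _ /=.
  rewrite -scaleN1r homzZ scaleN1r mulNr mulrA; congr (- (_ * _)).
  have [d2|d2] := ltnP d 2; first by rewrite (zbound_gt bc) // !(mul0r, homz0).
  rewrite -homzM; first by congr homz; have := ltn_ord i; lia.
    by have := bc 2%N; lia.
  by have := fcb i; have := ltn_ord i; lia.
rewrite fE /zsum !big_ord_recl !big_ord0 /= homz0 mul0r add0r !subSS !subn0.
rewrite /bump /= !add1n !mulrDr !addr0; ring.
Qed.

End Reduction.

Lemma fraction_numden (R : idomainType) (x : {fraction R}) :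
  exists n d, d != 0 /\ x * @FracField.tofrac R d = @FracField.tofrac R n.
Proof.
elim/quotW: x => -[[n d] /= d0]; exists n, d; split=> //.
rewrite -[_ * _]/(FracField.mul _ _) !piE; apply/eqmodP => /=.
rewrite FracField.equivfE /FracField.mulf /= !numden_Ratio ?mulr1 ?oner_neq0 //.
by rewrite mulrC.
Qed.

Section MonicCubic.

Variable k : closedFieldType.
Variables (f : {mpoly k[3]}) (fc : nat -> {poly k}).
Hypothesis hf : f \is 3.-homog.
Hypothesis nl : no_line f.
Hypothesis fcb : zbound 3 fc.
Hypothesis fE : f = 'X_o2 ^+ 3 + zsum 3 3 fc.

Lemma mmap_homz (A : comNzRingType) (phi : {rmorphism k -> A}) v d (g : {poly k}) :
  mmap phi v (homz d g) = \sum_(j < d.+1) phi g`_j * (v o0 ^+ (d - j) * v o1 ^+ j).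
Proof.
rewrite /homz rmorph_sum; apply: eq_bigr => j _ /=.
by rewrite mmapZ rmorphM !rmorphXn /= !mmapX !mmap1U.
Qed.

Lemma mmap_homz1 (A : comNzRingType) (phi : {rmorphism k -> A}) v d (g : {poly k}) :
  v o0 = 1 -> (size g <= d.+1)%N ->
  mmap phi v (homz d g) = (map_poly phi g).[v o1].
Proof.
move=> v0 sg; rewrite mmap_homz (@horner_coef_wide _ d.+1).
  by apply: eq_bigr => j _; rewrite v0 expr1n mul1r coef_map.
by apply: leq_trans (size_poly _ _) sg.
Qed.

Lemma mmap_zsum1 (A : comNzRingType) (phi : {rmorphism k -> A}) v d c :
  v o0 = 1 -> zbound d c ->
  mmap phi v (zsum 3 d c) = \sum_(i < 3) (map_poly phi (c i)).[v o1] * v o2 ^+ i.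
Proof.
move=> v0 bc; rewrite /zsum rmorph_sum; apply: eq_bigr => i _ /=.
rewrite rmorphM rmorphXn /= mmapXU; congr (_ * _).
have [di|id] := ltnP d i.
  by rewrite (zbound_gt bc) // homz0 !raddf0 horner0.
by rewrite mmap_homz1 // -subSn.
Qed.

(** f on the chart x_0 = 1, as a polynomial in x_2 over k[x_1]. *)
Definition zpoly : {poly {poly k}} := 'X^3 + \poly_(i < 3) fc i.

Lemma size_zpoly : size zpoly = 4%N.
Proof. by rewrite /zpoly size_polyDl size_polyXn // ltnS size_poly. Qed.

Lemma zpoly_monic : zpoly \is monic.
Proof.
rewrite monicE lead_coefE size_zpoly /zpoly coefD coefXn coef_poly /=.
by rewrite addr0.
Qed.

Lemma horner_zpoly (A : comNzRingType) (phi : {rmorphism {poly k} -> A}) x :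
  (map_poly phi zpoly).[x] = x ^+ 3 + \sum_(i < 3) phi (fc i) * x ^+ i.
Proof.
rewrite /zpoly rmorphD /= map_polyXn hornerD hornerXn; congr (_ + _).
rewrite (@horner_coef_wide _ 3); last first.
  by apply: leq_trans (size_poly _ _) _; rewrite size_poly.
by apply: eq_bigr => i _; rewrite coef_map coef_poly ltn_ord.
Qed.

(** A root has degree at most 1, so x_2 = a_0 x_0 + a_1 x_1 would be a line on the cubic. *)
Lemma zpoly_no_poly_root a : zpoly.[a] != 0.
Proof.
apply/eqP => a0; have := horner_zpoly idfun a.
rewrite (_ : map_poly idfun zpoly = zpoly); last by rewrite map_poly_id.
rewrite {}a0 => /esym a0.
(* Otherwise a^3 has larger degree than every fc_i a^i, as fc_i has degree at most 3 - i. *)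
have sa : (size a <= 2)%N.
  rewrite leqNgt; apply/negP => sa.
  have a_neq0 : a != 0 by rewrite -size_poly_gt0 (leq_trans _ sa).
  have s3 : size (a ^+ 3) = ((size a).-1 * 3).+1.
    by rewrite -[LHS]prednK ?size_exp // size_poly_gt0 expf_neq0.
  have : size (a ^+ 3 + \sum_(i < 3) idfun (fc i) * a ^+ i) = size (a ^+ 3).
    apply: size_polyDl; rewrite s3 ltnS; apply: leq_trans (size_sum _ _ _) _.
    apply/bigmax_leqP => i _ /=.
    have [->|ai] := eqVneq (fc i) 0; first by rewrite mul0r size_poly0.
    rewrite size_mul ?expf_neq0 // -subn1.
    have -> : size (a ^+ i) = ((size a).-1 * i).+1.
      by rewrite -[LHS]prednK ?size_exp // size_poly_gt0 expf_neq0.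
    have := fcb i; have := ltn_ord i; move: sa; rewrite -size_poly_gt0 in ai.
    by move: (size a) (size (fc i)) ai => [|s] [|t] //=; nia.
  by rewrite a0 size_poly0 s3.
(* Two points of that line, chosen so that u + X v = (1, X, a). *)
pose u i := if i == o0 then 1 else if i == o1 then 0 else a`_0.
pose v i := if i == o0 then 0 else if i == o1 then 1 else a`_1.
have aE : a = (a`_0)%:P + (a`_1)%:P * 'X.
  apply/polyP => -[|[|i]]; rewrite coefD coefC coefMX /= ?addr0 ?coefC ?add0r //.
  by rewrite nth_default // (leq_trans sa).
have l0 : line_poly idfun u v f = 0.
  rewrite /line_poly fE rmorphD rmorphXn /= mmapXU mmap_zsum1 //=; last first.
    by rewrite /u /v /= mul0r addr0.
  rewrite /u /v /= -aE -[RHS]a0; congr (_ + _); apply: eq_bigr => i _.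
  congr (_ * _); rewrite add0r mul1r.
  have -> : map_poly (polyC \o idfun) (fc i) = map_poly polyC (fc i).
    by apply/polyP => j; rewrite !coef_map.
  by rewrite -[RHS]comp_polyXr.
have [a1 [b1 /eqP[]]] : exists a b, mmap idfun (fun i => a * u i + b * v i) f != 0.
  apply: nl => x y xy; have := xy o0; have := xy o1.
  by rewrite /u /v /= !(mulr0, mulr1, add0r, addr0).
have [az|az] := eqVneq a1 0.
  rewrite az; transitivity (b1 ^+ 3 * mmap idfun v f).
    by rewrite -mmap_scale_homog //; apply: eq_mmap => i; rewrite mul0r add0r.
  by have [_ <-] := line_poly_homog idfun u v hf; rewrite l0 coef0 mulr0.
transitivity (a1 ^+ 3 * mmap idfun (fun i => u i + b1 / a1 * v i) f).
  rewrite -mmap_scale_homog //; apply: eq_mmap => i.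
  by rewrite mulrDr; congr (_ + _); rewrite mulrA mulrCA divff // mulr1.
by rewrite -line_poly_horner l0 horner0 mulr0.
Qed.

Local Notation tofrac := (@FracField.tofrac {poly k}).

(** A reducible cubic has a root in the fraction field; since [zpoly] is monic, the denominator of
    the root in lowest terms is a constant, so the root lies in k[x_1]. *)
Lemma zpoly_irreducible : irreducible_poly (map_poly tofrac zpoly).
Proof.
apply: cubic_irreducible => [|r].
  rewrite size_map_inj_poly ?size_zpoly ?rmorph0 //.
  by move=> x y /eqP; rewrite tofrac_eq => /eqP.
apply/negP => /rootP; rewrite horner_zpoly => r0.
have [n0 [d0 [d0_neq0 rd0]]] := fraction_numden r.
pose g := gcdp n0 d0; pose n := n0 %/ g; pose d := d0 %/ g.
have g_neq0 : g != 0 by rewrite gcdp_eq0 negb_and d0_neq0 orbT.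
have cop : coprimep d n.
  by rewrite coprimep_sym coprimep_div_gcd // d0_neq0 orbT.
have nE : n0 = n * g by rewrite divpK // dvdp_gcdl.
have dE : d0 = d * g by rewrite divpK // dvdp_gcdr.
have d_neq0 : d != 0 by apply: contraNneq d0_neq0 => dz; rewrite dE dz mul0r.
have rd : r * tofrac d = tofrac n.
  apply: (mulIf (x := tofrac g)); first by rewrite tofrac_eq0.
  by rewrite -mulrA -!tofracM -dE -nE.
have : n ^+ 3 + d * (fc 0 * d ^+ 2 + fc 1 * n * d + fc 2 * n ^+ 2) = 0.
  apply/eqP; rewrite -tofrac_eq0; apply/eqP.
  transitivity (tofrac d ^+ 3 * (r ^+ 3 + \sum_(i < 3) tofrac (fc i) * r ^+ i)).
    rewrite !big_ord_recl big_ord0 /= /bump /= !add1n.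
    rewrite !(tofracD, tofracM, tofracXn) -rd; ring.
  by rewrite r0 mulr0.
move=> e; have : d %| n ^+ 3.
  by rewrite (canRL (addrK _) e) add0r dvdpNr dvdp_mulr.
rewrite -(mul1r (n ^+ 3)) Gauss_dvdpl ?coprimep_expr // dvdp1 => /size_poly1P[c c0 dc].
have rE : r = tofrac (c^-1 *: n).
  apply: (mulIf (x := tofrac d)); first by rewrite tofrac_eq0.
  by rewrite rd -tofracM dc -scalerAl mulrC mul_polyC scalerA mulVf // scale1r.
have := zpoly_no_poly_root (c^-1 *: n); apply/negP; rewrite negbK -tofrac_eq0.
by rewrite -horner_map horner_zpoly /= -rE r0.
Qed.

End MonicCubic.

(** * Regular functions on an affine chart *)

Section Chart.

Variable k : closedFieldType.
Variables (f : {mpoly k[3]}) (hf : f \is 3.-homog).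
Hypothesis f2 : mmap idfun (unitv k o2) f = 1.
Variables (L : comNzRingType) (psi : {rmorphism {poly k} -> L}) (b : L).
Variables (u : 'I_3 -> {poly k}) (j0 : 'I_3).
Hypotheses (u2 : u o2 = 0) (j02 : j0 != o2) (uj0 : u j0 = 1).

Let s i := if i == o2 then b else psi (u i).
Let ev (g : {poly {poly k}}) := (map_poly psi g).[b].

Let chart := line_poly (@polyC k) u (fun i => (unitv k o2 i)%:P).

Lemma eval_chart p : ev (chart p) = mmap (psi \o polyC) s p.
Proof.
rewrite /chart /line_poly.
rewrite -[LHS]/((horner_eval b \o map_poly psi) (mmap (polyC \o polyC)
  (fun i => (u i)%:P + (unitv k o2 i)%:P%:P * 'X) p)) rmorph_mmap.
rewrite /mmap; apply: eq_bigr => m _; congr (_ * _).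
  by rewrite /= /horner_eval map_polyC hornerC.
apply: eq_bigr => i _; congr (_ ^+ _).
rewrite /= /horner_eval rmorphD rmorphM /= !map_polyC map_polyX /= hornerD hornerM.
rewrite !hornerC hornerX /s /unitv; case: eqP => [->|_].
  by rewrite u2 !rmorph0 !rmorph1 add0r mul1r.
by rewrite !rmorph0 mul0r addr0.
Qed.

(** The denominators of c, those p for which c times [ev p] is in the image of [ev], form an ideal.
    It contains the Q_i and the equation of the curve, which is monic because f is 1 at (0,0,1), so
    the Nullstellensatz puts 1 into it. *)
Lemma chart_regular (I : Type) (Q : I -> {mpoly k[3]}) c :
  mmap (psi \o polyC) s f = 0 ->
  (forall v : 'I_3 -> k, (exists j, v j != 0) -> mmap idfun v f = 0 ->
     exists i, mmap idfun v (Q i) != 0) ->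
  (forall i, exists g, c * mmap (psi \o polyC) s (Q i) = ev g) ->
  exists g, c = ev g.
Proof.
move=> fs noz Qreg.
have evD g h : ev (g + h) = ev g + ev h by rewrite /ev rmorphD hornerD.
have evM g h : ev (g * h) = ev g * ev h by rewrite /ev rmorphM hornerM.
have ptchart x y p : (chart p).[y%:P].[x] =
    mmap idfun (fun i => if i == o2 then y else (u i).[x]) p.
  rewrite /chart /line_poly.
  rewrite -[LHS]/((horner_eval x \o horner_eval y%:P) (mmap (polyC \o polyC)
    (fun i => (u i)%:P + (unitv k o2 i)%:P%:P * 'X) p)) rmorph_mmap.
  rewrite /mmap; apply: eq_bigr => m _; congr (_ * _).
    by rewrite /= /horner_eval !hornerC.
  apply: eq_bigr => i _; congr (_ ^+ _).
  rewrite /= /horner_eval hornerD hornerM !hornerC hornerX hornerD hornerM !hornerC.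
  rewrite /unitv; case: eqP => [->|_].
    by rewrite u2 horner0 add0r mul1r.
  by rewrite mul0r addr0.
have [sf f3] := line_poly_homog (@polyC k) u (fun i => (unitv k o2 i)%:P) hf.
have {}f3 : (chart f)`_3 = 1.
  rewrite f3 -[RHS](rmorph1 (@polyC k)) -f2 rmorph_mmap.
  by apply: eq_mmap.
have fmon : chart f \is monic.
  rewrite monicE lead_coefE; have -> : size (chart f) = 4%N; last by rewrite f3.
  apply/eqP; rewrite eqn_leq sf /=; rewrite ltnNge; apply/negP => sf'.
  by have := oner_neq0 {poly k}; rewrite -f3 nth_default ?eqxx.
pose J p := exists g, c * ev p = ev g.
have [] : J 1; last first.
  by move=> g; rewrite /ev rmorph1 hornerC mulr1; exists g.
apply: (@one_in_ideal_poly2 k J (chart f)) => //.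
- by move=> p q [g hp] [h hq]; exists (g + h); rewrite !evD mulrDr hp hq.
- by move=> a p [g hp]; exists (a * g); rewrite !evM mulrCA hp.
- by exists 0; rewrite eval_chart fs mulr0 /ev rmorph0 horner0.
move=> x y; pose v i := if i == o2 then y else (u i).[x].
have [fv|fv] := eqVneq (mmap idfun v f) 0; last first.
  exists (chart f); last by rewrite ptchart.
  by exists 0; rewrite eval_chart fs mulr0 /ev rmorph0 horner0.
have [|i Qi] := noz v _ fv.
  by exists j0; rewrite /v (negPf j02) uj0 hornerC oner_neq0.
exists (chart (Q i)); last by rewrite ptchart.
by have [g hg] := Qreg i; exists g; rewrite eval_chart hg.
Qed.

End Chart.

Section Regular.

Variables (k : closedFieldType) (L : fieldType) (phi : {rmorphism k -> L}).
Variable t : 'I_3 -> L.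

(* The values at t of the sections of O(d): the forms of degree d. *)
Definition reg (d : int) (c : L) : Prop :=
  match d with
  | Posz n => exists2 p, p \is n.-homog & c = mmap phi t p
  | Negz _ => c = 0
  end.

Lemma reg0 d : reg d 0.
Proof. by case: d => // n; exists 0; rewrite ?rpred0 ?raddf0. Qed.

Lemma regD d x y : reg d x -> reg d y -> reg d (x + y).
Proof.
case: d => [n|n] /= => [[p hp ->] [q hq ->]|-> ->]; last by rewrite addr0.
by exists (p + q); rewrite ?rpredD ?mmapD.
Qed.

Lemma regM d e x y : reg d x -> reg e y -> reg (d + e) (x * y).
Proof.
case: d => [m|m]; last by move=> /= ->; rewrite mul0r => _; exact: reg0.
case: e => [n|n]; last by move=> _ /= ->; rewrite mulr0; exact: reg0.
move=> /= [p hp ->] [q hq ->]; exists (p * q); first exact: dhomogM.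
by rewrite rmorphM.
Qed.

Lemma regC c : reg 0 (phi c).
Proof. by exists c%:MP; rewrite ?mmapC // -[c%:MP]mulr1 mul_mpolyC rpredZ ?dhomog1. Qed.

Lemma reg1 : reg 0 1.
Proof. by rewrite -(rmorph1 phi); exact: regC. Qed.

Lemma regN d x : reg d x -> reg d (- x).
Proof.
by move=> hx; rewrite -mulN1r -(add0r d); apply: regM => //;
  rewrite -(rmorph1 phi) -rmorphN; exact: regC.
Qed.

Lemma regB d x y : reg d x -> reg d y -> reg d (x - y).
Proof. by move=> hx hy; apply/regD/regN. Qed.

Lemma regX d x n : reg d x -> reg (d * n%:Z) (x ^+ n).
Proof.
move=> hx; elim: n => [|n IH]; first by rewrite mulr0 expr0; exact: reg1.
by rewrite exprS intS mulrDr mulr1; exact: regM.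
Qed.

Lemma reg_sum (I : Type) (r : seq I) (P : pred I) (F : I -> L) d :
  (forall i, P i -> reg d (F i)) -> reg d (\sum_(i <- r | P i) F i).
Proof. by move=> h; apply: big_ind => //; [exact: reg0|exact: regD]. Qed.

Lemma regt i : reg 1 (t i).
Proof.
exists 'X_i; last by rewrite mmapXU.
by rewrite dhomogX; apply/eqP; exact: mdeg1.
Qed.

(* Sections of O(d) over the complement of finitely many points that extend
   wherever some Q_i does not vanish are global. *)
Definition regular_extension (f : {mpoly k[3]}) : Prop :=
  forall (I : Type) (Q : I -> {mpoly k[3]}) (delta : nat) (e : int) (c : L),
  (forall i, Q i \is delta.-homog) ->
  (forall v : 'I_3 -> k, (exists j, v j != 0) -> mmap idfun v f = 0 ->
     exists i, mmap idfun v (Q i) != 0) ->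
  (forall i, reg (e + delta%:Z) (c * mmap phi t (Q i))) -> reg e c.

(* The last condition stands for the normality of the coordinate ring. *)
Definition generic_point (f : {mpoly k[3]}) : Prop :=
  [/\ mmap phi t f = 0,
      forall d p, p \is d.-homog -> mmap phi t p = 0 -> exists q, p = q * f
    & regular_extension f].

End Regular.

(** * The generic point of a cubic monic in x_2 *)

Section MonicGeneric.

Variable k : closedFieldType.
Variables (f : {mpoly k[3]}) (fc : nat -> {poly k}).
Hypothesis hf : f \is 3.-homog.
Hypothesis f2 : mmap idfun (unitv k o2) f = 1.
Hypothesis fcb : zbound 3 fc.
Hypothesis fE : f = 'X_o2 ^+ 3 + zsum 3 3 fc.
Variables (L : fieldType) (psi : {rmorphism {poly k} -> L}) (z : L).
Hypothesis zroot : z ^+ 3 + \sum_(i < 3) psi (fc i) * z ^+ i = 0.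

Definition zval (c : nat -> {poly k}) : L := \sum_(i < 3) psi (c i) * z ^+ i.

Hypothesis zval_inj : forall c, zval c = 0 -> forall i, (i < 3)%N -> c i = 0.

Let y := psi 'X.
Let phi : {rmorphism k -> L} := psi \o polyC.
Let t (i : 'I_3) : L := if i == o2 then z else if i == o1 then y else 1.
Let reg := reg phi t.

Lemma map_polyC_psi g : (map_poly phi g).[y] = psi g.
Proof.
elim/poly_ind: g => [|g c IH]; first by rewrite !rmorph0 horner0.
rewrite !rmorphD !rmorphM /= map_polyC map_polyX hornerD hornerM hornerC hornerX.
by rewrite IH.
Qed.

Lemma mmap_zsumt d c : zbound d c -> mmap phi t (zsum 3 d c) = zval c.
Proof.
move=> bc; rewrite mmap_zsum1 //; apply: eq_bigr => i _ /=.
by rewrite map_polyC_psi.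
Qed.

Lemma monic_ft : mmap phi t f = 0.
Proof.
by rewrite fE rmorphD rmorphXn /= mmapXU mmap_zsumt // zroot.
Qed.

(** Division by f turns regularity into degree bounds on the coordinates in 1, z, z^2, which are
    unique by [zval_inj]. *)
Lemma reg_zvalP (d : nat) c : reg d c <-> exists2 b, zbound d b & c = zval b.
Proof.
split=> [[p hp ->]|[b bb ->]].
  have [b [q [bb ->]]] := homog_reduce fcb fE hp.
  by exists b => //; rewrite mmapD rmorphM /= monic_ft mulr0 add0r mmap_zsumt.
exists (zsum 3 d b); last by rewrite mmap_zsumt.
apply: rpred_sum => i _; have [di|id] := ltnP d i.
  by rewrite (zbound_gt bb) // homz0 mul0r rpred0.
rewrite -{2}(subnK id); apply: dhomogM; first exact: homz_homog.
rewrite -{2}(mul1n i); apply: dhomogMn.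
by rewrite dhomogX; apply/eqP; exact: mdeg1.
Qed.

Lemma monic_generic d p : p \is d.-homog -> mmap phi t p = 0 ->
  exists q, p = q * f.
Proof.
move=> /(homog_reduce fcb fE)[c [q [bc ->]]].
rewrite mmapD rmorphM /= monic_ft mulr0 add0r mmap_zsumt // => /zval_inj c0.
exists q; rewrite /zsum big1 ?addr0 // => i _.
by rewrite c0 // homz0 mul0r.
Qed.

Lemma y_neq0 : y != 0.
Proof.
apply/eqP => y0.
have := zval_inj (c := fun i => if i == 0%N then 'X else 0) _ (i := 0) isT.
rewrite /zval !big_ord_recl big_ord0 /= rmorph0 !mul0r !addr0 mulr1.
by move=> /(_ y0)/eqP; rewrite polyX_eq0.
Qed.

(** The chart x_1 = 1 has coordinates 1/y and z/y, and a power of y clears the denominators. Asking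
    for all large N makes the property stable under sums and products. *)
Lemma reg_evB (psi' : {rmorphism {poly k} -> L}) (g : {poly {poly k}}) :
  (forall c, psi' c%:P = phi c) -> psi' 'X = y^-1 ->
  exists N0 : nat, forall N : nat, (N0 <= N)%N ->
    reg N%:Z (y ^+ N * (map_poly psi' g).[z / y]).
Proof.
move=> psiC psiX.
pose K x := exists N0 : nat, forall N : nat, (N0 <= N)%N -> reg N%:Z (y ^+ N * x).
have regy : reg 1 y := regt phi t o1.
have regyn n : reg n%:Z (y ^+ n) by have := regX n regy; rewrite mul1r.
have KD a b : K a -> K b -> K (a + b).
  move=> [M ha] [N hb]; exists (M + N)%N => P MN; rewrite mulrDr.
  by apply: regD; [apply: ha|apply: hb]; lia.
have KM a b : K a -> K b -> K (a * b).
  move=> [M ha] [N hb]; exists (M + N)%N => P MN.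
  have -> : y ^+ P * (a * b) = (y ^+ M * a) * (y ^+ (P - M) * b).
    by rewrite mulrACA -exprD subnKC //; lia.
  have -> : P%:Z = M%:Z + (P - M)%N%:Z by lia.
  by apply: regM; [apply: ha|apply: hb; lia].
have KC c : K (phi c).
  exists 0%N => N _; rewrite -[N%:Z]addr0; apply: regM; [exact: regyn|exact: regC].
have KV a : reg 1 a -> K (a / y).
  move=> ha; exists 1%N => -[//|N] _.
  rewrite exprSr -mulrA [y * _]mulrC mulfVK ?y_neq0 // intS addrC.
  by apply: regM; first exact: regyn.
have K0 : K 0 by rewrite -(rmorph0 phi).
have Kpsi c : K (psi' c).
  elim/poly_ind: c => [|c a IH]; first by rewrite rmorph0.
  rewrite rmorphD rmorphM /= psiC psiX; apply: KD => //; apply: KM => //.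
  rewrite -[y^-1]mul1r; apply: KV.
  exact: (regt phi t o0).
change (K (map_poly psi' g).[z / y]).
elim/poly_ind: g => [|g c IH]; first by rewrite rmorph0 horner0.
rewrite rmorphD rmorphM /= map_polyC map_polyX hornerD hornerM hornerC hornerX.
apply: KD; [apply: KM => //|exact: Kpsi].
by apply: KV; exact: (regt phi t o2).
Qed.

(** The charts x_0 = 1 and x_1 = 1 cover the curve, as f is nonzero at (0,0,1). Regularity on the
    first makes c a polynomial in y and z; regularity on the second bounds the degrees of its
    coordinates. *)
Lemma monic_regular_extension : regular_extension phi t f.
Proof.
move=> I Q delta e c hQ noz Qreg.
have yn0 := y_neq0.
have reg_poly d x : reg d x -> exists2 p,
    x = mmap phi t p & (0 <= d)%R -> p \is `|d|%N.-homog.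
  case: d => n /= => [[p hp ->]|->]; first by exists p.
  by exists 0; rewrite ?raddf0.
have sA i : (if i == o2 then z else psi (if i == o2 then 0 else
    if i == o1 then 'X else 1)) = t i.
  by move: i; apply: ord3P; rewrite /t /= ?rmorph1.
have [gA cA] : exists g : {poly {poly k}}, c = (map_poly psi g).[z].
  apply: (@chart_regular k f hf f2 L psi z
    (fun i => if i == o2 then 0 else if i == o1 then 'X else 1) o0 _ _ _ I Q) => //.
  - rewrite -[RHS]monic_ft; exact: eq_mmap.
  move=> i; have [p hp _] := reg_poly _ _ (Qreg i).
  exists (line_poly (@polyC k) (fun i => if i == o2 then 0 else if i == o1 then 'X else 1)
     (fun i => (unitv k o2 i)%:P) p).
  rewrite eval_chart //; apply: etrans (etrans hp _).
    by congr (_ * _); apply: eq_mmap.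
  by apply: eq_mmap => j; rewrite -sA.
pose psiB : {rmorphism {poly k} -> L} := horner_eval y^-1 \o map_poly phi.
have psiBC a : psiB a%:P = phi a by rewrite /= /horner_eval map_polyC hornerC.
have psiBX : psiB 'X = y^-1 by rewrite /= /horner_eval map_polyX hornerX.
pose sB i := if i == o2 then z / y else psiB (if i == o1 then 1 else 'X).
have sBE i : sB i = y^-1 * t i.
  rewrite /sB /t; case: eqP => _; first by rewrite mulrC.
  by case: eqP => _; rewrite ?rmorph1 ?psiBX ?mulVf ?mulr1.
have mmapB p : mmap (psiB \o polyC) sB p = mmap phi (fun i => y^-1 * t i) p.
  rewrite /mmap; apply: eq_bigr => m _; congr (_ * _); first exact: psiBC.
  by apply: eq_bigr => i _; rewrite sBE.
have mB q : mmap (psiB \o polyC) (fun i => if i == o2 then z / y else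
     psiB (if i == o2 then 0 else if i == o1 then 1 else 'X)) q =
     mmap phi (fun i => y^-1 * t i) q.
  by rewrite -mmapB; apply: eq_mmap; apply: ord3P.
have [gB cB] : exists g : {poly {poly k}}, c * y ^ (- e) = (map_poly psiB g).[z / y].
  apply: (@chart_regular k f hf f2 L psiB (z / y)
    (fun i => if i == o2 then 0 else if i == o1 then 1 else 'X) o1 _ _ _ I Q) => //.
  - by rewrite mB (mmap_scale_homog _ _ _ hf) monic_ft mulr0.
  move=> i; have [p hp phom] := reg_poly _ _ (Qreg i).
  have [ed|ed] := lerP 0 (e + delta%:Z); last first.
    exists 0; rewrite rmorph0 horner0 mulrAC.
    have z0 : c * mmap phi t (Q i) = 0.
      by have := Qreg i; case: (e + delta%:Z) ed.
    rewrite mB (mmap_scale_homog _ _ _ (hQ i)).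
    by rewrite mulrCA !mulrA -[_ * c * _]mulrA z0 ?mulr0 ?mul0r.
  exists (line_poly (@polyC k) (fun i => if i == o2 then 0 else if i == o1 then 1 else 'X)
     (fun i => (unitv k o2 i)%:P) p).
  rewrite eval_chart //.
  rewrite !mB (mmap_scale_homog _ _ _ (hQ i)) (mmap_scale_homog _ _ _ (phom ed)) -hp.
  have -> : y^-1 ^+ absz (e + delta%:Z) = y ^ (- e) * y^-1 ^+ delta.
    rewrite !exprVn !exprnN -expfzDr //; congr (y ^ _); lia.
  by ring.
have [N0 hN] := reg_evB gB psiBC psiBX.
(* The summand for e makes N + e a natural number that is still at least [N0]. *)
pose N := (N0 + `|e|)%N.
have [n Nn] : exists n : nat, N%:Z + e = n%:Z by exists (absz (N%:Z + e)); lia.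
have /reg_zvalP[h bh ch] : reg n%:Z (y ^+ N * c).
  have -> : y ^+ N * c = y ^+ n * (map_poly psiB gB).[z / y].
    rewrite -cB mulrCA mulrC; congr (_ * _).
    rewrite !exprnP -expfzDr //; congr (y ^ _); lia.
  apply: hN; lia.
pose g i := (Pdiv.Ring.rmodp gA (zpoly fc))`_i.
have cg : c = zval g.
  have sr : (size (Pdiv.Ring.rmodp gA (zpoly fc)) <= 3)%N.
    rewrite -ltnS -(size_zpoly fc) Pdiv.Ring.ltn_rmodp.
    by rewrite monic_neq0 // zpoly_monic.
  rewrite cA {1}(Pdiv.RingMonic.rdivp_eq (zpoly_monic fc) gA).
  rewrite rmorphD rmorphM /= hornerD hornerM horner_zpoly zroot mulr0 add0r.
  rewrite (@horner_coef_wide _ 3); last by apply: leq_trans (size_poly _ _) sr.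
  by apply: eq_bigr => i _; rewrite coef_map.
(* Both sides are the coordinates of y^N c in the basis 1, z, z^2. *)
have gh i : (i < 3)%N -> 'X^N * g i = h i.
  move=> i3; apply/eqP; rewrite -subr_eq0; apply/eqP.
  apply: (zval_inj (c := fun i => 'X^N * g i - h i)) => //.
  transitivity (y ^+ N * zval g - zval h); last by rewrite -cg ch subrr.
  rewrite mulr_sumr -sumrB; apply: eq_bigr => j _.
  by rewrite rmorphB rmorphM rmorphXn /= mulrBl mulrA.
pose g' i := if (i < 3)%N then g i else 0.
(* The maximum with 0 covers negative e, where all coordinates must vanish. *)
have sg i : (size (g' i))%:Z <= Num.max 0 (e + 1 - i%:Z).
  rewrite /g'; case: ltnP => i3; last by rewrite size_poly0; lia.
  have := bh i; rewrite -gh //; have [->|gi] := eqVneq (g i) 0.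
    by rewrite size_poly0; lia.
  rewrite mulrC size_mulXn //; rewrite -size_poly_gt0 in gi; move: gi Nn.
  by move: (size (g i)) => s; lia.
have cg' : c = zval g' by rewrite cg /zval; apply: eq_bigr => i _; rewrite /g' ltn_ord.
suff final d : (forall i, (size (g' i))%:Z <= Num.max 0 (d + 1 - i%:Z)) -> reg d c.
  exact: final sg.
case: d => d sd.
  apply/reg_zvalP; exists g' => // i; move: (sd i); move: (size _) => s; lia.
rewrite /= cg' /zval big1 // => i _.
have -> : g' i = 0; last by rewrite rmorph0 mul0r.
by apply/eqP; rewrite -size_poly_leq0; have := sd i; lia.
Qed.

End MonicGeneric.

Section MonicExistence.

Variable k : closedFieldType.
Variables (f : {mpoly k[3]}) (hf : f \is 3.-homog) (nl : no_line f).
Hypothesis f2 : mmap idfun (unitv k o2) f = 1.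

Lemma monic_zsum : exists2 fc, zbound 3 fc & f = 'X_o2 ^+ 3 + zsum 3 3 fc.
Proof.
have [c bc fE] := homog_zsum hf; exists c => //.
have c3 : (size (c 3%N) <= 1)%N := bc 3%N.
have fE' : f = homz 0 (c 3%N) * 'X_o2 ^+ 3 + zsum 3 3 c.
  by rewrite {1}fE /zsum big_ord_recr /= addrC.
rewrite {1}fE' (size1_polyC c3) homzC expr0 -scalerAl mul1r.
suff -> : (c 3%N)`_0 = 1 by rewrite scale1r.
rewrite -f2 {1}fE' rmorphD rmorphM rmorphXn /= mmapXU (size1_polyC c3) homzC.
rewrite mmapZ /= expr0 rmorph1 {2}/unitv /= expr1n !mulr1.
rewrite /zsum rmorph_sum big1 ?addr0 ?coefC // => i _.
rewrite rmorphM /= mmap_homz big1 ?mul0r // => j _.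
have : (0 < 3 - i)%N by rewrite subn_gt0.
have [->|j0] := posnP j.
  by case: (3 - i)%N => // n _; rewrite subn0 /unitv /= expr0n !(mul0r, mulr0).
by rewrite /unitv /= (expr0n _ j) gtn_eqF // !mulr0.
Qed.

(** L is the function field: a root z of the irreducible [zpoly] adjoined to k(x_1). *)
Lemma exists_generic_point_monic : exists (L : fieldType)
  (phi : {rmorphism k -> L}) (t : 'I_3 -> L), generic_point phi t f.
Proof.
have [fc fcb fE] := monic_zsum.
have irr := zpoly_irreducible hf nl fcb fE.
have [L _ [z zroot _]] := irredp_FAdjoin irr.
pose psi : {rmorphism {poly k} -> L} :=
  GRing.in_alg L \o @FracField.tofrac {poly k}.
have mapE p : map_poly (GRing.in_alg L) (map_poly (@FracField.tofrac {poly k}) p) = map_poly psi p.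
  by apply/polyP => i; rewrite !coef_map.
have root0 : z ^+ 3 + \sum_(i < 3) psi (fc i) * z ^+ i = 0.
  by rewrite -horner_zpoly -mapE; apply/rootP.
have inj c : zval psi z c = 0 -> forall i, (i < 3)%N -> c i = 0.
  move=> c0; pose p := \poly_(i < 3) c i.
  suff p0 : p = 0 by move=> i i3; have := coef_poly 3 c i; rewrite i3 -/p p0 coef0.
  have pz : (map_poly psi p).[z] = 0.
    rewrite -[RHS]c0 (@horner_coef_wide _ 3); last first.
      by apply: leq_trans (size_poly _ _) _; rewrite size_poly.
    by apply: eq_bigr => i _; rewrite coef_map coef_poly ltn_ord.
  apply/eqP; apply: contraT => p_neq0.
  pose P := map_poly (@FracField.tofrac {poly k}) p.
  have tofrac_inj : injective (@FracField.tofrac {poly k}).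
    by move=> x y /eqP; rewrite tofrac_eq => /eqP.
  have sP : size P = size p by rewrite size_map_inj_poly ?rmorph0.
  have szp : size (map_poly (@FracField.tofrac {poly k}) (zpoly fc)) = 4%N.
    by rewrite size_map_inj_poly ?rmorph0 ?size_zpoly.
  (* A nonzero polynomial of degree at most 2 is coprime to an irreducible cubic; if it vanished at
     z, Bezout would give 1 = 0. *)
  have cop : coprimep (map_poly (@FracField.tofrac {poly k}) (zpoly fc)) P.
    apply: contraT => ncop.
    have := irr.2 (gcdp (map_poly (@FracField.tofrac {poly k}) (zpoly fc)) P).
    rewrite -coprimep_def ncop dvdp_gcdl => /(_ isT isT) e.
    have := dvdp_gcdr (map_poly (@FracField.tofrac {poly k}) (zpoly fc)) P.
    rewrite (eqp_dvdl _ e) => /dvdp_leq; rewrite -size_poly_gt0 sP size_poly_gt0 szp.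
    by move=> /(_ p_neq0); rewrite leqNgt ltnS size_poly.
  have /Bezout_eq1_coprimepP [[a b] /= ab] := cop.
  have := congr1 (fun q => (map_poly (GRing.in_alg L) q).[z]) ab.
  rewrite rmorphD !rmorphM rmorph1 /= hornerD !hornerM hornerC !mapE pz.
  rewrite horner_zpoly root0 !mulr0 addr0 => /esym/eqP.
  by rewrite oner_eq0.
exists L, (psi \o polyC); eexists.
split; [exact: monic_ft root0|exact: monic_generic root0 inj|].
exact: monic_regular_extension.
Qed.

End MonicExistence.

(** * Linear changes of coordinates *)

Section LinearSubstitution.

Variables (k : comNzRingType) (A : 'I_3 -> 'I_3 -> k).

Definition lsubst (p : {mpoly k[3]}) : {mpoly k[3]} :=
  mmap (@mpolyC 3 k) (fun i => \sum_j A i j *: 'X_j) p.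

Lemma mmap_lsubst (L : comNzRingType) (phi : {rmorphism k -> L}) v p :
  mmap phi v (lsubst p) = mmap phi (fun i => \sum_j phi (A i j) * v j) p.
Proof.
rewrite /lsubst -[LHS]/((mmap phi v : {rmorphism _ -> _}) _) rmorph_mmap.
rewrite /mmap; apply: eq_bigr => m _; congr (_ * _); first by rewrite /= mmapC.
apply: eq_bigr => i _; congr (_ ^+ _); rewrite /= rmorph_sum.
by apply: eq_bigr => j _ /=; rewrite mmapZ mmapXU.
Qed.

Lemma lsubst_homog d p : p \is d.-homog -> lsubst p \is d.-homog.
Proof.
move: d p; apply: (@dhomog_ind _ _ (fun d p => lsubst p \is d.-homog)).
- by move=> d; rewrite /lsubst raddf0 rpred0.
- by move=> d p q hp hq; rewrite /lsubst mmapD rpredD.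
- by move=> d c p hp; rewrite /lsubst mmapZ mul_mpolyC rpredZ.
- by rewrite /lsubst rmorph1 dhomog1.
move=> d i p hp; rewrite /lsubst rmorphM /= mmapXU -[d.+1]add1n; apply: dhomogM => //.
apply: rpred_sum => j _; apply: rpredZ.
by rewrite dhomogX; apply/eqP; exact: mdeg1.
Qed.

End LinearSubstitution.

Lemma lsubstK (k : comNzRingType) (A B : 'I_3 -> 'I_3 -> k) p :
  (forall i l, \sum_j A i j * B j l = (i == l)%:R) ->
  lsubst B (lsubst A p) = p.
Proof.
move=> AB; rewrite {1}/lsubst mmap_lsubst.
rewrite [RHS]mpolyE /mmap; apply: eq_bigr => m _; rewrite mul_mpolyC; congr (_ *: _).
rewrite -mmap1_id; apply: eq_bigr => i _; congr (_ ^+ _).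
under eq_bigr => j _ do rewrite mul_mpolyC scaler_sumr.
rewrite exchange_big /= (bigD1 i) //= [X in _ + X]big1 ?addr0 => [|l li].
  under eq_bigr => j _ do rewrite scalerA.
  by rewrite -scaler_suml AB eqxx scale1r.
under eq_bigr => j _ do rewrite scalerA.
by rewrite -scaler_suml AB eq_sym (negPf li) scale0r.
Qed.

Lemma sum_lincomb (k : comNzRingType) (a u v : 'I_3 -> k) x y :
  \sum_j a j * (x * u j + y * v j) =
  x * (\sum_j a j * u j) + y * (\sum_j a j * v j).
Proof.
by rewrite !mulr_sumr -big_split; apply: eq_bigr => j _ /=; ring.
Qed.

Section Existence.

Variables (k : closedFieldType) (f : {mpoly k[3]}).
Hypotheses (hf : f \is 3.-homog) (nl : no_line f).

(** The last column of [A] is a point v off the curve, scaled by a cube root to f v = 1; the others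
    are the two unit vectors away from an index a with v a nonzero. *)
Lemma exists_coordinates : exists A B : 'I_3 -> 'I_3 -> k,
  [/\ forall i l, \sum_j A i j * B j l = (i == l)%:R,
      forall i l, \sum_j B i j * A j l = (i == l)%:R
    & mmap idfun (fun i => A i o2) f = 1].
Proof.
have [v0 fv0] := no_line_nonzero hf nl.
have [c c3] : exists c : k, c ^+ 3 = mmap idfun v0 f.
  have [c hc] := @solve_monicpoly k 3
    (fun i => if i == 0%N then mmap idfun v0 f else 0) isT.
  exists c; rewrite hc !big_ord_recl big_ord0 /=.
  by rewrite !mul0r !addr0 expr0 mulr1.
have c0 : c != 0 by apply: contraNneq fv0 => cz; rewrite -c3 cz expr0n.
pose v i := c^-1 * v0 i.
have fv : mmap idfun v f = 1.
  by rewrite (mmap_scale_homog _ _ _ hf) -c3 -exprMn mulVf // expr1n.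
have [a va] : exists a, v a != 0.
  apply/existsP; apply: contra_eqT fv; rewrite negb_exists => /forallP v00.
  have -> : mmap idfun v f = 0 ^+ 3 * mmap idfun v f.
    rewrite -mmap_scale_homog //; apply: eq_mmap => i; rewrite mul0r.
    by apply/eqP; have := v00 i; rewrite negbK.
  by rewrite expr0n mul0r eq_sym oner_eq0.
exists (fun i j => if j == o2 then v i else
  if j == o1 then (i == nx (nx a))%:R else (i == nx a)%:R).
exists (fun j i => if j == o2 then (i == a)%:R / v a else
  if j == o1 then (i == nx (nx a))%:R - v (nx (nx a)) * ((i == a)%:R / v a)
  else (i == nx a)%:R - v (nx a) * ((i == a)%:R / v a)).
split=> //.
- by move: a va; apply: ord3P => va; apply: ord3P; apply: ord3P;
    rewrite sum3 /nx /=; field.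
by move: a va; apply: ord3P => va; apply: ord3P; apply: ord3P;
  rewrite sum3 /nx /=; field.
Qed.

Lemma exists_generic_point : exists (L : fieldType)
  (phi : {rmorphism k -> L}) (t : 'I_3 -> L), generic_point phi t f.
Proof.
have [A [B [AB BA fA]]] := exists_coordinates.
pose f' := lsubst A f.
have AK p : lsubst B (lsubst A p) = p := lsubstK p AB.
have BK p : lsubst A (lsubst B p) = p := lsubstK p BA.
have hf' : f' \is 3.-homog := lsubst_homog A hf.
have Ainj v : (forall i, \sum_j A i j * v j = 0) -> forall i, v i = 0.
  move=> Av i; transitivity (\sum_l B i l * \sum_j A l j * v j).
    under eq_bigr => l _ do rewrite mulr_sumr.
    rewrite exchange_big (bigD1 i) //= [X in _ + X]big1 ?addr0 => [|l li].
      under eq_bigr => j _ do rewrite mulrA.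
      by rewrite -mulr_suml BA eqxx mul1r.
    under eq_bigr => j _ do rewrite mulrA.
    by rewrite -mulr_suml BA eq_sym (negPf li) mul0r.
  by rewrite big1 // => l _; rewrite Av mulr0.
have nl' : no_line f'.
  move=> u v ind.
  have [x y xy|a [b fab]] := nl (u := fun i => \sum_j A i j * u j)
      (v := fun i => \sum_j A i j * v j).
    apply: ind; apply: (Ainj (fun i => x * u i + y * v i)) => i.
    exact: etrans (sum_lincomb _ _ _ _ _) (xy i).
  exists a, b; rewrite mmap_lsubst; move: fab; congr (_ != _).
  by apply: eq_mmap => i; apply/esym; exact: sum_lincomb.
have f'2 : mmap idfun (unitv k o2) f' = 1.
  rewrite -[RHS]fA mmap_lsubst; apply: eq_mmap => i.
  by rewrite sum3 /unitv /= !mulr0 !add0r mulr1.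
have [L [phi [t' [ft' gen ext]]]] := exists_generic_point_monic hf' nl' f'2.
pose t i := \sum_j phi (A i j) * t' j.
have tA p : mmap phi t p = mmap phi t' (lsubst A p) by rewrite mmap_lsubst.
have regE d x : reg phi t d x <-> reg phi t' d x.
  case: d => n //=; split=> [[p hp ->]|[p hp ->]].
    by exists (lsubst A p); rewrite ?lsubst_homog.
  by exists (lsubst B p); rewrite ?lsubst_homog // tA BK.
exists L, phi, t; split=> [|d p hp|I Q delta e c hQ noz Qreg].
- by rewrite tA.
- rewrite tA => /(gen d _ (lsubst_homog A hp))[q hq]; exists (lsubst B q).
  by rewrite -(AK p) hq /lsubst rmorphM /= -/(lsubst _ _) -/(lsubst _ _) AK.
apply/regE; apply: (ext I (fun i => lsubst A (Q i)) delta) => [i|v [j vj] fv|i].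
- exact: lsubst_homog.
- have [||i Qi] := noz (fun i => \sum_j A i j * v j).
  + apply: contrapT => /forallNP h; case/eqP: vj; apply: Ainj => i.
    by apply/eqP; apply: contrapT => /negP; exact: h.
  + by rewrite -[RHS]fv mmap_lsubst.
  by exists i; rewrite mmap_lsubst.
by rewrite -tA; apply/regE.
Qed.

End Existence.

(** * The tangential map *)

Lemma rmorph_tang (k A B : comNzRingType) (phi : {rmorphism k -> A})
    (g : {rmorphism A -> B}) f e t i :
  g (tang phi f e t i) = tang (g \o phi) f (g \o e) (g \o t) i.
Proof.
have gradE u : g \o grad phi f u =1 grad (g \o phi) f (g \o u).
  by move=> a; rewrite /= /grad rmorph_mmap.
have wE : g \o tangw phi f e t =1 tangw (g \o phi) f (g \o e) (g \o t).
  by move=> a; rewrite /tangw /= /cross rmorphB !rmorphM /= -!gradE.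
rewrite /tang rmorphB !rmorphM /= rmorph_mmap (eq_mmap _ _ wE); congr (_ - _ * _).
  rewrite /dot rmorph_sum; apply: eq_bigr => a _; rewrite rmorphM; congr (_ * _).
  by rewrite /grad rmorph_mmap; apply: eq_mmap.
exact: wE.
Qed.

Lemma mmap_homog_comp (n : nat) (k : comNzRingType) (h : 'I_n -> {mpoly k[n]})
    d e p : p \is d.-homog -> (forall i, h i \is e.-homog) ->
  mmap (@mpolyC n k) h p \is (e * d).-homog.
Proof.
move=> hp he; move: d p hp; apply: (@dhomog_ind _ _ (fun d p =>
  mmap (@mpolyC n k) h p \is (e * d).-homog)).
- by move=> d; rewrite raddf0 rpred0.
- by move=> d p q hp hq; rewrite mmapD rpredD.
- by move=> d c p hp; rewrite mmapZ mul_mpolyC rpredZ.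
- by rewrite rmorph1 muln0 dhomog1.
move=> d i p hp; rewrite rmorphM /= mmapX mmap1U mulnS; exact: dhomogM.
Qed.

Section TangentMap.

Variables (k : closedFieldType) (f : {mpoly k[3]}).
Hypotheses (hf : f \is 3.-homog) (nl : no_line f).
Hypothesis ns : forall v : 'I_3 -> k, (exists i, v i != 0) ->
  mmap idfun v f = 0 -> exists i, mmap idfun v (f^`M(i)) != 0.
Variables (L : fieldType) (phi : {rmorphism k -> L}) (t : 'I_3 -> L).
Hypothesis gp : generic_point phi t f.

Let reg := reg phi t.

(* The family v of sections of O(d) has no common zero on the curve, in a form
   that makes it a test family for regularity. *)
Definition no_common_zero (d : nat) (v : 'I_3 -> L) := forall (N : nat) e c,
  (forall i, reg (e + (d * N)%N%:Z) (c * v i ^+ N)) -> reg e c.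

Lemma no_common_zero_forms d (Q : 'I_3 -> {mpoly k[3]}) :
  (forall i, Q i \is d.-homog) ->
  (forall v : 'I_3 -> k, (exists j, v j != 0) -> mmap idfun v f = 0 ->
     exists i, mmap idfun v (Q i) != 0) ->
  no_common_zero d (fun i => mmap phi t (Q i)).
Proof.
case: gp => _ _ ext hQ noz N e c hreg.
apply: (ext _ (fun i => Q i ^+ N) (d * N)%N) => [i|v v0 fv|i].
- exact: dhomogMn.
- have [i Qi] := noz v v0 fv; exists i.
  by rewrite rmorphXn expf_neq0.
by rewrite rmorphXn; exact: hreg.
Qed.

(** If every v i were 0, the test would accept any c, and 1 would be regular of degree -1. *)
Lemma no_common_zero_neq0 d v : no_common_zero d v -> exists i, v i != 0.
Proof.
move=> nz; apply/existsP; apply: contraT; rewrite negb_exists => /forallP v0.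
have : reg (-1) 1.
  apply: (nz 1%N) => i; have := v0 i; rewrite negbK => /eqP ->.
  by rewrite expr1 mulr0; exact: reg0.
by move/eqP; rewrite oner_eq0.
Qed.

Lemma grad_no_common_zero : no_common_zero 2 (grad phi f t).
Proof. by apply: no_common_zero_forms => // i; exact: dhomog_mderiv. Qed.

Lemma reg_grad i : reg 2 (grad phi f t i).
Proof. by exists (f^`M(i)) => //; exact: dhomog_mderiv. Qed.

Lemma coord_no_common_zero : no_common_zero 1 t.
Proof.
have nz : no_common_zero 1 (fun i => mmap phi t 'X_i).
  apply: no_common_zero_forms => [i|v [j vj] _].
    by rewrite dhomogX; apply/eqP; exact: mdeg1.
  by exists j; rewrite mmapXU.
move=> N e c h; apply: (nz N) => i; rewrite mmapXU; exact: h.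
Qed.

(** The tangential construction at the generic coordinates: forms of degree 7, from which x_l^3 is
    divided out modulo f to leave degree 4. *)
Let tangf l i : {mpoly k[3]} :=
  tang (@mpolyC 3 k) f (unitv _ l) (fun i => 'X_i) i.

Lemma mmap_tangf (A : comNzRingType) (psi : {rmorphism k -> A}) v l i :
  mmap psi v (tangf l i) = tang psi f (unitv A l) v i.
Proof.
rewrite /tangf -[LHS]/((mmap psi v : {rmorphism _ -> _}) _) rmorph_tang /=.
have e1 c : mmap psi v (c%:MP_[3]) = psi c by rewrite mmapC.
have eqm u p : mmap (mmap psi v \o @mpolyC 3 k) u p = mmap psi u p.
  by rewrite /mmap; apply: eq_bigr => m _; congr (_ * _); exact: e1.
have eX : mmap psi v \o (fun i => 'X_i) =1 v by move=> a; rewrite /= mmapXU.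
have eU : mmap psi v \o unitv {mpoly k[3]} l =1 unitv A l.
  by move=> a; rewrite /= /unitv rmorph_nat.
have eg u u' : u =1 u' ->
    grad (mmap psi v \o @mpolyC 3 k) f u =1 grad psi f u'.
  by move=> uu' a; rewrite /grad eqm; exact: eq_mmap.
have ew : tangw (mmap psi v \o @mpolyC 3 k) f (mmap psi v \o unitv {mpoly k[3]} l)
    (mmap psi v \o (fun i => 'X_i)) =1 tangw psi f (unitv A l) v.
  by move=> a; rewrite /tangw /cross !eU !(eg _ _ eX).
rewrite /tang eqm (eq_mmap _ _ ew) eX ew; congr (_ - _ * _).
by apply: eq_bigr => a _; rewrite (eg _ _ ew) eX.
Qed.

Lemma tangf_homog l i : tangf l i \is 7.-homog.
Proof.
have dX a : ('X_a : {mpoly k[3]}) \is 1.-homog.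
  by rewrite dhomogX; apply/eqP; exact: mdeg1.
have dg e u a : (forall b, u b \is e.-homog) ->
    grad (@mpolyC 3 k) f u a \is (e * 2).-homog.
  by move=> hu; apply: mmap_homog_comp => //; exact: dhomog_mderiv.
have du a b : unitv {mpoly k[3]} a b \is 0.-homog.
  by rewrite /unitv; case: eqP => _; rewrite ?dhomog1 ?rpred0.
have dw a : tangw (@mpolyC 3 k) f (unitv _ l) (fun i => 'X_i) a \is 2.-homog.
  by rewrite /tangw /cross; apply: rpredB; apply: (@dhomogM _ _ _ 0%N _ 2);
    rewrite ?du //; apply: (dg 1%N).
rewrite /tangf /tang; apply: rpredB.
  by apply: (@dhomogM _ _ _ 6 _ 1) => //; exact: (@mmap_homog_comp 3 k _ 3 2).
apply: (@dhomogM _ _ _ 5 _ 2) => //; apply: rpred_sum => a _.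
by apply: (@dhomogM _ _ _ 4 _ 1) => //; exact: (dg 2).
Qed.

Lemma dot_unitv (A : comNzRingType) l (v : 'I_3 -> A) : dot (unitv A l) v = v l.
Proof.
rewrite /dot /unitv (bigD1 l) //= eqxx mul1r big1 ?addr0 // => i /negPf ->.
by rewrite mul0r.
Qed.

(* Tangential map of the curve, i.e. multiplication by -2 on the elliptic curve:
   G is the residual intersection of the tangent line at t. *)
Lemma exists_tangential : exists G : 'I_3 -> L,
  [/\ forall i, reg 4 (G i), no_common_zero 4 G, mmap phi G f = 0
    & dot (grad phi f t) G = 0].
Proof.
have [ft gen ext] := gp.
have [j tj] := no_common_zero_neq0 coord_no_common_zero.
have tj3 : t j ^+ 3 != 0 by rewrite expf_neq0.
pose G i := (t j ^+ 3)^-1 * tang phi f (unitv L j) t i.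
have GE l i : t l ^+ 3 * G i = tang phi f (unitv L l) t i.
  have := tang_change hf ft (unitv L j) (unitv L l) i; rewrite !dot_unitv => e.
  by rewrite /G mulrCA e mulrA mulVf // mul1r.
(* Each t_l^3 G_i is regular of degree 7, and the t_l have no common zero. *)
have regG i : reg 4 (G i).
  apply: (@coord_no_common_zero 3) => l; rewrite mulrC GE -mmap_tangf.
  by exists (tangf l i) => //; exact: tangf_homog.
exists G; split=> //.
- have [Q hQ] : exists Q : 'I_3 -> {mpoly k[3]},
      forall i, Q i \is 4.-homog /\ G i = mmap phi t (Q i).
    have /choice[Q hQ] : forall i, exists p, p \is 4.-homog /\ G i = mmap phi t p.
      by move=> i; have [p hp e] := regG i; exists p.
    by exists Q.
  suff nz : no_common_zero 4 (fun i => mmap phi t (Q i)).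
    by move=> N e c h; apply: (nz N) => i; rewrite -(hQ i).2; exact: h.
  apply: no_common_zero_forms => [i|v v0 fv]; first by case: (hQ i).
  have [l vl] := v0.
  have [i ti] := tang_nonzero hf nl fv vl (ns v0 fv).
  exists i; apply: contraNneq ti => Qi.
  (* This form vanishes at t, so it is a multiple of f and vanishes at the point v over k, where
     [Q i] = 0 would force the coordinate [ti] of the residual point to be 0. *)
  have : 'X_l ^+ 3 * Q i - tangf l i \is 7.-homog.
    apply: rpredB; last exact: tangf_homog.
    apply: (@dhomogM _ _ _ 3 _ 4); last by case: (hQ i).
    apply: (@dhomogMn _ _ _ 1 _ 3).
    by rewrite dhomogX; apply/eqP; exact: mdeg1.
  case/gen => [|q hq].
    by rewrite rmorphB rmorphM rmorphXn /= mmapXU -(hQ i).2 GE mmap_tangf subrr.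
  have := congr1 (mmap idfun v) hq.
  rewrite rmorphB !rmorphM /= Qi fv !mulr0 sub0r mmap_tangf => /eqP.
  by rewrite oppr_eq0.
- by rewrite /G (mmap_scale_homog _ _ _ hf) tang_on_cubic // mulr0.
rewrite -[RHS](mulr0 (t j ^+ 3)^-1) -[in RHS](tang_grad hf ft (unitv L j)).
by rewrite /dot mulr_sumr; apply: eq_bigr => i _; rewrite /G mulrCA.
Qed.

End TangentMap.

(** * Vanishing of sections of small degree *)

Section BinaryForms.

Variables (L C : comNzRingType) (phi : {rmorphism L -> C}).

Definition hbin (q : nat) (c : nat -> C) (a b : C) : C :=
  \sum_(i < q.+1) c i * a ^+ (q - i) * b ^+ i.

Lemma hbin_mulX q (c : nat -> C) a b (x y : C) : c q.+1 = 0 ->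
  hbin q.+1 (fun i => x * c i + y * (if i is j.+1 then c j else 0)) a b =
  (x * a + y * b) * hbin q c a b.
Proof.
move=> cq; rewrite /hbin; under eq_bigr => i _ do rewrite !mulrDl.
rewrite big_split /= big_ord_recr /= cq mulr0 !mul0r addr0.
rewrite [X in _ + X]big_ord_recl /= mulr0 !mul0r add0r mulrDl !mulr_sumr.
congr (_ + _); apply: eq_bigr => i _.
  by rewrite subSn ?exprS; [ring|rewrite -ltnS].
by rewrite /= /bump /= add1n subSS exprS; ring.
Qed.

(** Composes binary forms with linear ones; it evaluates both the transition between charts and the
    expansion along a line. *)
Lemma hbin_linear q m (p : {poly L}) (x y x' y' : L) a b : (m <= q)%N ->
  p = (x%:P + y *: 'X) ^+ (q - m) * (x'%:P + y' *: 'X) ^+ m ->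
  hbin q (fun i => phi p`_i) a b =
  (phi x * a + phi y * b) ^+ (q - m) * (phi x' * a + phi y' * b) ^+ m.
Proof.
have step r (g : {poly L}) u v : (size g <= r.+1)%N ->
    (size ((u%:P + v *: 'X) * g)%R <= r.+2)%N /\
    hbin r.+1 (fun i => phi ((u%:P + v *: 'X) * g)`_i) a b =
    (phi u * a + phi v * b) * hbin r (fun i => phi g`_i) a b.
  move=> sg; split.
    have s2 : (size (u%:P + v *: 'X)%R <= 2)%N.
      rewrite addrC -mul_polyC size_MXaddC; case: ifP => // _.
      by rewrite ltnS size_polyC leq_b1.
    apply: leq_trans (size_polyMleq _ _) _; rewrite -subn1 leq_subLR.
    exact: (leq_add s2 sg).
  rewrite -hbin_mulX; last by rewrite nth_default ?rmorph0.
  apply: eq_bigr => i _; congr (_ * _ * _).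
  rewrite mulrDl coefD coefCM -scalerAl coefZ coefXM rmorphD !rmorphM /=.
  by case: (nat_of_ord i) => [|j] //=; rewrite rmorph0.
have pow m1 m2 : let g := (x%:P + y *: 'X) ^+ m1 * (x'%:P + y' *: 'X) ^+ m2 in
   (size g <= (m1 + m2).+1)%N /\ hbin (m1 + m2) (fun i => phi g`_i) a b =
   (phi x * a + phi y * b) ^+ m1 * (phi x' * a + phi y' * b) ^+ m2.
  elim: m1 => [|m1 IH] /=.
    elim: m2 => [|m2 IH] /=.
      rewrite !expr0 mulr1 size_poly1; split=> //.
      by rewrite /hbin big_ord1 coef1 rmorph1 !expr0 !mulr1.
    rewrite !expr0 !mul1r !exprS in IH *; have [s e] := step _ _ x' y' IH.1.
    by rewrite !add0n in s e IH *; split=> //; rewrite e IH.2.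
  have [s e] := step _ _ x y IH.1.
  by rewrite !exprS -!mulrA addSn; split=> //; rewrite e IH.2.
move=> mq ->; have [_ /=] := pow (q - m)%N m; by rewrite subnK.
Qed.

End BinaryForms.

Section Vanishing.

Variables (k : closedFieldType) (L : fieldType) (phi : {rmorphism k -> L}).
Variable t : 'I_3 -> L.
Let reg := reg phi t.
Variables n G : 'I_3 -> L.
Hypotheses (regn : forall i, reg 2 (n i)) (regG : forall i, reg 4 (G i)).
Hypotheses (nzn : no_common_zero phi t 2 n) (nzG : no_common_zero phi t 4 G).
Hypothesis nG : dot n G = 0.

Lemma nzn1 e c : (forall i, reg (e + 2) (c * n i)) -> reg e c.
Proof. by move=> h; apply: (nzn (N := 1)) => i; rewrite expr1; exact: h. Qed.

Lemma nzG1 e c : (forall i, reg (e + 4) (c * G i)) -> reg e c.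
Proof. by move=> h; apply: (nzG (N := 1)) => i; rewrite expr1; exact: h. Qed.

Lemma cross_unitv_contract (A : comNzRingType) (u v w : 'I_3 -> A) i j :
  u j * (\sum_a cross (unitv A i) v a * w a)
  - u i * (\sum_a cross (unitv A j) v a * w a) =
  dot (cross (unitv A i) (unitv A j)) w * dot v u
  - dot v (cross (unitv A i) (unitv A j)) * (\sum_a u a * w a).
Proof. by move: i; apply: ord3P; move: j; apply: ord3P; vec3; ring. Qed.

Lemma cross_unitv_dot (A : comNzRingType) (v w : 'I_3 -> A) i :
  \sum_a cross (unitv A i) v a * w a = cross v w i.
Proof. by move: i; apply: ord3P; vec3; ring. Qed.

Lemma reg_cross_unitv d v i a : (forall j, reg d (v j)) ->
  reg d (cross (unitv L i) v a).
Proof.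
move=> hv; have hu b j : reg d (unitv L i b * v j).
  by rewrite /unitv; case: eqP => _; rewrite ?mul1r ?mul0r //; exact: reg0.
by apply: regB; apply: hu.
Qed.

(* T(s) stands for the value of a multilinear form on the rank 2 bundle G^perp
   at the sections e_a x G, a in s.  The section n of G^perp generates a
   subbundle whose slope is that of G^perp, so that contracting with n and then
   passing to the quotient reduces to lower tensors. *)
Lemma tensor_vanish q (d : int) (T : seq 'I_3 -> L) :
  (forall s, size s = q -> reg d (T s)) ->
  (forall s1 s2, (size s1 + size s2).+1 = q ->
     \sum_a G a * T (s1 ++ a :: s2) = 0) ->
  d < (2 * q)%N%:Z -> forall s, size s = q -> T s = 0.
Proof.
elim: q d T => [|q IH] d T Treg Torth dq s.
  move=> sq; have := Treg s sq; case: d dq {Treg} => d //=; lia.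
have [j0 Gj0] := no_common_zero_neq0 nzG.
(* Since (e_j x n) x G = G_j n, this is G_j times the contraction of the first slot with n. It has
   degree d + 2, and dividing by G_j leaves d - 2. *)
pose S j s' := \sum_a cross (unitv L j) n a * T (a :: s').
have GS j j' s' : size s' = q -> G j' * S j s' = G j * S j' s'.
  move=> sq; have := cross_unitv_contract G n (fun a => T (a :: s')) j j'.
  rewrite nG (Torth [::] s') /= ?sq // !mulr0 subrr => /eqP.
  by rewrite subr_eq0 => /eqP.
pose T1 s' := S j0 s' / G j0.
have GT1 j s' : size s' = q -> G j * T1 s' = S j s'.
  by move=> sq; rewrite /T1 mulrA GS // mulrAC divff // mul1r.
have T1reg s' : size s' = q -> reg (d - 2) (T1 s').
  move=> sq; apply: nzG1 => j; rewrite mulrC GT1 //.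
  have -> : d - 2 + 4 = 2 + d by lia.
  apply: reg_sum => a _; apply: regM; first exact: (reg_cross_unitv _ _ regn).
  by apply: Treg; rewrite /= sq.
have T1orth s1 s2 : (size s1 + size s2).+1 = q ->
    \sum_a G a * T1 (s1 ++ a :: s2) = 0.
  move=> sq; rewrite /T1 /S; under eq_bigr => a _ do rewrite mulrA mulr_sumr.
  rewrite -mulr_suml exchange_big /= big1 ?mul0r // => b _.
  under eq_bigr => a _ do rewrite mulrCA.
  by rewrite -mulr_sumr (Torth (b :: s1) s2) ?mulr0 //= addSn sq.
have d2 : d - 2 < (2 * q)%N%:Z by lia.
have T10 s' : size s' = q -> T1 s' = 0 := IH _ _ T1reg T1orth d2 s'.
(* The contraction with n vanishes, so the first slot factors through the quotient by n, where the
   class of e_a x G is proportional to n_a. *)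
have nT a b s' : size s' = q -> n a * T (b :: s') = n b * T (a :: s').
  move=> sq; apply: (@cross_parallel L n (fun a => T (a :: s'))) => j.
  by rewrite -cross_unitv_dot -/(S j s') -GT1 // T10 // mulr0.
have [b0 nb0] := no_common_zero_neq0 nzn.
pose T2 s' := T (b0 :: s') / n b0.
have nT2 a s' : size s' = q -> T2 s' * n a = T (a :: s').
  by move=> sq; rewrite /T2 mulrAC [_ * n a]mulrC nT // mulrAC divff // mul1r.
have T2reg s' : size s' = q -> reg (d - 2) (T2 s').
  move=> sq; apply: nzn1 => a; rewrite nT2 // subrK; apply: Treg; by rewrite /= sq.
have T2orth s1 s2 : (size s1 + size s2).+1 = q ->
    \sum_a G a * T2 (s1 ++ a :: s2) = 0.
  move=> sq; rewrite /T2; under eq_bigr => a _ do rewrite mulrA.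
  by rewrite -mulr_suml (Torth (b0 :: s1) s2) ?mul0r //= addSn sq.
case: s => // a s [sq].
by rewrite -nT2 // (IH _ _ T2reg T2orth d2 s sq) mul0r.
Qed.

End Vanishing.

Section SymVanishing.

Variables (k : closedFieldType) (L : fieldType) (phi : {rmorphism k -> L}).
Variable t : 'I_3 -> L.
Let reg := reg phi t.
Variables n G : 'I_3 -> L.
Hypotheses (regn : forall i, reg 2 (n i)) (regG : forall i, reg 4 (G i)).
Hypotheses (nzn : no_common_zero phi t 2 n) (nzG : no_common_zero phi t 4 G).
Hypothesis nG : dot n G = 0.

Let E b := cross (unitv L b) G.

Variables (q : nat) (d : int) (qc : 'I_3 -> nat -> L).
Hypothesis qc_reg : forall j i, (i <= q)%N -> reg d (qc j i).
Hypothesis qc_compat : forall j j' i', (i' <= q)%N ->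
  G j ^+ q * qc j' i' = \sum_(i < q.+1) (-1) ^+ i * qc j i *
    (((E (nx (nx j)) (nx j'))%:P + E (nx (nx j)) (nx (nx j')) *: 'X) ^+ (q - i) *
     ((E (nx j) (nx j'))%:P + E (nx j) (nx (nx j')) *: 'X) ^+ i)`_i'.
Hypothesis dq : d < (2 * q)%N%:Z.

(** By the alternating pairing a bundle of rank 2 is its own dual up to a twist. An element of Sym^q
    thus becomes a form of degree q on vectors u orthogonal to G, evaluated in the chart j at
    (u_(j+2), -u_(j+1)). *)
Let Q j (u : 'I_3 -> {poly L}) : {poly L} :=
  hbin q (fun i => (qc j i)%:P) (u (nx (nx j))) (- u (nx j)).

Lemma Q_compat j j' u : \sum_a (G a)%:P * u a = 0 ->
  (G j)%:P ^+ q * Q j' u = (G j')%:P ^+ q * Q j u.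
Proof.
move=> Gu.
(* The component j' of (e_b x G) x u = G u_b - e_b (G . u). *)
have Eu b : (E b (nx j'))%:P * u (nx (nx j')) + (E b (nx (nx j')))%:P * (- u (nx j')) =
    (G j')%:P * u b.
  transitivity ((G j')%:P * u b - unitv _ b j' * (\sum_a (G a)%:P * u a)).
    rewrite /E; move: b; apply: ord3P; move: (j'); apply: ord3P; vec3;
    by rewrite !polyCB !polyCM; ring.
  by rewrite Gu mulr0 subr0.
transitivity (\sum_(i < q.+1) ((-1) ^+ i * qc j i)%:P *
    hbin q (fun l => ((((E (nx (nx j)) (nx j'))%:P + E (nx (nx j)) (nx (nx j')) *: 'X) ^+ (q - i) *
     ((E (nx j) (nx j'))%:P + E (nx j) (nx (nx j')) *: 'X) ^+ i)`_l)%:P)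
     (u (nx (nx j'))) (- u (nx j'))).
  rewrite /Q /hbin mulr_sumr; under [RHS]eq_bigr => i _ do rewrite mulr_sumr.
  rewrite exchange_big /=; apply: eq_bigr => l _.
  rewrite !mulrA -rmorphXn -polyCM (qc_compat _ _ (ltnSE (ltn_ord l))) rmorph_sum !mulr_suml.
  by apply: eq_bigr => i _; rewrite /= !polyCM !mulrA.
rewrite [in RHS]/Q [in RHS]/hbin mulr_sumr; apply: eq_bigr => i _.
have iq : (i <= q)%N by rewrite -ltnS.
rewrite (hbin_linear polyC _ _ iq (erefl _)) /= !Eu.
have -> : (G j')%:P ^+ q = (G j')%:P ^+ (q - i) * (G j')%:P ^+ i.
  by rewrite -exprD subnK.
rewrite polyCM rmorphXn rmorphN rmorph1 !exprMn [(- u _) ^+ i]exprNn.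
move: ((G j')%:P ^+ (q - i)) ((G j')%:P ^+ i) (u (nx j) ^+ i) => x1 x2 x3.
by move: (u (nx (nx j)) ^+ (q - i)) ((-1) ^+ i) => x4 x5; ring.
Qed.

Let U b (a : 'I_3) : {poly L} := (n a)%:P + E b a *: 'X.
Let P j b := Q j (U b).

Lemma Q_expand j b (x y : {poly L}) :
  Q j (fun a => x * (n a)%:P + y * (E b a)%:P) =
  hbin q (fun i => ((P j b)`_i)%:P) x y.
Proof.
have PE : P j b = \sum_(i < q.+1) (qc j i)%:P *
   (((n (nx (nx j)))%:P + E b (nx (nx j)) *: 'X) ^+ (q - i) *
    ((- n (nx j))%:P + (- E b (nx j)) *: 'X) ^+ i).
  have NU : - U b (nx j) = (- n (nx j))%:P + (- E b (nx j)) *: 'X.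
    by rewrite /U polyCN scaleNr opprD.
  by apply: eq_bigr => i _; rewrite NU mulrA.
rewrite /hbin; under [RHS]eq_bigr => l _.
  rewrite PE coef_sum rmorph_sum /= mulr_suml mulr_suml; over.
rewrite exchange_big /=; apply: eq_bigr => i _.
have iq : (i <= q)%N by rewrite -ltnS.
have := hbin_linear polyC x y iq (erefl (((n (nx (nx j)))%:P + E b (nx (nx j)) *: 'X) ^+ (q - i) *
    ((- n (nx j))%:P + (- E b (nx j)) *: 'X) ^+ i)).
rewrite /hbin => e; under eq_bigr => l _ do rewrite coefCM polyCM -!mulrA.
rewrite -mulr_sumr -mulrA; congr (_ * _).
transitivity (((n (nx (nx j)))%:P * x + (E b (nx (nx j)))%:P * y) ^+ (q - i) *
  ((- n (nx j))%:P * x + (- E b (nx j))%:P * y) ^+ i).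
  by congr (_ ^+ _ * _ ^+ _); rewrite ?polyCN; ring.
by rewrite -e; apply: eq_bigr => l _; rewrite mulrA.
Qed.

(** In [U b] the constant term n has degree 2 and the coefficient e_b x G of X degree 4, so each
    power of X costs 2 more. *)
Let graded (m : nat) (p : {poly L}) :=
  forall i : nat, reg (2 * (m + i))%N%:Z p`_i.

Lemma gradedM m m' p p' : graded m p -> graded m' p' -> graded (m + m') (p * p').
Proof.
move=> gp gp' i; rewrite coefM; apply: reg_sum => l _.
have -> : (2 * (m + m' + i))%N%:Z = (2 * (m + l))%N%:Z + (2 * (m' + (i - l)))%N%:Z.
  by have := ltn_ord l; lia.
by apply: regM; [exact: gp|exact: gp'].
Qed.

Lemma gradedX m p r : graded m p -> graded (m * r) (p ^+ r).
Proof.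
move=> gp; elim: r => [|r IH].
  by rewrite muln0 expr0 => -[|i]; rewrite coef1; [exact: reg1|exact: reg0].
by rewrite mulnS exprS; exact: gradedM.
Qed.

Lemma reg_E b a : reg 4 (E b a).
Proof. exact: reg_cross_unitv. Qed.

Lemma graded_U b a : graded 1 (U b a).
Proof.
move=> [|[|i]]; rewrite /U coefD coefC coefZ coefX /= ?(mulr0, mulr1, addr0, add0r).
- exact: regn.
- exact: reg_E.
exact: (@reg0 _ _ phi t (Posz _)).
Qed.

Lemma reg_P j b i : reg (d + (2 * (q + i))%N%:Z) (P j b)`_i.
Proof.
rewrite /P /Q /hbin coef_sum; apply: reg_sum => l _; rewrite -mulrA coefCM.
apply: regM; first by apply: qc_reg; rewrite -ltnS.
have gN : graded 1 (- U b (nx j)).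
  by move=> r; rewrite coefN; apply: regN; exact: graded_U.
have := gradedM (gradedX (q - l) (graded_U b (nx (nx j)))) (gradedX l gN).
by rewrite !mul1n subnK ?leq_ord // => gQ; exact: gQ.
Qed.

Lemma G_U b : \sum_a (G a)%:P * U b a = 0.
Proof.
transitivity ((dot n G)%:P + (dot G (E b)) *: 'X).
  rewrite /dot !rmorph_sum scaler_suml -big_split; apply: eq_bigr => a _ /=.
  by rewrite /U mulrDr -polyCM [G a * n a]mulrC mul_polyC scalerA.
have -> : dot G (E b) = 0 by rewrite /E; move: b; apply: ord3P; vec3; ring.
by rewrite nG scale0r addr0.
Qed.

(** Modulo n the directions e_b x G are proportional to n_b, and rho records the multiple of n. *)
Lemma P_change j b b' : exists rho : L,
  hbin q (fun i => ((P j b)`_i)%:P) 1 (n b' *: 'X) =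
  hbin q (fun i => ((P j b')`_i)%:P) (1 + rho *: 'X) (n b *: 'X).
Proof.
exists (- dot (cross (unitv L b) (unitv L b')) G).
rewrite -!Q_expand /Q.
have e a : 1 * (n a)%:P + (n b' *: 'X) * (E b a)%:P =
   (1 + (- dot (cross (unitv L b) (unitv L b')) G) *: 'X) * (n a)%:P +
   (n b *: 'X) * (E b' a)%:P.
  have ee : n b' * E b a = (- dot (cross (unitv L b) (unitv L b')) G) * n a + n b * E b' a
    + cross (unitv L b) (unitv L b') a * dot n G.
    rewrite /E; move: a; apply: ord3P; move: b; apply: ord3P; move: b'; apply: ord3P;
    by vec3; ring.
  rewrite nG mulr0 addr0 in ee.
  rewrite mulrDl -addrA; congr (_ + _); rewrite -!scalerAl ![_ * _%:P]mulrC !mul_polyC.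
  by rewrite !scalerA -scalerDl ee.
by rewrite !e.
Qed.

(** The terms with l > i are divisible by X^(i+1), and the powers of 1 + rho X have constant term
    1. *)
Lemma coef_hbin_low (p : nat -> L) rho c i : (i <= q)%N ->
  (forall l, (l < i)%N -> p l = 0) ->
  (hbin q (fun l => (p l)%:P) (1 + rho *: 'X) (c *: 'X))`_i = p i * c ^+ i.
Proof.
move=> iq p0; rewrite /hbin coef_sum (bigD1 (inord i)) //= inordK ?ltnS //.
rewrite [X in _ + X]big1 ?addr0 => [|l li]; last first.
  rewrite -mulrA coefCM; have [lt|ge] := ltnP l i; first by rewrite p0 ?mul0r.
  rewrite exprZn -scalerAr coefZ coefMXn; have {}ge : (i < l)%N.
    rewrite ltn_neqAle ge andbT; apply: contraNneq li => e.
    by apply/eqP/val_inj; rewrite /= inordK ?ltnS // e.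
  by rewrite ge !mulr0.
rewrite -mulrA coefCM exprZn -scalerAr coefZ coefMXn ltnn subnn.
rewrite -horner_coef0 horner_exp hornerD hornerZ hornerX hornerC mulr0 addr0.
by rewrite expr1n mulr1.
Qed.

(* Q j is the given section in the chart G_j <> 0, as a form on vectors orthogonal
   to G, and P j b is its expansion at n in the direction e_b x G.  Once the
   coefficients below i vanish, P_change makes the i-th one proportional to n_b^i,
   and dividing by n_b^i G_j^q leaves a section of negative degree. *)
Lemma P_coef0 i : (i <= q)%N -> forall j b, (P j b)`_i = 0.
Proof.
have [j0 Gj0] := no_common_zero_neq0 nzG.
have [b0 nb0] := no_common_zero_neq0 nzn.
have PG j j' b l : G j ^+ q * (P j' b)`_l = G j' ^+ q * (P j b)`_l.
  by rewrite -!coefCM !rmorphXn /= Q_compat // G_U.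
elim/ltn_ind: i => i IH iq.
have n_P j b b' : (P j b)`_i * n b' ^+ i = (P j b')`_i * n b ^+ i.
  have [rho] := P_change j b b'; move/(congr1 (fun p : {poly L} => p`_i)).
  have low b1 l : (l < i)%N -> (P j b1)`_l = 0.
    by move=> li; apply: IH => //; apply: leq_trans (ltnW li) iq.
  rewrite coef_hbin_low; [|by []|exact: low].
  have := coef_hbin_low 0 (n b') iq (low b).
  by rewrite scale0r addr0 => ->.
pose tau := (P j0 b0)`_i / (n b0 ^+ i * G j0 ^+ q).
have tauE j b : tau * n b ^+ i * G j ^+ q = (P j b)`_i.
  have e1 := n_P j0 b b0; have e2 := PG j0 j b i.
  apply: (mulIf (x := n b0 ^+ i * G j0 ^+ q)).
    by rewrite mulf_neq0 ?expf_neq0.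
  transitivity ((P j0 b0)`_i * n b ^+ i * G j ^+ q).
    rewrite /tau; move: (mulf_neq0 (expf_neq0 i nb0) (expf_neq0 q Gj0)).
    by move: (_ * G j0 ^+ q) => D D0; field.
  by rewrite -e1 mulrAC [_ * G j ^+ q]mulrC -e2; ring.
(* The coefficient has degree d + 2(q + i); dividing by n_b^i and G_j^q removes 2i + 4q. *)
have tau_reg : reg (d - (2 * q)%N%:Z) tau.
  apply: (nzn (N := i)) => b; apply: (nzG (N := q)) => j.
  rewrite tauE; have := reg_P j b i.
  by congr (reg _ _); lia.
have tau0 : tau = 0.
  move: tau_reg; have : d - (2 * q)%N%:Z < 0 by lia.
  by case: (d - (2 * q)%N%:Z).
by move=> j b; rewrite -tauE tau0 !mul0r.
Qed.

(** For n_b nonzero, n and e_b x G form a frame with determinant -n_b G_j in the chart j. The vector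
    at which Q j is evaluated at (1, X) is a combination of them, and the value there lists the
    coefficients [qc j i]. *)
Lemma sym_vanish j i : G j != 0 -> (i <= q)%N -> qc j i = 0.
Proof.
move=> Gj iq; have [b nb] := no_common_zero_neq0 nzn.
have D0 : n (nx j) * E b (nx (nx j)) - n (nx (nx j)) * E b (nx j) = - (n b * G j).
  transitivity (unitv L b j * dot n G - n b * G j).
    by rewrite /E; move: b {nb}; apply: ord3P; move: j {Gj}; apply: ord3P; vec3; ring.
  by rewrite nG mulr0 sub0r.
set D := - (n b * G j) in D0; have D_neq0 : D != 0 by rewrite oppr_eq0 mulf_neq0.
pose x : {poly L} := (- D^-1)%:P * ((E b (nx j))%:P + (E b (nx (nx j)))%:P * 'X).
pose y : {poly L} := D^-1%:P * ((n (nx j))%:P + (n (nx (nx j)))%:P * 'X).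
have inv : D^-1%:P * ((n (nx j))%:P * (E b (nx (nx j)))%:P -
    (n (nx (nx j)))%:P * (E b (nx j))%:P) = 1 :> {poly L}.
  by rewrite -!polyCM -polyCB D0 -polyCM mulVf.
have := Q_expand j b x y.
rewrite [RHS]big1 => [|l _]; last first.
  by rewrite P_coef0 ?leq_ord // !mul0r.
rewrite /Q.
have -> : x * (n (nx (nx j)))%:P + y * (E b (nx (nx j)))%:P = 1.
  rewrite -[RHS]inv /x /y polyCN; ring.
have -> : - (x * (n (nx j))%:P + y * (E b (nx j))%:P) = 'X.
  rewrite -['X in RHS]mul1r -inv /x /y polyCN; ring.
move/(congr1 (fun p : {poly L} => p`_i)); rewrite coef0 /hbin coef_sum.
rewrite (bigD1 (inord i)) //= inordK ?ltnS // big1 => [|l li].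
  by rewrite expr1n mulr1 coefCM coefXn eqxx mulr1 addr0.
rewrite expr1n mulr1 coefCM coefXn; case: eqP => [e|_]; last by rewrite mulr0.
by case/eqP: li; apply/val_inj; rewrite /= inordK ?ltnS.
Qed.

End SymVanishing.

(** * Symmetric powers and their duals *)

Section SymPower.

Variables (R : comNzRingType) (M : lmodType R) (q : nat).
Implicit Types (m : {ffun 'I_q -> M}).

Lemma freegU_scale (K : choiceType) (c a : R) (x : K) :
  c *: << a *g x >> = << c * a *g x >> :> {freeg K / R}.
Proof.
by apply/eqP/freeg_eqP => y; rewrite coeffZ !coeffU mulrA.
Qed.

Lemma fglift_scale (K : choiceType) (V : lmodType R) (g : K -> V) c D :
  fglift g (c *: D) = c *: fglift g D.
Proof.
pose h : {additive {freeg K / R} -> V} := HB.pack (fglift g)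
  (GRing.isZmodMorphism.Build _ _ (fglift g) (@lift_is_additive R K V g)).
have hsum I (r : seq I) (F : I -> {freeg K / R}) :
  fglift g (\sum_(i <- r) F i) = \sum_(i <- r) fglift g (F i) := raddf_sum h _ _ _.
rewrite -[in LHS](freeg_sumE D) scaler_sumr hsum -[in RHS](freeg_sumE D) hsum.
rewrite scaler_sumr; apply: eq_bigr => x _.
by rewrite freegU_scale !liftU scalerA.
Qed.

Lemma fglift_linear (K : choiceType) (V : lmodType R) (g : K -> V) :
  linear (fglift g).
Proof.
pose h : {additive {freeg K / R} -> V} := HB.pack (fglift g)
  (GRing.isZmodMorphism.Build _ _ (fglift g) (@lift_is_additive R K V g)).
by move=> c x y; rewrite -fglift_scale; exact: (raddfD h).
Qed.

Lemma quot_proj_linear (V : lmodType R) (S : set V) : linear (@quot_proj R V S).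
Proof. by move=> a x y; rewrite quot_projD quot_projZ. Qed.

Lemma lin_span_mem (V : lmodType R) (S : set V) x : S x -> x \in lin_span S.
Proof.
move=> Sx; apply/asboolP; exists 1%N, (fun=> 1), (fun=> x).
by rewrite big_ord1 scale1r.
Qed.

Lemma sym_prod_linear m i a x y :
  sym_prod (upd m i (a *: x + y)) =
  a *: sym_prod (upd m i x) + sym_prod (upd m i y).
Proof.
rewrite /sym_prod; transitivity (quot_proj (@sym_rel R M q)
  (a *: << upd m i x >> + << upd m i y >>)); last exact: quot_proj_linear.
apply/quot_projP; rewrite opprD addrA; apply: lin_span_mem; left.
by exists m, i, a, x, y.
Qed.

Lemma sym_prod_perm m (s : 'S_q) :
  sym_prod [ffun j => m (s j)] = sym_prod m.
Proof.
apply/quot_projP; apply: lin_span_mem; right; by exists m, s.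
Qed.

Lemma sym_mod_span (z : sym_mod M q) :
  exists n (r : 'I_n -> R) (m : 'I_n -> {ffun 'I_q -> M}),
  z = \sum_(i < n) r i *: sym_prod (m i).
Proof.
pose S := @sym_rel R M q.
pose h : {linear {freeg {ffun 'I_q -> M} / R} -> quot_mod S} := HB.pack (quot_proj S)
  (GRing.isLinear.Build _ _ _ _ (quot_proj S) (@quot_proj_linear _ S)).
pose D := repr (z : Quotient.quot (GRing.ZmodClosed.clone _ (lin_span S) _)).
have -> : z = h (\sum_(i <- dom D) coeff i D *: << i >>).
  rewrite -[LHS]quot_projK -/D; congr (quot_proj S _).
  rewrite -[LHS]freeg_sumE; apply: eq_bigr => i _.
  by rewrite freegU_scale mulr1.
rewrite raddf_sum /= (big_nth [ffun=> 0]) big_mkord.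
exists (size (dom D)), (fun i => coeff (nth [ffun=> 0] (dom D) i) D),
  (fun i => nth [ffun=> 0] (dom D) i).
by apply: eq_bigr => i _; exact: (@quot_projZ _ _ S).
Qed.

Definition multilinear (V : lmodType R) (B : {ffun 'I_q -> M} -> V) :=
  forall m i a x y, B (upd m i (a *: x + y)) =
    a *: B (upd m i x) + B (upd m i y).

Definition symmetric_map (V : Type) (B : {ffun 'I_q -> M} -> V) :=
  forall m (s : 'S_q), B [ffun j => m (s j)] = B m.

Lemma sym_lift (B : {ffun 'I_q -> M} -> R^o) :
  multilinear B -> symmetric_map B ->
  exists h : sym_mod M q -> R^o, linear h /\ forall m, h (sym_prod m) = B m.
Proof.
move=> Bl Bs; pose S := @sym_rel R M q.
pose g : {linear {freeg {ffun 'I_q -> M} / R} -> R^o} := HB.pack (fglift B)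
  (GRing.isLinear.Build _ _ _ _ (fglift B) (fglift_linear B)).
have gU m : g << m >> = B m by rewrite /= liftU scale1r.
have g0 x : x \in lin_span S -> g x = 0.
  move=> /asboolP[n [c [u [Su ->]]]]; rewrite (linear_sum g) big1 // => i _.
  rewrite -[_ *: u i]addr0 (linearP g) (linear0 g) addr0.
  suff -> : g (u i) = 0 by rewrite scaler0.
  have [[m [j [a [y [z ->]]]]]|[m [s ->]]] := Su i.
    rewrite !(linearB g) (linearZ_LR g) !gU Bl.
    by rewrite [_ *: B _ + _]addrC addrK subrr.
  by rewrite (linearB g) !gU Bs subrr.
pose h (z : sym_mod M q) : R^o :=
  g (repr (z : Quotient.quot (GRing.ZmodClosed.clone _ (lin_span S) _))).
have hE x : h (quot_proj S x) = g x.
  apply/eqP; rewrite -subr_eq0 -(linearB g) g0 //.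
  by apply/quot_projP; rewrite quot_projK.
exists h; split=> [a x y|m]; last by rewrite /sym_prod hE.
have <- : quot_proj S (a *: repr (x : Quotient.quot (GRing.ZmodClosed.clone _ (lin_span S) _))
   + repr (y : Quotient.quot (GRing.ZmodClosed.clone _ (lin_span S) _))) = a *: x + y.
  by rewrite quot_proj_linear !quot_projK.
rewrite hE (linearP g) /h; congr (_ *: g _ + g _); exact/esym/quot_projK.
Qed.

End SymPower.

Section LinearDependence.

Variable A : comNzRingType.
Hypothesis dom : forall a b : A, a * b = 0 -> a = 0 \/ b = 0.

(** Fraction-free Gaussian elimination; the pivot multiplies the solution of the smaller system,
    which stays nonzero in a domain. *)
Lemma linear_dependence m n (V : 'I_n -> 'I_m -> A) : (m < n)%N ->
  exists c : 'I_n -> A, (exists i, c i != 0) /\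
    forall j, \sum_i c i * V i j = 0.
Proof.
elim: m n V => [|m IH] [//|n] V mn.
  by exists (fun=> 1); split=> [|[]//]; exists ord0; exact: oner_neq0.
have [[p vp]|v0] := pselect (exists p, V p ord0 != 0); last first.
  have [c [c0 hc]] := IH n.+1 (fun i j => V i (fintype.lift ord0 j)) (ltnW mn).
  exists c; split=> // j; case: (unliftP ord0 j) => [j' ->|->]; first exact: hc.
  rewrite big1 // => i _; have [->|vi] := eqVneq (V i ord0) 0; first by rewrite mulr0.
  by case: v0; exists i.
pose W (i : 'I_n) (j : 'I_m) : A :=
  V p ord0 * V (fintype.lift p i) (fintype.lift ord0 j)
  - V (fintype.lift p i) ord0 * V p (fintype.lift ord0 j).
have [d [[i0 d0] hd]] := IH n W mn.
exists (fun i => if unlift p i is Some i' then d i' * V p ord0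
                 else - \sum_i' d i' * V (fintype.lift p i') ord0).
split.
  exists (fintype.lift p i0); rewrite fintype.liftK; apply/eqP => /dom[] /eqP.
    by rewrite (negPf d0).
  by rewrite (negPf vp).
move=> j; rewrite (bigD1_ord p) // unlift_none.
rewrite /= [X in _ + X](eq_bigr (fun i => d i * V p ord0 * V (fintype.lift p i) j));
  last by move=> i _; rewrite fintype.liftK.
case: (unliftP ord0 j) => [j' ->|->].
  rewrite -[RHS](hd j') mulNr mulr_suml -sumrN -big_split; apply: eq_bigr => i _ /=.
  by rewrite /W; ring.
rewrite mulNr mulr_suml -sumrN -big_split big1 // => i _ /=; ring.
Qed.

End LinearDependence.

Section MaxNat.

Lemma max_natE (P : set nat) n : P n -> (forall m, P m -> (m <= n)%N) ->
  max_nat P = n.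
Proof.
move=> Pn Pmax; rewrite /max_nat; case: xgetP => [m -> [Pm mmax]|/(_ n)[]//].
by apply/eqP; rewrite eqn_leq mmax // Pmax.
Qed.

Lemma max_natP (P : set nat) : max_nat P = 0%N \/ P (max_nat P).
Proof. by rewrite /max_nat; case: xgetP => [m -> [Pm _]|_]; [right|left]. Qed.

End MaxNat.

Section Multilinear.

Variables (R : comNzRingType) (M : lmodType R) (q : nat).
Implicit Types (m : {ffun 'I_q -> M}) (B : {ffun 'I_q -> M} -> R^o).

Lemma multilinear0 B m i : multilinear B -> B (upd m i 0) = 0.
Proof.
move=> Bl; have := Bl m i 1 0 0; rewrite !scale1r addr0 => /eqP.
by rewrite -subr_eq0 opprD addrA subrr sub0r oppr_eq0 => /eqP.
Qed.

Lemma multilinear2 B m i a b x y : multilinear B ->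
  B (upd m i (a *: x + b *: y)) = a *: B (upd m i x) + b *: B (upd m i y).
Proof.
move=> Bl; rewrite Bl; congr (_ + _).
by rewrite -[b *: y]addr0 Bl multilinear0 ?addr0.
Qed.

Lemma upd_id m i : upd m i (m i) = m.
Proof. by apply/ffunP => j; rewrite ffunE; case: eqP => [->|]. Qed.

(** Scaling a slot by x rewrites its entry in terms of [S], one slot at a time, and x is cancelled
    afterwards. *)
Lemma multilinear_agree B1 B2 (x : R) (S : set M) :
  multilinear B1 -> multilinear B2 ->
  (forall c, x * c = 0 -> c = 0) ->
  (forall u, exists a b s s', [/\ S s, S s' & x *: u = a *: s + b *: s']) ->
  (forall m, (forall l, S (m l)) -> B1 m = B2 m) ->
  forall m, B1 m = B2 m.
Proof.
move=> B1l B2l xreg gen agree.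
suff H r m : (forall l : 'I_q, (r <= l)%N -> S (m l)) -> B1 m = B2 m.
  by move=> m; apply: (H q) => l; rewrite leqNgt ltn_ord.
elim: r m => [|r IH] m hm; first by apply: agree => l; apply: hm.
have [rq|qr] := ltnP r q; last first.
  by apply: IH => l rl; have := leq_ltn_trans (leq_trans qr rl) (ltn_ord l); rewrite ltnn.
pose i := Ordinal rq.
have [a [b [s [s' [Ss Ss' e]]]]] := gen (m i).
have Su s1 : S s1 -> B1 (upd m i s1) = B2 (upd m i s1).
  move=> Ss1; apply: IH => l rl; rewrite ffunE; case: eqP => // /eqP li.
  by apply: hm; rewrite ltn_neqAle rl andbT eq_sym.
apply/eqP; rewrite -subr_eq0; apply/eqP/xreg; rewrite mulrBr; apply/eqP.
have scale B : multilinear B -> x * B m = B (upd m i (x *: m i)).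
  by move=> Bl; rewrite -[x *: m i]addr0 Bl multilinear0 // addr0 upd_id.
by rewrite subr_eq0 !scale // e !multilinear2 // !Su.
Qed.

Lemma symmetric_map_perm (T : eqType) (B : {ffun 'I_q -> M} -> R^o) (g : T -> M)
  (u v : q.-tuple T) : symmetric_map B -> perm_eq u v ->
  B [ffun l => g (tnth u l)] = B [ffun l => g (tnth v l)].
Proof.
move=> Bs /tuple_permP[p up].
rewrite -(Bs [ffun l => g (tnth v l)] p); congr B; apply/ffunP => l.
by rewrite !ffunE (val_inj up) tnth_mktuple.
Qed.

End Multilinear.

Section Dual.

Variables (R : comNzRingType) (M : lmodType R).

Lemma dual_linear (phi : dual_mod M) : linear (val phi).
Proof. by have := valP phi; rewrite unfold_in => /asboolP. Qed.

Lemma exists_dual (g : M -> R^o) : linear g -> exists phi : dual_mod M, val phi = g.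
Proof.
move=> gl; have gd : g \in @dual_pred R M by rewrite unfold_in; apply/asboolP.
by exists (Sub g gd); rewrite SubK.
Qed.

Lemma dual_ext (phi psi : dual_mod M) : (forall x, val phi x = val psi x) -> phi = psi.
Proof. by move=> e; apply/val_inj/funext. Qed.

Lemma dual_sum (phi : dual_mod M) n (r : 'I_n -> R) (x : 'I_n -> M) :
  val phi (\sum_(i < n) r i *: x i) = \sum_(i < n) r i * val phi (x i).
Proof.
have lin := dual_linear phi.
have phi0 : val phi 0 = 0.
  by have := lin (-1) 0 0; rewrite scaler0 addr0 scaleN1r addrC subrr.
elim: n r x => [|n IH] r x; first by rewrite !big_ord0.
by rewrite !big_ord_recl lin IH.
Qed.

Lemma val_dual_sum n (r : 'I_n -> R) (phi : 'I_n -> dual_mod M) x :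
  val (\sum_(i < n) r i *: phi i) x = \sum_(i < n) r i * val (phi i) x.
Proof.
elim: n r phi => [|n IH] r phi; first by rewrite !big_ord0.
by rewrite !big_ord_recl /= -IH.
Qed.

End Dual.

(** * Reflexive symmetric powers of a module with Koszul generators *)

Section SymDual.

Variables (A : gradedRing) (M : gradedModule A).
Hypothesis dom : forall a b : A, a * b = 0 -> a = 0 \/ b = 0.
Hypothesis rdeg0 : forall d, rdeg d (0 : A).
Hypothesis rdegD : forall d (a b : A), rdeg d a -> rdeg d b -> rdeg d (a + b).
Hypothesis rdegM : forall d e (a b : A), rdeg d a -> rdeg e b -> rdeg (d + e) (a * b).
Hypothesis rdeg1 : rdeg 0 (1 : A).

Variables (X : 'I_3 -> A) (w : M -> 'I_3 -> A) (kappa : 'I_3 -> M) (a1 : int).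
Hypothesis X_neq0 : forall j, X j != 0.
Hypothesis w_linear : forall a u v i, w (a *: u + v) i = a * w u i + w v i.
Hypothesis w_kappa : forall b i, w (kappa b) i = cross (unitv A b) X i.
Hypothesis X_scale : forall j u, X j *: u =
  w u (nx j) *: kappa (nx (nx j)) + (- w u (nx (nx j))) *: kappa (nx j).
Hypothesis X_kappa : \sum_a X a *: kappa a = 0.
Hypothesis w_deg : forall e u, gdeg e u -> forall i, rdeg (e + a1) (w u i).
Hypothesis kappa_deg : forall b, gdeg (1 - a1) (kappa b).

Variable q : nat.

Let SM := sym_mod M q.
Local Notation Sdual := (dual_mod SM).
Local Notation Sddual := (dual_mod Sdual).

Lemma rdeg_sum (I : Type) (r : seq I) (F : I -> A) d :
  (forall i, rdeg d (F i)) -> rdeg d (\sum_(i <- r) F i).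
Proof. by move=> h; apply: big_ind => //; exact: rdegD. Qed.

Lemma X_reg n j (c : A) : X j ^+ n * c = 0 -> c = 0.
Proof.
elim: n c => [|n IH] c; first by rewrite expr0 mul1r.
by rewrite exprSr -mulrA => /IH /dom[/eqP|//]; rewrite (negPf (X_neq0 j)).
Qed.

Let wpoly j (u : M) : {poly A} := (w u (nx j))%:P + w u (nx (nx j)) *: 'X.

(* Over x_j <> 0 the bundle is trivialized by (w_(j+1), w_(j+2)); the theta_fun j i
   are the coordinates of Sym^q in this trivialization. *)
Definition theta_fun j i (m : {ffun 'I_q -> M}) : A^o :=
  (\prod_l wpoly j (m l))`_i.

Lemma theta_fun_multilinear j i : multilinear (theta_fun j i).
Proof.
move=> m l a x y; rewrite /theta_fun.
have split z : \prod_l' wpoly j (upd m l z l') =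
    wpoly j z * \prod_(l' | l' != l) wpoly j (m l').
  rewrite (bigD1 l) //= ffunE eqxx; congr (_ * _); apply: eq_bigr => l' /negPf ll.
  by rewrite ffunE ll.
rewrite !split; set r := \prod_(_ | _) _.
have -> : wpoly j (a *: x + y) = a%:P * wpoly j x + wpoly j y.
  rewrite /wpoly !w_linear polyCD polyCM scalerDl mulrDr mul_polyC.
  by rewrite mul_polyC scalerA addrACA.
by rewrite mulrDl coefD -mulrA coefCM.
Qed.

Lemma theta_fun_symmetric j i : symmetric_map (theta_fun j i).
Proof.
move=> m s; rewrite /theta_fun.
suff -> : \prod_l wpoly j ([ffun l' => m (s l')] l) = \prod_l wpoly j (m l) by [].
rewrite [RHS](reindex_inj (@perm_inj _ s)) /=.
by apply: eq_bigr => l _; rewrite ffunE.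
Qed.

Lemma exists_theta : exists theta : 'I_3 -> nat -> Sdual,
  forall j i m, val (theta j i) (sym_prod m) = theta_fun j i m.
Proof.
have H j i : exists th : Sdual, forall m, val th (sym_prod m) = theta_fun j i m.
  have [h [hl hE]] := sym_lift (theta_fun_multilinear j i) (@theta_fun_symmetric j i).
  by have [th thE] := exists_dual hl; exists th => m; rewrite thE hE.
have /choice[theta htheta] : forall ji : 'I_3 * nat, exists th : Sdual,
    forall m, val th (sym_prod m) = theta_fun ji.1 ji.2 m by move=> ji; exact: H.
by exists (fun j i => theta (j, i)) => j i m; rewrite htheta.
Qed.

Definition kword (s : seq 'I_3) : {ffun 'I_q -> M} :=
  [ffun l : 'I_q => kappa (nth o0 s l)].

(** By [X_scale], kappa_(j+2) and -kappa_(j+1) are X_j times the frame dual to (w_(j+1), w_(j+2));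
    these words spell the monomials of degree q in that frame. *)
Definition standard_word (j : 'I_3) (i : nat) : seq 'I_3 :=
  nseq (q - i) (nx (nx j)) ++ nseq i (nx j).

Lemma size_standard_word j i : (i <= q)%N -> size (standard_word j i) = q.
Proof. by move=> iq; rewrite size_cat !size_nseq subnK. Qed.

Lemma theta_standard j j' i i' : (i <= q)%N ->
  theta_fun j' i' (kword (standard_word j i)) =
  (((cross (unitv A (nx (nx j))) X (nx j'))%:P +
     cross (unitv A (nx (nx j))) X (nx (nx j')) *: 'X) ^+ (q - i) *
   ((cross (unitv A (nx j)) X (nx j'))%:P +
     cross (unitv A (nx j)) X (nx (nx j')) *: 'X) ^+ i)`_i'.
Proof.
move=> iq; rewrite /theta_fun; congr ((polyseq _)`_i').
transitivity (\prod_(b <- standard_word j i) wpoly j' (kappa b)).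
  rewrite (big_nth o0) size_standard_word // big_mkord.
  by apply: eq_bigr => l _; rewrite ffunE.
by rewrite big_cat !big_nseq !iter_mulr_1 /= /wpoly !w_kappa.
Qed.

Lemma theta_standard_same j i i' : (i <= q)%N ->
  theta_fun j i' (kword (standard_word j i)) =
  (-1) ^+ i * X j ^+ q * (i' == i)%:R.
Proof.
move=> iq; rewrite theta_standard //.
have -> : cross (unitv A (nx (nx j))) X (nx j) = X j.
  by move: j; apply: ord3P; vec3; ring.
have -> : cross (unitv A (nx (nx j))) X (nx (nx j)) = 0.
  by move: j; apply: ord3P; vec3; ring.
have -> : cross (unitv A (nx j)) X (nx j) = 0.
  by move: j; apply: ord3P; vec3; ring.
have -> : cross (unitv A (nx j)) X (nx (nx j)) = - X j.
  by move: j; apply: ord3P; vec3; ring.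
rewrite scale0r addr0 add0r exprZn -rmorphXn /= coefCM coefZ coefXn.
have -> : X j ^+ q = X j ^+ (q - i) * X j ^+ i by rewrite -exprD subnK.
rewrite [(- X j) ^+ i]exprNn; move: (X j ^+ (q - i)) (X j ^+ i) ((-1) ^+ i) => x y z.
by move: (_%:R) => c; ring.
Qed.

Lemma standard_perm (t : q.-tuple bool) j : exists2 i, (i <= q)%N &
  forall B : {ffun 'I_q -> M} -> A^o, symmetric_map B ->
  B [ffun l => kappa (if tnth t l then nx j else nx (nx j))] =
  B (kword (standard_word j i)).
Proof.
pose i := count id t; have iq : (i <= q)%N by rewrite -(size_tuple t) count_size.
exists i => // B Bs.
have st : size (nseq (q - i) false ++ nseq i true) == q.
  by rewrite size_cat !size_nseq subnK.
have pt : perm_eq t (Tuple st).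
  rewrite /=; apply/allP => b _; rewrite /= count_cat !count_nseq.
  have c : count_mem true t = i by apply: eq_count => -[].
  have cf : count_mem false t = (q - i)%N.
    have := count_predC (pred1 true) t; rewrite size_tuple c.
    have -> : count (predC (pred1 true)) t = count_mem false t.
      by apply: eq_count => -[].
    lia.
  by case: b; rewrite ?c ?cf /= ?mul0n ?mul1n ?addn0.
rewrite (symmetric_map_perm (fun b : bool => kappa (if b then nx j else nx (nx j))) Bs pt).
congr B; apply/ffunP => l; rewrite !ffunE; congr kappa.
rewrite (tnth_nth false) /= /standard_word !nth_cat !size_nseq.
case: ltnP => ll; rewrite !nth_nseq ?ll //.
by have -> : (l - (q - i) < i)%N by have := ltn_ord l; lia.
Qed.

(** As X_j u is a combination of kappa_(j+1) and kappa_(j+2), it suffices to compare both sides on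
    words in these two letters, which symmetry sorts into standard ones. *)
Lemma multilinear_expand (B : {ffun 'I_q -> M} -> A^o) j m :
  multilinear B -> symmetric_map B ->
  X j ^+ q * B m =
  \sum_(i < q.+1) (-1) ^+ i * B (kword (standard_word j i)) * theta_fun j i m.
Proof.
move=> Bl Bs.
pose B1 m : A^o := X j ^+ q * B m.
pose B2 m : A^o :=
  \sum_(i < q.+1) (-1) ^+ i * B (kword (standard_word j i)) * theta_fun j i m.
have B1l : multilinear B1.
  by move=> m' i a x y; rewrite /B1 Bl mulrDr; congr (_ + _); exact: mulrCA.
have B2l : multilinear B2.
  move=> m' i a x y; rewrite /B2 scaler_sumr -big_split; apply: eq_bigr => l _ /=.
  by rewrite theta_fun_multilinear mulrDr; congr (_ + _); exact: mulrCA.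
have B1s : symmetric_map B1 by move=> m' s; rewrite /B1 Bs.
have B2s : symmetric_map B2.
  by move=> m' s; apply: eq_bigr => l _; rewrite theta_fun_symmetric.
pose S : set M := fun u => exists b : bool, u = kappa (if b then nx j else nx (nx j)).
apply: (multilinear_agree (S := S) (x := X j) B1l B2l) => [c|u|m' hm].
- by rewrite -[X in X * c]expr1; exact: X_reg.
- exists (w u (nx j)), (- w u (nx (nx j))), (kappa (nx (nx j))), (kappa (nx j)).
  by split; [exists false|exists true|exact: X_scale].
have /choice[sg hsg] : forall l, exists b : bool,
    m' l = kappa (if b then nx j else nx (nx j)) by move=> l; exact: hm.
pose t : q.-tuple bool := [tuple sg l | l < q].
have [i iq hi] := standard_perm t j.
have -> : m' = [ffun l => kappa (if tnth t l then nx j else nx (nx j))].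
  by apply/ffunP => l; rewrite ffunE tnth_mktuple.
rewrite (hi B1 B1s) (hi B2 B2s) /B1 /B2 (bigD1 (inord i)) //= inordK ?ltnS //.
rewrite theta_standard_same // eqxx mulr1 big1 => [|l li]; last first.
  rewrite theta_standard_same //; case: eqP => [e|_]; last by rewrite !mulr0.
  by case/eqP: li; apply: val_inj; rewrite /= inordK ?ltnS // e.
have : (-1) ^+ i * (-1) ^+ i = 1 :> A by rewrite -expr2 sqrr_sign.
rewrite addr0; move: ((-1) ^+ i) (X j ^+ q) (B _) => s x b s1.
by rewrite -[LHS]mul1r -s1; ring.
Qed.

Variable theta : 'I_3 -> nat -> Sdual.
Hypothesis thetaE : forall j i m, val (theta j i) (sym_prod m) = theta_fun j i m.

Lemma dual_expand (phi : Sdual) j :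
  X j ^+ q *: phi = \sum_(i < q.+1)
    ((-1) ^+ i * val phi (sym_prod (kword (standard_word j i))) : A) *: theta j i.
Proof.
pose B m : A^o := val phi (sym_prod m).
have Bl : multilinear B.
  by move=> m i a x y; rewrite /B sym_prod_linear (dual_linear phi).
have Bs : symmetric_map B by move=> m s; rewrite /B sym_prod_perm.
apply: dual_ext => z; have [n [r [m ->]]] := sym_mod_span z.
rewrite val_dual_sum.
transitivity (X j ^+ q * val phi (\sum_(i < n) r i *: sym_prod (m i))); first by [].
rewrite dual_sum mulr_sumr; under [RHS]eq_bigr => i _ do rewrite dual_sum mulr_sumr.
rewrite exchange_big /=; apply: eq_bigr => l _.
rewrite mulrCA (multilinear_expand j (m l) Bl Bs) mulr_sumr; apply: eq_bigr => i _.
by rewrite thetaE mulrCA.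
Qed.

(** Since X_j is a nonzerodivisor, the q+1 values on [theta j] determine psi; the rank and the chart
    coordinates are read off from them. *)
Lemma ddual_expand (psi : Sddual) (phi : Sdual) j :
  X j ^+ q * val psi phi = \sum_(i < q.+1)
    (-1) ^+ i * val phi (sym_prod (kword (standard_word j i))) * val psi (theta j i).
Proof.
have <- : val psi (X j ^+ q *: phi) = X j ^+ q * val psi phi.
  have lin := dual_linear psi; have psi0 : val psi 0 = 0.
    by have := lin (-1) 0 0; rewrite scaler0 addr0 scaleN1r addrC subrr.
  by rewrite -[_ *: phi]addr0 lin psi0 addr0.
by rewrite dual_expand dual_sum.
Qed.

Lemma exists_eval (z : SM) : exists psi : Sddual, forall phi, val psi phi = val phi z.
Proof.
have [|psi hpsi] := @exists_dual A Sdual (fun phi => val phi z).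
  by move=> a phi1 phi2.
by exists psi => phi; rewrite hpsi.
Qed.

Definition eval (z : SM) : Sddual := projT1 (cid (exists_eval z)).

Lemma evalE z phi : val (eval z) phi = val phi z.
Proof. by rewrite /eval; case: cid. Qed.

Lemma eval_linear : linear eval.
Proof.
move=> a x y; apply: dual_ext => phi.
by rewrite evalE (dual_linear phi) -!evalE.
Qed.

Lemma theta_standard_val j i i' : (i <= q)%N ->
  val (theta j i') (sym_prod (kword (standard_word j i))) =
  (-1) ^+ i * X j ^+ q * (i' == i)%:R.
Proof. by move=> iq; rewrite thetaE theta_standard_same. Qed.

Lemma ddual_independent n (v : 'I_n -> Sddual) :
  (forall c : 'I_n -> A, \sum_i c i *: v i = 0 -> forall i, c i = 0) -> (n <= q.+1)%N.
Proof.
move=> ind; rewrite leqNgt; apply/negP => qn.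
have [c [[i ci] hc]] := linear_dependence dom
  (fun i (l : 'I_q.+1) => val (v i) (theta o0 l)) qn.
case/eqP: ci; apply: ind; apply: dual_ext => phi.
apply: (@X_reg q o0); rewrite ddual_expand big1 // => l _.
by rewrite val_dual_sum hc mulr0.
Qed.

Lemma rank_ddual : rank_mod (Sddual : lmodType A) = q.+1.
Proof.
apply: max_natE => [|m [v ind]]; last exact: ddual_independent ind.
(* These evaluations pair diagonally with [theta o0], with nonzero entries. *)
exists (fun i : 'I_q.+1 => eval (sym_prod (kword (standard_word o0 i)))) => c h0 i.
have := congr1 (fun psi : Sddual => val psi (theta o0 i)) h0.
rewrite val_dual_sum (bigD1 i) //= evalE theta_standard_val ?leq_ord // eqxx mulr1.
rewrite big1 => [|l li]; last first.
  rewrite evalE theta_standard_val ?leq_ord // (_ : (_ == _) = false) ?mulr0 //.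
  by apply/eqP => e; case/eqP: li; apply: val_inj.
rewrite addr0 => h; apply: (@X_reg q o0); move: h.
have : (-1) ^+ i * (-1) ^+ i = 1 :> A by rewrite -expr2 sqrr_sign.
move: ((-1) ^+ i) (X o0 ^+ q) (c i) => s x b s1 h.
transitivity (s * (b * (s * x))); last by rewrite h mulr0.
by rewrite -[LHS]mul1r -s1; ring.
Qed.

Lemma gfree_quotient_le n : has_gfree_quotient (reflexive_sym M q) n -> (n <= q.+1)%N.
Proof.
case=> a [p [s [_ _ sK]]].
apply: (@ddual_independent n (fun i => s (delta_mx 0 i))) => c h i.
have e : \sum_i c i *: s (delta_mx 0 i) = s (\row_i c i).
  rewrite (row_sum_delta (\row_i c i)) linear_sum; apply: eq_bigr => l _.
  by rewrite linearZ_LR mxE.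
have := congr1 p (etrans (esym e) h); rewrite sK linear0 => /matrixP/(_ 0 i).
by rewrite !mxE.
Qed.

Lemma wpoly_deg e (u : M) j : gdeg e u ->
  forall i, rdeg (e + a1) (wpoly j u)`_i.
Proof.
move=> ue [|[|i]]; rewrite /wpoly coefD coefC coefZ coefX /=
  ?(mulr0, mulr1, addr0, add0r) //; exact: w_deg.
Qed.

Lemma theta_deg j i : gdeg ((q%:Z * a1) : int) (theta j i : gdual (gsym q M)).
Proof.
move=> e z [n [r [m [-> hm]]]] /=; rewrite dual_sum; apply: rdeg_sum => l.
have [e' [b [re hb ->]]] := hm l.
have -> : q%:Z * a1 + (e' + \sum_(j < q) b j) = e' + \sum_(j < q) (b j + a1).
  by rewrite big_split /= sumr_const card_ord -mulr_natl natz addrCA [_ + q%:Z * _]addrC.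
apply: rdegM => //; rewrite thetaE /theta_fun.
elim/big_rec2: _ i => [[|i]|l' d pol _ IH i]; rewrite ?coef1 /= ?mulr1n //.
rewrite coefM; apply: rdeg_sum => l2; apply: rdegM; last exact: IH.
exact: wpoly_deg.
Qed.

Lemma eval_deg e z : gdeg e (z : gsym q M) ->
  gdeg e (eval z : reflexive_sym M q).
Proof. by move=> ze e' phi phie; rewrite evalE addrC; exact: phie. Qed.

Lemma kword_deg s : gdeg ((q%:Z * (1 - a1)) : int) (sym_prod (kword s) : gsym q M).
Proof.
exists 1%N, (fun=> 1), (fun=> kword s); split; first by rewrite big_ord1 scale1r.
move=> _; exists 0, (fun=> 1 - a1); split=> [//|l|].
  by rewrite ffunE; exact: kappa_deg.
by rewrite sumr_const card_ord -mulr_natl natz add0r.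
Qed.

Lemma kword_orth s1 s2 : (size s1 + size s2).+1 = q ->
  \sum_a X a *: sym_prod (kword (s1 ++ a :: s2)) = 0.
Proof.
move=> sq; have lq : (size s1 < q)%N by rewrite -sq ltnS leq_addr.
pose l := Ordinal lq.
have kE a : kword (s1 ++ a :: s2) = upd (kword (s1 ++ o0 :: s2)) l (kappa a).
  apply/ffunP => l'; rewrite !ffunE !nth_cat; case: eqP => [->|/eqP ll].
    by rewrite /= ltnn subnn.
  have {}ll : nat_of_ord l' != size s1 by apply: contraNneq ll => e; apply/eqP/val_inj.
  case: ltnP => // sl; case e : (l' - size s1)%N => [|x] //.
  by case/eqP: ll; apply/eqP; rewrite eqn_leq sl andbT -subn_eq0 e.
under eq_bigr => a _ do rewrite kE.
pose m := kword (s1 ++ o0 :: s2); rewrite -/m.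
pose B (u : M) := sym_prod (upd m l u).
have Blin a u v : B (a *: u + v) = a *: B u + B v by exact: sym_prod_linear.
have B0 : B 0 = 0.
  by have := Blin (-1) 0 0; rewrite scaler0 addr0 scaleN1r addrC subrr.
have BZ a u : B (a *: u) = a *: B u by rewrite -[a *: u]addr0 Blin B0 addr0.
have BD u v : B (u + v) = B u + B v by rewrite -[u]scale1r Blin !scale1r.
transitivity (B (\sum_a X a *: kappa a)); last by rewrite X_kappa.
by rewrite !sum3 !BD !BZ.
Qed.

(* A graded free summand of S^q of positive rank yields a form Phi on Sym^q M and
   a section P of S^q, given in the three charts x_j <> 0, that pair to 1. *)
Lemma gfree_quotient_data n : has_gfree_quotient (reflexive_sym M q) n -> (0 < n)%N ->
  exists (dPhi dP : int) (Phi : seq 'I_3 -> A) (P : 'I_3 -> nat -> A),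
  [/\ dPhi + dP = q%:Z /\ (forall s, rdeg dPhi (Phi s)),
      forall s1 s2, (size s1 + size s2).+1 = q ->
        \sum_a X a * Phi (s1 ++ a :: s2) = 0,
      forall j i, rdeg dP (P j i),
      forall j j' i', X j ^+ q * P j' i' = \sum_(i < q.+1) (-1) ^+ i * P j i *
    (((cross (unitv A (nx (nx j))) X (nx j'))%:P +
     cross (unitv A (nx (nx j))) X (nx (nx j')) *: 'X) ^+ (q - i) *
   ((cross (unitv A (nx j)) X (nx j'))%:P +
     cross (unitv A (nx j)) X (nx (nx j')) *: 'X) ^+ i)`_i'
    & forall j, X j ^+ q = \sum_(i < q.+1) (-1) ^+ i * P j i * Phi (standard_word j i)].
Proof.
case: n => [//|n] [a [p [s [ph sh sK]]]] _.
pose s0 : reflexive_sym M q := s (delta_mx 0 ord0).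
pose Phi sq : A := (p (eval (sym_prod (kword sq))) : 'rV[A]_n.+1) 0 ord0.
pose P j i : A := val (s0 : Sddual) (theta j i).
have s0deg : gdeg (- a ord0) s0.
  apply: sh => i /=; rewrite mxE eqxx /=; case: eqP => [->|_] /=.
    by rewrite addrN.
  exact: rdeg0.
(* The generator of A(a) has degree -a; the shifts a and a1 cancel in the sum of the two degrees,
   which is q. *)
exists (a ord0 + q%:Z * (1 - a1)), (- a ord0 + q%:Z * a1), Phi, P; split.
- split; first by ring.
  by move=> sq; apply: (ph _ _ (eval_deg (kword_deg sq)) ord0).
- move=> s1 s2 sq; have := kword_orth sq.
  move/(congr1 (fun z => (p (eval z) : 'rV[A]_n.+1) 0 ord0)).
  have e0 : eval 0 = 0.
    by have := eval_linear (-1) 0 0; rewrite scaler0 addr0 scaleN1r addrC subrr.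
  have eD u v : eval (u + v) = eval u + eval v by rewrite -[u]scale1r eval_linear !scale1r.
  have eZ c u : eval (c *: u) = c *: eval u.
    by rewrite -[c *: u]addr0 eval_linear e0 addr0.
  rewrite !sum3 !eD !eZ e0 linear0 !linearD !linearZ_LR !mxE => <-.
  by [].
- by move=> j i; exact: (s0deg _ _ (theta_deg j i)).
- move=> j j' i'; rewrite /P ddual_expand; apply: eq_bigr => i _.
  by rewrite thetaE theta_standard ?leq_ord // -!mulrA; congr (_ * _); exact: mulrC.
move=> j.
(* The first coordinate of the image under p is X_j^q on the left and the pairing of P with Phi on
   the right. *)
have e : X j ^+ q *: s0 = \sum_(i < q.+1) ((-1) ^+ i * P j i : A) *:
    (eval (sym_prod (kword (standard_word j i))) : reflexive_sym M q).
  apply: dual_ext => phi; rewrite val_dual_sum.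
  apply: etrans (ddual_expand _ _ j) _; apply: eq_bigr => i _.
  by rewrite evalE /P mulrAC.
have := congr1 (fun z => (p z : 'rV[A]_n.+1) 0 ord0) e.
rewrite linearZ_LR sK linear_sum !mxE summxE eqxx mulr1 => ->.
by apply: eq_bigr => i _; rewrite linearZ_LR mxE.
Qed.

Lemma gfrk_le : (gfrk (reflexive_sym M q) <= q.+1)%N.
Proof.
rewrite /gfrk; case: (max_natP (has_gfree_quotient (reflexive_sym M q))) => [->//|].
exact: gfree_quotient_le.
Qed.

End SymDual.

(** * The coordinate ring and the resolution of the residue field *)

Section CoordRing.

Variables (k : closedFieldType) (f : {mpoly k[3]}) (hf : f \is 3.-homog).

Local Notation A := (coord_ring (DHomog hf)).
Local Notation I := (cubic_idealr (DHomog hf)).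

Definition cpi (p : {mpoly k[3]}) : A := \pi_({ideal_quot I})%qT p.

Lemma cpiP p q : cpi p = cpi q <-> exists g, p - q = g * f.
Proof.
split=> [/eqP|[g e]].
  by rewrite -[_ == _]Quotient.idealrBE => /asboolP.
by apply/eqP; rewrite -[_ == _]Quotient.idealrBE; apply/asboolP; exists g.
Qed.

Lemma cpi_surj (r : A) : exists p, r = cpi p.
Proof. by exists (repr (r : {ideal_quot I})); rewrite /cpi reprK. Qed.

Lemma cpiB : zmod_morphism cpi.
Proof. by move=> p q; exact: (rmorphB (\pi_({ideal_quot I})%qT)). Qed.

Lemma cpi_monoid : monoid_morphism cpi.
Proof.
split=> [|p q]; first exact: (rmorph1 (\pi_({ideal_quot I})%qT)).
exact: (rmorphM (\pi_({ideal_quot I})%qT)).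
Qed.

HB.instance Definition _ := GRing.isZmodMorphism.Build {mpoly k[3]} A cpi cpiB.
HB.instance Definition _ := GRing.isMonoidMorphism.Build {mpoly k[3]} A cpi cpi_monoid.

Section Lift.

Variables (C : comNzRingType) (psi : {rmorphism {mpoly k[3]} -> C}).
Hypothesis psif : psi f = 0.

Definition clift (r : A) : C := psi (repr (r : {ideal_quot I})).

Lemma cliftE p : clift (cpi p) = psi p.
Proof.
have /cpiP[g e] : cpi (repr (cpi p : {ideal_quot I})) = cpi p by rewrite /cpi reprK.
apply/eqP; rewrite -subr_eq0 -rmorphB; apply/eqP.
by rewrite e rmorphM /= psif mulr0.
Qed.

Lemma cliftB : zmod_morphism clift.
Proof.
move=> r s; have [p ->] := cpi_surj r; have [q ->] := cpi_surj s.
by rewrite -rmorphB !cliftE rmorphB.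
Qed.

Lemma clift_monoid : monoid_morphism clift.
Proof.
split=> [|r s]; first by rewrite -(rmorph1 cpi) cliftE rmorph1.
have [p ->] := cpi_surj r; have [q ->] := cpi_surj s.
by rewrite -rmorphM !cliftE rmorphM.
Qed.

End Lift.

Lemma exists_clift (C : comNzRingType) (psi : {rmorphism {mpoly k[3]} -> C}) :
  psi f = 0 -> exists h : {rmorphism A -> C}, forall p, h (cpi p) = psi p.
Proof.
move=> psif.
pose h : {rmorphism A -> C} := HB.pack (clift psi)
  (GRing.isZmodMorphism.Build A C (clift psi) (cliftB psif))
  (GRing.isMonoidMorphism.Build A C (clift psi) (clift_monoid psif)).
by exists h => p; exact: cliftE.
Qed.

Lemma rdeg_coord0 d : rdeg d (0 : A).
Proof.
by case: d => [n|n] //=; exists 0; rewrite ?rpred0 //; apply/esym; exact: (rmorph0 cpi).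
Qed.

Lemma rdeg_coordD d (a b : A) : rdeg d a -> rdeg d b -> rdeg d (a + b).
Proof.
case: d => [n|n] /=; last by move=> -> ->; rewrite addr0.
move=> [p hp ->] [q hq ->]; exists (p + q); first exact: rpredD.
exact/esym/(rmorphD cpi).
Qed.

Lemma rdeg_coordM d e (a b : A) : rdeg d a -> rdeg e b -> rdeg (d + e) (a * b).
Proof.
case: d => [m|m]; last by move=> /= ->; rewrite mul0r => _; exact: rdeg_coord0.
case: e => [n|n]; last by move=> _ /= ->; rewrite mulr0; exact: rdeg_coord0.
move=> [p hp ->] [q hq ->]; exists (p * q); first exact: dhomogM.
exact/esym/(rmorphM cpi).
Qed.

Lemma rdeg_coord1 : rdeg 0 (1 : A).
Proof. by exists 1; [exact: dhomog1|apply/esym; exact: (rmorph1 cpi)]. Qed.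

End CoordRing.

Section CoordDomain.

Variables (k : closedFieldType) (f : {mpoly k[3]}) (hf : f \is 3.-homog).
Variables (L : fieldType) (phi : {rmorphism k -> L}) (t : 'I_3 -> L).
Hypothesis gp : generic_point phi t f.

Local Notation A := (coord_ring (DHomog hf)).
Local Notation pi := (cpi hf).

(** Evaluation on the cone over t. The variable records the degree, because evaluation at t alone
    separates classes only within one degree. *)
Definition cone_map (p : {mpoly k[3]}) : {poly L} :=
  mmap (polyC \o phi) (fun i => 'X * (t i)%:P) p.

Lemma cone_map_homog d p : p \is d.-homog ->
  cone_map p = 'X^d * (mmap phi t p)%:P.
Proof.
move=> hp; rewrite /cone_map (mmap_scale_homog _ _ _ hp); congr (_ * _).
by rewrite (rmorph_mmap phi polyC).
Qed.

Lemma cone_map_eq0 p : cone_map p = 0 -> pi p = 0.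
Proof.
case: gp => _ gen _ p0.
have pE : p = \sum_(d < msize p) pihomog mdeg d p by exact: pihomog_partitionE.
have c0 d : (d < msize p)%N -> mmap phi t (pihomog mdeg d p) = 0.
  move=> dp; have := congr1 (fun g : {poly L} => g`_d) p0.
  rewrite coef0 {1}pE /cone_map rmorph_sum coef_sum (bigD1 (Ordinal dp)) //=.
  rewrite -/(cone_map _) (cone_map_homog (pihomogP _ _ _)) coefXnM ltnn subnn coefC /=.
  rewrite big1 ?addr0 // => i /negPf id.
  rewrite -/(cone_map _) (cone_map_homog (pihomogP _ _ _)) coefXnM.
  case: ltnP => // id'; rewrite coefC; case: eqP => // /eqP.
  by rewrite subn_eq0 => di; move: id; rewrite -val_eqE /= eqn_leq di id'.
rewrite pE rmorph_sum big1 // => d _ /=.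
have [q ->] := gen _ _ (pihomogP mdeg d p) (c0 d (ltn_ord d)).
rewrite -(rmorph0 pi); apply/cpiP; exists q; by rewrite subr0.
Qed.

Lemma cone_map_f : cone_map f = 0.
Proof. by case: gp => ft _ _; rewrite (cone_map_homog hf) ft mulr0. Qed.

Lemma exists_cone : exists h : {rmorphism A -> {poly L}},
  (forall p, h (pi p) = cone_map p) /\ injective h.
Proof.
have [h hE] := exists_clift hf (psi := mmap (polyC \o phi) (fun i => 'X * (t i)%:P)) cone_map_f.
exists h; split=> // r s; have [p ->] := cpi_surj r; have [q ->] := cpi_surj s.
move=> /eqP; rewrite -subr_eq0 -rmorphB -rmorphB hE => /eqP /cone_map_eq0.
by rewrite rmorphB => /eqP; rewrite subr_eq0 => /eqP.
Qed.

Lemma coord_ring_domain (a b : A) : a * b = 0 -> a = 0 \/ b = 0.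
Proof.
have [h [_ hinj]] := exists_cone => ab.
have /eqP : h a * h b = 0 by rewrite -rmorphM ab rmorph0.
by rewrite mulf_eq0 => /orP[] /eqP h0; [left|right]; apply: hinj; rewrite h0 rmorph0.
Qed.

End CoordDomain.

Section CoordConstants.

Variables (k : closedFieldType) (f : {mpoly k[3]}) (hf : f \is 3.-homog).

Local Notation A := (coord_ring (DHomog hf)).
Local Notation pi := (cpi hf).

Lemma mmap0_homog (C : comNzRingType) (psi : {rmorphism k -> C}) d
    (p : {mpoly k[3]}) :
  (0 < d)%N -> p \is d.-homog -> mmap psi (fun=> 0) p = 0.
Proof.
move=> d0 hp; rewrite -(@eq_mmap _ _ _ psi (fun i => 0 * (fun=> 0) i)) => [|i].
  by rewrite (mmap_scale_homog _ _ _ hp) expr0n gtn_eqF // mul0r.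
by rewrite mul0r.
Qed.

Lemma exists_residue : exists eps : {rmorphism A -> k},
  forall p, eps (pi p) = mmap idfun (fun=> 0) p.
Proof. exact: exists_clift (mmap0_homog _ (isT : 0 < 3)%N hf). Qed.

Lemma mpoly_decomp (p : {mpoly k[3]}) : exists c : 'I_3 -> {mpoly k[3]},
  p = (mmap idfun (fun=> 0) p)%:MP + \sum_i c i * 'X_i.
Proof.
pose P (p : {mpoly k[3]}) := exists c : 'I_3 -> {mpoly k[3]},
  p = (mmap idfun (fun=> 0) p)%:MP + \sum_i c i * 'X_i.
have PD a b : P a -> P b -> P (a + b).
  move=> [c ac] [d bd]; exists (fun i => c i + d i).
  rewrite mmapD mpolyCD {1}ac {1}bd addrACA -big_split; congr (_ + _).
  by apply: eq_bigr => i _; rewrite mulrDl.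
have PZ a b : P b -> P (a *: b).
  move=> [c bc]; exists (fun i => a *: c i).
  rewrite mmapZ mpolyCM mul_mpolyC {1}bc scalerDr scaler_sumr; congr (_ + _).
  by apply: eq_bigr => i _; rewrite scalerAl.
suff PX m : P 'X_[m].
  suff : P p by [].
  rewrite (mpolyE p); apply: (@big_ind _ P) => // [|m _]; last exact/PZ/PX.
  by exists (fun=> 0); rewrite raddf0 mpolyC0 add0r big1 // => i _; rewrite mul0r.
case e : (mdeg m) => [|d].
  move/eqP: e; rewrite mdeg_eq0 => /eqP->; exists (fun=> 0).
  rewrite mpolyX0 rmorph1 mpolyC1 big1 ?addr0 // => i _; exact: mul0r.
case/mdegS_U: e => i [m' [-> _]]; exists (fun j => if j == i then 'X_[m'] else 0).
rewrite mpolyXD rmorphM /= mmapX mmap1U mul0r mpolyC0 add0r.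
rewrite (bigD1 i) //= eqxx mulrC big1 ?addr0 // => j /negPf ->.
by rewrite mul0r.
Qed.

End CoordConstants.

(** * The first steps of a minimal resolution of k *)

Section Resolution.

Variables (k : closedFieldType) (f : {mpoly k[3]}) (hf : f \is 3.-homog).
Variables (L : fieldType) (phi : {rmorphism k -> L}) (t : 'I_3 -> L).
Hypothesis gp : generic_point phi t f.
Hypothesis f_neq0 : f != 0.

Local Notation A := (coord_ring (DHomog hf)).
Local Notation pi := (cpi hf).
Local Notation x i := (pi 'X_i).
Local Notation kc c := (pi c%:MP).

Variable eps : {rmorphism A -> k}.
Hypothesis epsE : forall p, eps (pi p) = mmap idfun (fun=> 0) p.

Lemma epsC c : eps (kc c) = c.
Proof. by rewrite epsE mmapC. Qed.

Lemma rdegC c : rdeg 0 (kc c : A).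
Proof. by exists c%:MP; rewrite // -[c%:MP]mulr1 mul_mpolyC rpredZ ?dhomog1. Qed.

Lemma rdegx i : rdeg 1 (x i : A).
Proof. by exists 'X_i => //; rewrite dhomogX; apply/eqP; exact: mdeg1. Qed.

Lemma eps_decomp (r : A) : exists c : 'I_3 -> A, r = kc (eps r) + \sum_i c i * x i.
Proof.
have [p ->] := cpi_surj r; have [c pE] := mpoly_decomp p.
exists (fun i => pi (c i)); rewrite epsE; have := congr1 pi pE.
rewrite (rmorphD pi) => ->; congr (_ + _); rewrite (rmorph_sum pi).
by apply: eq_bigr => i _; rewrite /= rmorphM.
Qed.

Lemma eps_positive (r : A^o) : r \in lin_span (@positive_part A) -> eps r = 0.
Proof.
move=> /asboolP[n [c [g [hg ->]]]]; rewrite rmorph_sum big1 // => i _.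
rewrite [c i *: g i]/(c i * g i) rmorphM; suff -> : eps (g i) = 0 by rewrite mulr0.
have [[d|//] d0 [p hp ->]] := hg i.
by rewrite epsE (mmap0_homog _ _ hp).
Qed.

Lemma positive_eps (r : A^o) : eps r = 0 -> r \in lin_span (@positive_part A).
Proof.
move=> r0; have [c ->] := eps_decomp r; rewrite r0 mpolyC0 rmorph0 add0r.
apply: rpred_sum => i _; apply: (@rpredZ A A^o); apply: lin_span_mem.
by exists 1 => //; exact: rdegx.
Qed.

Lemma rdeg0_eps r : rdeg 0 (r : A) -> r = kc (eps r).
Proof.
move=> [p hp ->]; rewrite epsE; congr (pi _).
move: p hp; apply: (@dhomog_ind_monomial 3 k 0 (fun p => p = (mmap idfun (fun=> 0) p)%:MP)).
- by rewrite raddf0 mpolyC0.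
- by move=> p q hp hq; rewrite mmapD mpolyCD -hp -hq.
- by move=> c p hp; rewrite mmapZ mpolyCM mul_mpolyC -hp.
by move=> m /eqP; rewrite mdeg_eq0 => /eqP->; rewrite mpolyX0 rmorph1 mpolyC1.
Qed.

Lemma linear_form p : p \is 1.-homog -> exists c : 'I_3 -> k, p = \sum_i c i *: 'X_i.
Proof.
move: p; apply: (@dhomog_ind_monomial 3 k 1
  (fun p => exists c : 'I_3 -> k, p = \sum_i c i *: 'X_i)).
- by exists (fun=> 0); rewrite big1 // => i _; rewrite scale0r.
- move=> _ _ [c ->] [d ->]; exists (fun i => c i + d i); rewrite -big_split.
  by apply: eq_bigr => i _; rewrite scalerDl.
- move=> a _ [c ->]; exists (fun i => a * c i); rewrite scaler_sumr.
  by apply: eq_bigr => i _; rewrite scalerA.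
move=> m /mdegS_U[i [m' [-> /eqP]]]; rewrite mdeg_eq0 => /eqP->; rewrite addm0.
exists (fun j => (j == i)%:R); rewrite (bigD1 i) //= eqxx scale1r big1 ?addr0 // => j /negPf ->.
by rewrite scale0r.
Qed.

(** A nonzero multiple of f has degree at least 3, so no nonzero linear form becomes 0 in R. *)
Lemma x_indep (b : 'I_3 -> k) : \sum_i kc (b i) * x i = 0 -> forall i, b i = 0.
Proof.
have -> : \sum_i kc (b i) * x i = pi (\sum_i b i *: 'X_i).
  by rewrite rmorph_sum; apply: eq_bigr => i _; rewrite -mul_mpolyC rmorphM.
set l : {mpoly k[3]} := \sum_i b i *: 'X_i; rewrite -(rmorph0 pi) => /cpiP[g]; rewrite subr0 => lE.
suff l0 : l = 0.
  move=> i; have := congr1 (mcoeff U_(i)) l0; rewrite mcoeff0 /l raddf_sum /=.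
  rewrite (bigD1 i) //= mcoeffZ mcoeffX eqxx mulr1 big1 ?addr0 // => j /negPf ji.
  by rewrite mcoeffZ mcoeffX eq_mnm1 ji mulr0.
apply/eqP; apply: contraT => l_neq0.
have g_neq0 : g != 0 by apply: contraNneq l_neq0 => g0; rewrite lE g0 mul0r.
have msz d (p : {mpoly k[3]}) : p != 0 -> p \is d.-homog -> msize p = d.+1.
  move=> p0 hp; rewrite (dhomog_uniq p0 hp (dhomog_msize hp)) prednK //.
  by rewrite lt0n msize_poly_eq0.
have hl : l \is 1.-homog.
  apply: rpred_sum => i _; apply: rpredZ.
  by rewrite dhomogX; apply/eqP; exact: mdeg1.
have := msz _ _ l_neq0 hl; rewrite lE msizeM // (msz _ _ f_neq0 hf).
have : (0 < msize g)%N by rewrite lt0n msize_poly_eq0.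
by move: (msize g) => s; lia.
Qed.

Variable F : minResolution (gresidue A).

Local Notation m0 := (betti F 0%N).
Local Notation m1 := (betti F 1%N).
Local Notation proj := (quot_proj (@positive_part A)).

Lemma proj_eq0 (r : A) : proj (r : A^o) = 0 <-> eps r = 0.
Proof.
have p0 : proj 0 = 0.
  have := @quot_proj_linear A A^o (@positive_part A) (-1) 0 0.
  by rewrite scaler0 addr0 scaleN1r addrC subrr.
split=> [e|e].
  by apply: eps_positive; rewrite -[r]subr0; apply/quot_projP; rewrite p0.
by rewrite -p0; apply/quot_projP; rewrite subr0; exact: positive_eps.
Qed.

Lemma residue_scale (c : A) (z : gresidue A) : eps c = 0 -> c *: z = 0.
Proof.
move=> c0; rewrite -[z]quot_projK -[LHS]/(quot_scale _ _) -quot_projZ.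
by apply/proj_eq0; rewrite rmorphM c0 mul0r.
Qed.

Lemma augm_eq0 (v : 'rV[A]_m0) : augm F v = 0 -> forall j, eps (v 0 j) = 0.
Proof.
by move=> /augm_exact[w <-] j; apply: eps_positive; exact: bdry_minimal.
Qed.

Lemma augm_sum (v : 'rV[A]_m0) : augm F v = \sum_j v 0 j *: augm F (delta_mx 0 j).
Proof.
rewrite [in LHS](row_sum_delta v) linear_sum; apply: eq_bigr => j _.
exact: linearZ_LR.
Qed.

Lemma augm_eps0 (v : 'rV[A]_m0) : (forall j, eps (v 0 j) = 0) -> augm F v = 0.
Proof.
by move=> v0; rewrite augm_sum big1 // => j _; exact: residue_scale.
Qed.

(** Each generator maps to the class of a scalar, so two of them satisfy a relation with scalar
    coefficients. Minimality makes these 0; then a generator lies in the kernel, against minimality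
    again. *)
Lemma resolution_generator : exists i0 : 'I_m0, forall j, j = i0.
Proof.
have eps_neq : eps 1 <> 0 by rewrite rmorph1; apply/eqP; exact: oner_neq0.
have [i0 _|none] := pickP (@predT 'I_m0); last first.
  case: eps_neq; apply/proj_eq0; have [v <-] := augm_surj F (proj (1 : A^o)).
  by rewrite augm_sum big1 // => j _; have := none j.
exists i0 => j; apply/eqP; apply: contraT => ji.
have cE i : exists c, augm F (delta_mx 0 i) = proj (kc c : A^o).
  have [p e] : exists p : A, augm F (delta_mx 0 i) = proj (p : A^o).
    pose Q := Quotient.quot (GRing.ZmodClosed.clone _ (lin_span (@positive_part A)) _).
    by exists (repr (augm F (delta_mx 0 i) : Q)); rewrite quot_projK.
  exists (eps p); rewrite e; apply/quot_projP; apply: positive_eps.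
  by rewrite rmorphB epsC subrr.
have [c ci] := cE i0; have [d dj] := cE j.
pose v : 'rV[A]_m0 := kc d *: delta_mx 0 i0 - kc c *: delta_mx 0 j.
have v0 : augm F v = 0.
  have E a b : kc a *: (proj (kc b : A^o) : gresidue A) = proj (kc (a * b) : A^o).
    by rewrite -[LHS]/(quot_scale _ _) -quot_projZ mpolyCM rmorphM.
  by rewrite /v linearB !(linearZ_LR (augm F)) ci dj !E [d * c]mulrC; exact: subrr.
have := augm_eq0 v0 i0; have := augm_eq0 v0 j.
rewrite /v !mxE !eqxx (negPf ji) eq_sym (negPf ji) !mulr1 !mulr0 sub0r subr0 rmorphN.
rewrite !epsC => /eqP; rewrite oppr_eq0 => /eqP c0 d0.
have a0 : augm F (delta_mx 0 i0) = 0 by rewrite ci; apply/proj_eq0; rewrite epsC.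
by case: eps_neq; have := augm_eq0 a0 i0; rewrite mxE !eqxx.
Qed.

Section Syzygies.

Variable i0 : 'I_m0.
Hypothesis i0_uniq : forall j : 'I_m0, j = i0.

(** The entries of F_1 -> F_0, where F_0 has rank 1: minimal generators of the ideal R_+. [delta j]
    is the degree of [C j]. *)
Let C (j : 'I_m1) : A := (bdry F 0%N (delta_mx 0 j) : 'rV[A]_m0) 0 i0.
Let a0 : int := @Defs.shift _ _ F 0%N i0.
Let delta (j : 'I_m1) : int := a0 - @Defs.shift _ _ F 1%N j.

Lemma bdry_val (v : 'rV[A]_m1) :
  (bdry F 0%N v : 'rV[A]_m0) 0 i0 = \sum_j v 0 j * C j.
Proof.
rewrite [in LHS](row_sum_delta v) linear_sum summxE; apply: eq_bigr => j _.
by rewrite linearZ_LR mxE.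
Qed.

Lemma bdry_eq0 (v : 'rV[A]_m1) : bdry F 0%N v = 0 <-> \sum_j v 0 j * C j = 0.
Proof.
rewrite -bdry_val; split=> [->|e]; first by rewrite mxE.
apply/rowP => j; rewrite (i0_uniq j) e mxE; by [].
Qed.

Lemma syz_minimal (v : 'I_m1 -> A) : \sum_j v j * C j = 0 -> forall j, eps (v j) = 0.
Proof.
move=> e; have : bdry F 0%N (\row_j v j) = 0.
  by apply/bdry_eq0; rewrite -[RHS]e; apply: eq_bigr => j _; rewrite mxE.
move=> /bdry_exact[w we] j.
have := eps_positive (bdry_minimal (m := F) w j).
by rewrite we mxE.
Qed.

Lemma C_deg j : rdeg (delta j) (C j).
Proof.
have := @bdry_homog _ _ F 0%N (- @Defs.shift _ _ F 1%N j) (delta_mx 0 j) _ i0; apply.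
move=> i /=; rewrite mxE eqxx /=; case: eqP => [->|_] /=.
  by rewrite addrN; exact: rdeg_coord1.
exact: rdeg_coord0.
Qed.

Lemma eps_C j : eps (C j) = 0.
Proof. by apply: eps_positive; exact: bdry_minimal. Qed.

Lemma C_generate r : eps r = 0 -> exists v : 'I_m1 -> A, r = \sum_j v j * C j.
Proof.
move=> r0; have : augm F (\row_j r) = 0.
  by apply: augm_eps0 => j; rewrite mxE.
move/augm_exact => [w we]; exists (fun j => w 0 j).
by rewrite -bdry_val we mxE.
Qed.

Lemma C_neq0 j : C j != 0.
Proof.
apply/eqP => c0; have := @syz_minimal (fun l => (l == j)%:R) _ j.
rewrite eqxx rmorph1 => h; suff : (1 : k) = 0 by move/eqP; rewrite oner_eq0.
apply: h; rewrite (bigD1 j) //= c0 mulr0 add0r big1 // => l /negPf ->.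
by rewrite mul0r.
Qed.

Lemma delta_gt0 j : 0 < delta j.
Proof.
have := C_deg j; have := C_neq0 j; case e : (delta j) => [[|d]|d] //; last first.
  by move=> c0 /= cz; rewrite cz eqxx in c0.
by move=> /negP c0 /rdeg0_eps; rewrite eps_C mpolyC0 rmorph0 => /eqP.
Qed.

Variable h : {rmorphism A -> {poly L}}.
Hypothesis hE : forall p, h (pi p) = cone_map phi t p.
Hypothesis h_inj : injective h.

Lemma cone_coef0 r : (h r)`_0 = phi (eps r).
Proof.
have [p ->] := cpi_surj r; rewrite hE epsE rmorph_mmap -horner_coef0.
rewrite -[_.[0]]/(horner_eval 0 _) rmorph_mmap /mmap; apply: eq_bigr => m _.
congr (_ * _); first by rewrite /= /horner_eval hornerC.
apply: eq_bigr => i _; congr (_ ^+ _).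
by rewrite /= /horner_eval hornerM hornerX mul0r rmorph0.
Qed.

Lemma cone_C j : exists (d : nat) (g : L),
  delta j = d.+1%:Z /\ h (C j) = 'X^(d.+1) * g%:P.
Proof.
have := delta_gt0 j; have := C_deg j; case: (delta j) => [[|d]|d] // [p hp ->] _.
by exists d, (mmap phi t p); rewrite hE (cone_map_homog phi t hp).
Qed.

(** In an expression of x_i by the C_j only the part of degree 1 matters, where C_j has degree 1 and
    its coefficient is a constant. The parts are compared as coefficients in L[X]. *)
Lemma coords_of_x : exists c : 'I_3 -> 'I_m1 -> k,
  (forall i, x i = \sum_j kc (c i j) * C j) /\
  (forall i j, delta j != 1 -> c i j = 0).
Proof.
have eps_x i : eps (x i) = 0 by rewrite epsE mmapXU.
have /choice[v vE] : forall i, exists v : 'I_m1 -> A, x i = \sum_j v j * C j.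
  by move=> i; exact: C_generate.
exists (fun i j => if delta j == 1 then eps (v i j) else 0).
split=> [i|i j /negPf -> //]; apply: h_inj.
have hkc c : h (kc c) = (phi c)%:P by rewrite hE /cone_map mmapC.
have coef_hC j l : (h (C j))`_l = if delta j == l%:Z then (h (C j))`_l else 0.
  have [d [g [-> ->]]] := cone_C j; case: eqP => // dl.
  rewrite coefMC coefXn; case: eqP => [e|]; last by rewrite mul0r.
  by case: dl; rewrite e.
rewrite rmorph_sum; apply/polyP => l; rewrite coef_sum.
under eq_bigr => j _ do rewrite rmorphM /= hkc coefCM coef_hC.
have [->|l1] := eqVneq l 1%N; last first.
  rewrite big1 => [|j _].
    have dX : ('X_i : {mpoly k[3]}) \is 1.-homog by rewrite dhomogX; apply/eqP; exact: mdeg1.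
    by rewrite hE (cone_map_homog phi t dX) coefMC coefXn (negPf l1) mul0r.
  case: eqP => [d1|_]; last by rewrite rmorph0 mul0r.
  by rewrite d1; case: eqP => [[e]|_]; [rewrite -e eqxx in l1|rewrite mulr0].
rewrite [in LHS]vE rmorph_sum coef_sum; apply: eq_bigr => j _.
rewrite rmorphM /=; have [d [g [de ->]]] := cone_C j; rewrite de.
rewrite mulrA !coefMC coefMXn coefXn; case: d {de} => [|d] /=.
  by rewrite cone_coef0 mul1r.
by rewrite rmorph0 !mul0r.
Qed.

(** C_j is a combination of the x_i, hence of the C_l of degree 1. If its own degree were different,
    this would be a relation with coefficient 1 at j, against minimality. *)
Lemma delta_eq1 j : delta j = 1.
Proof.
have [c [xE c0]] := coords_of_x; apply/eqP; apply: contraT => dj.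
have [r rE] := eps_decomp (C j); rewrite eps_C mpolyC0 rmorph0 add0r in rE.
pose v l : A := (l == j)%:R - \sum_i r i * kc (c i l).
have : \sum_l v l * C l = 0.
  under eq_bigr => l _ do rewrite mulrBl.
  rewrite sumrB (bigD1 j) //= eqxx mul1r big1 ?addr0 => [|l /negPf ->]; last exact: mul0r.
  rewrite {1}rE; apply/eqP; rewrite subr_eq0; apply/eqP.
  under [RHS]eq_bigr => l _ do rewrite mulr_suml.
  rewrite exchange_big /=; apply: eq_bigr => i _; rewrite xE mulr_sumr.
  by apply: eq_bigr => l _; rewrite mulrA.
move=> /syz_minimal/(_ j); rewrite /v eqxx big1 => [|i _]; last first.
  by rewrite c0 // mpolyC0 rmorph0 mulr0.
by rewrite subr0 rmorph1 => /eqP; rewrite oner_eq0.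
Qed.

Lemma forms_of_C : exists al : 'I_m1 -> 'I_3 -> k, forall j, C j = \sum_i kc (al j i) * x i.
Proof.
have H j : exists al : 'I_3 -> k, C j = \sum_i kc (al i) * x i.
  have := C_deg j; rewrite delta_eq1 => -[p /linear_form[al ->] ->]; exists al.
  by rewrite -[LHS]/(pi _) rmorph_sum; apply: eq_bigr => i _ /=; rewrite -mul_mpolyC rmorphM.
by have /choice[al alE] := H; exists al.
Qed.

(** The scalar matrices [c] and [al] between the x_i and the C_j are inverse to each other, so the
    syzygies of the C_j become those of x, y, z, and kappa consists of the Koszul syzygies. As all
    C_j have degree 1, one shift a1 = a0 - 1 serves all coordinates. *)
Lemma syzygy_coordinates : exists (w : gsyz2 F -> 'I_3 -> A) (kappa : 'I_3 -> gsyz2 F)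
    (a1 : int),
  [/\ forall a u v i, w (a *: u + v) i = a * w u i + w v i,
      forall b i, w (kappa b) i = cross (unitv A b) (fun i => x i) i,
      forall j u, x j *: u =
        w u (nx j) *: kappa (nx (nx j)) + (- w u (nx (nx j))) *: kappa (nx j),
      \sum_a x a *: kappa a = 0
    & (forall e u, gdeg e u -> forall i, rdeg (e + a1) (w u i)) /\
      (forall b, gdeg (1 - a1) (kappa b))].
Proof.
have [c [xE _]] := coords_of_x; have [al CE] := forms_of_C.
have kcM a b : kc (a * b) = kc a * kc b by rewrite mpolyCM rmorphM.
have kc_sum (I : finType) (g : I -> k) : kc (\sum_i g i) = \sum_i kc (g i).
  by rewrite (raddf_sum (@mpolyC 3 k)) rmorph_sum.
have ca i i' : \sum_j c i j * al j i' = (i == i')%:R.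
  apply/eqP; rewrite -subr_eq0; apply/eqP; move: i'.
  apply: x_indep; under eq_bigr => i' _ do rewrite mpolyCB rmorphB mulrBl.
  rewrite sumrB [X in _ - X](_ : _ = x i); last first.
    rewrite (bigD1 i) //= eqxx mpolyC1 rmorph1 mul1r big1 ?addr0 // => l li.
    by rewrite eq_sym (negPf li) mpolyC0 rmorph0 mul0r.
  apply/eqP; rewrite subr_eq0; apply/eqP; rewrite [RHS]xE.
  under [RHS]eq_bigr => j _ do rewrite CE mulr_sumr.
  rewrite exchange_big /=; apply: eq_bigr => i' _; rewrite kc_sum mulr_suml.
  by apply: eq_bigr => j _; rewrite kcM mulrA.
(* By minimality a relation among the C_j with constant coefficients is trivial. *)
have ac j j' : \sum_i al j i * c i j' = (j == j')%:R.
  have := @syz_minimal (fun l => kc (\sum_i al j i * c i l - (j == l)%:R)) _ j'.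
  rewrite epsC => hh; apply/eqP; rewrite -subr_eq0; apply/eqP; apply: hh.
  under eq_bigr => l _ do rewrite mpolyCB rmorphB mulrBl.
  rewrite sumrB [X in _ - X](_ : _ = C j); last first.
    rewrite (bigD1 j) //= eqxx mpolyC1 rmorph1 mul1r big1 ?addr0 // => l lj.
    by rewrite eq_sym (negPf lj) mpolyC0 rmorph0 mul0r.
  apply/eqP; rewrite subr_eq0; apply/eqP; rewrite [RHS]CE.
  under [RHS]eq_bigr => i _ do rewrite xE mulr_sumr.
  rewrite exchange_big /=; apply: eq_bigr => l _; rewrite kc_sum mulr_suml.
  by apply: eq_bigr => i _; rewrite kcM mulrA.
pose coord (u : gsyz2 F) (j : 'I_m1) : A := (val (u : ker_mod (bdry F 0%N)) : 'rV[A]_m1) 0 j.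
have coord_lin a u v j : coord (a *: u + v) j = a * coord u j + coord v j.
  rewrite /coord; have -> : val (a *: u + v : ker_mod (bdry F 0%N)) =
    a *: val (u : ker_mod (bdry F 0%N)) + val (v : ker_mod (bdry F 0%N)) by [].
  by rewrite !mxE.
have coord_ker u : \sum_j coord u j * C j = 0.
  by apply/bdry_eq0; apply/eqP; have := valP (u : ker_mod (bdry F 0%N)); rewrite unfold_in.
have coord_ext (u v : gsyz2 F) : (forall j, coord u j = coord v j) -> u = v.
  by move=> e; apply: val_inj; apply/rowP => j; exact: e.
have mk (v : 'I_m1 -> A) : \sum_j v j * C j = 0 -> exists u : gsyz2 F, forall j, coord u j = v j.
  move=> e; have kv : (\row_j v j : @gfree A _ (@Defs.shift _ _ F 1%N)) \in ker_pred (bdry F 0%N).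
    rewrite unfold_in; apply/eqP/bdry_eq0; rewrite -[RHS]e.
    by apply: eq_bigr => j _; rewrite mxE.
  exists (exist (fun u => u \in ker_pred (bdry F 0%N)) _ kv : ker_mod (bdry F 0%N)) => j.
  by rewrite /coord /= mxE.
pose w u i : A := \sum_j coord u j * kc (al j i).
have coordE u j : coord u j = \sum_i w u i * kc (c i j).
  rewrite /w; under eq_bigr => i _ do rewrite mulr_suml.
  rewrite exchange_big /= (bigD1 j) //= [X in _ + X]big1 ?addr0 => [|l lj].
    under eq_bigr => i _ do rewrite -mulrA -kcM.
    by rewrite -mulr_sumr -kc_sum ac eqxx mpolyC1 rmorph1 mulr1.
  under eq_bigr => i _ do rewrite -mulrA -kcM.
  by rewrite -mulr_sumr -kc_sum ac (negPf lj) mpolyC0 rmorph0 mulr0.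
have w_ext (u v : gsyz2 F) : (forall i, w u i = w v i) -> u = v.
  by move=> e; apply: coord_ext => j; rewrite !coordE; apply: eq_bigr => i _; rewrite e.
have w_lin a u v i : w (a *: u + v) i = a * w u i + w v i.
  rewrite /w mulr_sumr -big_split; apply: eq_bigr => j _.
  by rewrite coord_lin mulrDl mulrA.
have w_x u : \sum_i w u i * x i = 0.
  rewrite -[RHS](coord_ker u) /w; under eq_bigr => i _ do rewrite mulr_suml.
  rewrite exchange_big /=; apply: eq_bigr => j _; rewrite CE mulr_sumr.
  by apply: eq_bigr => i _; rewrite mulrA.
pose X i : A := x i.
have mkw (v : 'I_3 -> A) : \sum_i v i * X i = 0 -> exists u : gsyz2 F, forall i, w u i = v i.
  move=> e; have [|u uE] := mk (fun j => \sum_i v i * kc (c i j)).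
    under eq_bigr => j _ do rewrite mulr_suml.
    rewrite exchange_big /= -[RHS]e; apply: eq_bigr => i _; rewrite /X xE mulr_sumr.
    by apply: eq_bigr => j _; rewrite mulrA.
  exists u => i; rewrite /w; under eq_bigr => j _ do rewrite uE mulr_suml.
  rewrite exchange_big /= (bigD1 i) //= [X in _ + X]big1 ?addr0 => [|l li].
    under eq_bigr => j _ do rewrite -mulrA -kcM.
    by rewrite -mulr_sumr -kc_sum ca eqxx mpolyC1 rmorph1 mulr1.
  under eq_bigr => j _ do rewrite -mulrA -kcM.
  by rewrite -mulr_sumr -kc_sum ca (negPf li) mpolyC0 rmorph0 mulr0.
have /choice[kappa kappaE] : forall b, exists u : gsyz2 F, forall i, w u i = cross (unitv A b) X i.
  by move=> b; apply: mkw; move: b; apply: ord3P; vec3; ring.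
have s1 j : @Defs.shift _ _ F 1%N j = a0 - 1.
  by have := delta_eq1 j; rewrite /delta => e; lia.
exists w, kappa, (a0 - 1); split=> //.
- move=> j u; apply: w_ext => i.
  have w0 : w 0 i = 0.
    by have := w_lin (-1) 0 0 i; rewrite scaler0 addr0 mulN1r addrC subrr.
  rewrite w_lin -[x j *: u]addr0 w_lin w0 addr0.
  rewrite -[_ *: kappa (nx j)]addr0 w_lin w0 addr0 !kappaE -/(X j).
  have := w_x u; rewrite sum3 => e.
  transitivity (X j * w u i - unitv A j i * (w u o0 * X o0 + w u o1 * X o1 + w u o2 * X o2)).
    by rewrite [X in _ - _ * X]e mulr0 subr0.
  move: (w u) (X) => wu Y; move: j; apply: ord3P; move: i {w0}; apply: ord3P; vec3; ring.
- apply: w_ext => i.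
  have w0 : w 0 i = 0.
    by have := w_lin (-1) 0 0 i; rewrite scaler0 addr0 mulN1r addrC subrr.
  have wD u v : w (u + v) i = w u i + w v i by rewrite -[u]scale1r w_lin mul1r scale1r.
  have wZ r u : w (r *: u) i = r * w u i by rewrite -[r *: u]addr0 w_lin w0 addr0.
  rewrite sum3 !wD !wZ w0 !kappaE -!/(X _); move: (X) => Y.
  by move: i {w0 wD wZ}; apply: ord3P; vec3; ring.
split=> [e u ue i|b j].
  rewrite /w; apply: rdeg_sum => [||j]; [exact: rdeg_coord0|exact: rdeg_coordD|].
  rewrite -[e + _]addr0; apply: rdeg_coordM; last exact: rdegC.
  by have := ue j; rewrite s1 addrC.
have -> : @Defs.shift _ _ F 1%N j + (1 - (a0 - 1)) = 1 by rewrite s1; lia.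
change (rdeg 1 (coord (kappa b) j)); rewrite coordE.
apply: rdeg_sum => [||i]; [exact: rdeg_coord0|exact: rdeg_coordD|].
rewrite -(addr0 (1 : int)); apply: rdeg_coordM; last exact: rdegC.
have rN r : rdeg 1 r -> rdeg 1 (- r : A).
  move=> hr; have -> : - r = kc (-1) * r.
    by rewrite mpolyCN rmorphN mpolyC1 rmorph1 mulN1r.
  by rewrite -(add0r (1 : int)); apply: rdeg_coordM => //; exact: rdegC.
have ru l l' : rdeg 1 (unitv A b l * X l').
  rewrite /unitv; case: eqP => _; first by rewrite mul1r; exact: rdegx.
  by rewrite mul0r; exact: rdeg_coord0.
by rewrite kappaE /cross; apply: rdeg_coordD; [exact: ru|exact/rN/ru].
Qed.

End Syzygies.

End Resolution.

(** * The free rank *)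

Lemma map_poly_binomial (R S : comNzRingType) (g : {rmorphism R -> S})
    (a b c d : R) m n :
  map_poly g ((a%:P + b *: 'X) ^+ m * (c%:P + d *: 'X) ^+ n) =
  ((g a)%:P + g b *: 'X) ^+ m * ((g c)%:P + g d *: 'X) ^+ n.
Proof.
by rewrite rmorphM !rmorphXn !rmorphD /= !map_polyC !map_polyZ /= !map_polyX.
Qed.

Section Syz2.

Variables (k : closedFieldType) (f : {mpoly k[3]}) (hf : f \is 3.-homog).
Hypothesis ns : nonsingular f.
Variable F : minResolution (gresidue (coord_ring (DHomog hf))).

Local Notation A := (coord_ring (DHomog hf)).
Local Notation M := (gsyz2 F).

Lemma reg_comp_homog (L : fieldType) (phi : {rmorphism k -> L}) (t G : 'I_3 -> L)
    e d p : (forall i, reg phi t e (G i)) -> p \is d.-homog ->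
  reg phi t (e * d%:Z) (mmap phi G p).
Proof.
move=> hG; move: d p; apply: (@dhomog_ind 3 k (fun d p =>
  reg phi t (e * d%:Z) (mmap phi G p))).
- by move=> d; rewrite raddf0; exact: reg0.
- by move=> d p q hp hq; rewrite mmapD; exact: regD.
- move=> d c p hp; rewrite mmapZ -[e * _]add0r; apply: regM => //; exact: regC.
- by rewrite rmorph1 mulr0; exact: reg1.
move=> d i p hp; rewrite rmorphM /= mmapXU intS mulrDr mulr1; exact: regM.
Qed.

Lemma syz2_rank_frk q :
  [/\ rank_mod (reflexive_sym M q) = q.+1, (gfrk (reflexive_sym M q) <= q.+1)%N
    & odd q -> gfrk (reflexive_sym M q) = 0%N].
Proof.
have nl : no_line f by apply: nonsingular_no_line.
have [L [phi [t gp]]] := exists_generic_point hf nl.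
have f0 : f != 0.
  by have [v fv] := no_line_nonzero hf nl; apply: contraNneq fv => ->; rewrite raddf0.
have [h [hE hinj]] := exists_cone hf gp.
have [eps epsE] := exists_residue hf.
have [i0 i0u] := resolution_generator epsE F.
have [w [kappa [a1 [wl wk Xs Xk [wd kd]]]]] := syzygy_coordinates f0 epsE i0u hE hinj.
pose X i : A := cpi hf 'X_i.
have X0 j : X j != 0.
  apply/eqP => Xj; have /(_ _) := @x_indep _ _ hf f0 (fun i => (i == j)%:R).
  move/(_ _)/(_ j); rewrite eqxx => hh; suff : (1 : k) = 0 by move/eqP; rewrite oner_eq0.
  apply: hh; rewrite (bigD1 j) //= eqxx mpolyC1 rmorph1 mul1r -/(X j) Xj add0r.
  rewrite big1 // => i /negPf ->.
  by rewrite mpolyC0 rmorph0 mul0r.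
have dom := @coord_ring_domain _ _ hf _ _ _ gp.
have r0 := rdeg_coord0 hf; have rD := @rdeg_coordD _ _ hf.
have rM := @rdeg_coordM _ _ hf; have r1 := rdeg_coord1 hf.
have [theta thetaE] := exists_theta wl q.
split.
- exact: (rank_ddual dom X0 wl wk Xs thetaE).
- exact: (gfrk_le dom X0 wl wk Xs thetaE).
move=> qodd; rewrite /gfrk.
case: (max_natP (has_gfree_quotient (reflexive_sym M q))) => // Hn.
apply/eqP; rewrite -leqn0 leqNgt; apply/negP => n0.
have [dPhi [dP [Phi [P [[dd Phid] Porth Pd Pc PPhi]]]]] :=
  gfree_quotient_data dom r0 rD rM r1 X0 wl wk Xs Xk wd kd thetaE Hn n0.
have ns' (v : 'I_3 -> k) : (exists i, v i != 0) -> mmap idfun v f = 0 ->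
   exists i, mmap idfun v (f^`M(i)) != 0 by exact: ns.
have [G [regG nzG fG nG]] := exists_tangential hf nl ns' gp.
(* Pullback along the tangential map, from R to L; it multiplies degrees by 4. *)
have [gam gamE] := exists_clift hf (psi := mmap phi G) fG.
have gamX i : gam (X i) = G i by rewrite gamE /= mmapXU.
have regn := reg_grad hf phi t.
have nzn := grad_no_common_zero hf ns' gp.
have [j0 Gj0] := no_common_zero_neq0 nzG.
have gam_reg d r : rdeg d r -> reg phi t (4 * d) (gam r).
  case: d => [d|d]; last by move=> ->; rewrite rmorph0.
  move=> [p hp ->]; change (reg phi t (4 * d) (gam (cpi hf p))); rewrite gamE.
  exact: (@reg_comp_homog _ phi t G 4 _ _ regG hp).
have := PPhi j0 => /(congr1 gam); rewrite rmorphXn /= gamX rmorph_sum => e0.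
suff : G j0 ^+ q = 0 by apply/eqP; rewrite expf_neq0.
rewrite e0 big1 // => i _; rewrite !rmorphM.
(* The degrees add up to the odd number q, so one of them is less than q/2. *)
have [small|small] : 4 * dPhi < (2 * q)%N%:Z \/ 4 * dP < (2 * q)%N%:Z.
  have := odd_double_half q; rewrite qodd; move: (q./2) dd => m dd; lia.
- have -> : gam (Phi (standard_word q j0 i)) = 0; last by rewrite mulr0.
  apply: (tensor_vanish regn nzn nzG nG (T := fun s => gam (Phi s)) _ _ small).
  + by move=> s _; apply: gam_reg.
  + move=> s1 s2 sq; rewrite -[RHS](rmorph0 gam) -(Porth s1 s2 sq) rmorph_sum.
    by apply: eq_bigr => a _; rewrite rmorphM gamX.
  by rewrite size_standard_word // -ltnS.
have -> : gam (P j0 i) = 0; last by rewrite mulr0 mul0r.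
apply: (sym_vanish regn regG nzn nzG nG (qc := fun j i => gam (P j i)) _ _ small Gj0).
- by move=> j l _; apply: gam_reg.
- move=> j j' l _.
  have gE b a : gam (cross (unitv A b) X a) = cross (unitv L b) G a.
    by rewrite /cross rmorphB !rmorphM !gamX /unitv !rmorph_nat.
  have := congr1 gam (Pc j j' l).
  rewrite rmorphM rmorphXn /= gamX rmorph_sum => ->; apply: eq_bigr => l' _.
  rewrite !rmorphM rmorphXn rmorphN rmorph1 /= -coef_map; congr (_ * _`_l).
  by rewrite map_poly_binomial !gE.
by rewrite -ltnS.
Qed.

End Syz2.

(** The pair 2m, 2m+1 contributes at most 2m+1 to the sum of g and 4m+3 to the other sum. *)
Lemma sum_odd_vanishing (g : nat -> nat) m :
  (forall q, g q <= q.+1)%N -> (forall q, odd q -> g q = 0%N) ->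
  (2 * \sum_(0 <= q < m.*2) g q <= \sum_(0 <= q < m.*2) q.+1)%N.
Proof.
move=> gle godd; elim: m => [|m IH]; first by rewrite !big_geq.
rewrite doubleS 4?big_nat_recr //= (godd m.*2.+1) /= ?odd_double //.
have := gle m.*2; lia.
Qed.

Theorem corollary4p18 (RR : realType) (k : closedFieldType)
    (f : {mpoly k[3]}) (f_homog : f \is 3.-homog) (f_nonsing : nonsingular f)
    (F : minResolution (gresidue (coord_ring (DHomog f_homog)))) :
  symsig_exists RR (gsyz2 F) -> symsig RR (gsyz2 F) <= 2^-1.
Proof.
move=> cvu; pose u : nat -> RR := symsig_ratio RR (gsyz2 F).
(* The ratio at N sums over q <= N, so the subsequence N = 2m+1 has complete pairs of an even and an
   odd q. *)
have odd_cvg : ((fun m => u m.*2.+1) @ \oo --> limn u)%classic.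
  apply: (@cvg_comp _ _ _ (fun m => m.*2.+1) u _ \oo%classic _ _ cvu).
  move=> A [n _ nA]; exists n => // m /= nm; apply: nA => /=; lia.
apply: (cvgr_to_le odd_cvg); apply: nearW => m.
rewrite /u /symsig_ratio.
rewrite [X in _ / X%:R](eq_bigr (fun q => q.+1)); last first.
  by move=> q _; case: (syz2_rank_frk f_nonsing F q).
rewrite ler_pdivrMr ?ltr0n; last by rewrite big_nat_recl.
rewrite mulrC ler_pdivlMr // -natrM ler_nat mulnC.
by apply: (@sum_odd_vanishing (fun q => gfrk (reflexive_sym (gsyz2 F) q)) m.+1) => q;
  case: (syz2_rank_frk f_nonsing F q).
Qed.
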